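(* Let $J$ be an open interval containing $0$ and $D=J\times J$. If $f:D\to\mathbb R^3$ is a weakly regular $C^{1M}$ asymptotic Chebyshev ps-front, then there exists a $C^0$ potential $\eta$ (that is, one given by continuous functions $\alpha,\beta:J\to\mathbb R$) such that $f=f_\eta$.
   Context: Definitions. A $C^1$ map $g$ on $D$ (coordinates $(x,y)$) is $C^{1M}$ if its mixed second partials $g_{xy},g_{yx}$ exist, are continuous and are equal. A $C^1$ map $f$ is weakly regular if $\langle f_x,f_x\rangle\ne0$ and $\langle f_y,f_y\rangle\ne0$ everywhere on $D$ (rank $2$ is not required), and Chebyshev if $\langle f_x,f_x\rangle=\langle f_y,f_y\rangle=1$ on $D$. A weakly regular $C^{1M}$ map $N:D\to\mathbb S^2$ is weakly (Lorentz) harmonic if there is a function $h:D\to\mathbb R$ with $N_{xy}=N_{yx}=hN$ on $D$. A weakly regular $C^{1M}$ map $f:D\to\mathbb R^3$ is a (weakly-regular $C^{1M}$) ps-front if there is a weakly harmonic $C^{1M}$ map $N:D\to\mathbb S^2$ with $f_x=N\times N_x$ and $f_y=-N\times N_y$. With this $N$, $f$ is asymptotic if $\ell:=-\langle f_x,N_x\rangle=0$ and $n:=-\langle f_y,N_y\rangle=0$ on $D$. The map $f_\eta$. Given continuous $\alpha,\beta:J\to\mathbb R$, the $C^0$ potential $\eta=(\eta_-\,dy,\eta_+\,dx)$ is $$\eta_-(y)=-\tfrac{i}{2}\lambda^{-1}\begin{pmatrix}0&e^{i\beta(y)}\\ e^{-i\beta(y)}&0\end{pmatrix},\qquad \eta_+(x)=\tfrac{i}{2}\lambda\begin{pmatrix}0&e^{-i\alpha(x)}\\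 e^{i\alpha(x)}&0\end{pmatrix}.$$ Here $\lambda>0$, and everything extends holomorphically to $\lambda\in\mathbb C^*$. Let $U_\pm$ solve $\partial_xU_+=U_+\eta_+$, $U_+(0,\lambda)=I$ and $\partial_yU_-=U_-\eta_-$, $U_-(0,\lambda)=I$. A loop $g(\lambda)$ is twisted if $g(-\lambda)=\sigma_3g(\lambda)\sigma_3^{-1}$, $\sigma_3=\mathrm{diag}(1,-1)$. By the Birkhoff decomposition theorem of Brander and Toda there is, for every $(x,y)\in D$, a unique factorization $U_-(y,\lambda)^{-1}U_+(x,\lambda)=L_+(x,y,\lambda)L_-(x,y,\lambda)^{-1}$ with $L_\pm$ twisted loops, holomorphic in $\lambda\in\mathbb C^*$ and $SU(2)$-valued for real $\lambda\neq0$, with $L_+=L_{+_0}+\lambda L_{+_1}+\cdots$ and $L_-=I+\lambda^{-1}L_{-_{-1}}+\cdots$; $L_\pm$ are $C^1$ in $(x,y)$. Set $\widehat U:=U_-L_+=U_+L_-$ and, with $\lambda=e^t$, $f_\eta(x,y):=\big(\partial_t\widehat U\,\widehat U^{-1}\big)\big|_{t=0}\in\mathfrak{su}(2)$. Here $\mathfrak{su}(2)$ is identified with oriented $\mathbb R^3$ with $\langle A,B\rangle=-2\,\mathrm{tr}(AB)$ and $A\times B=[A,B]$, the standard basis of $\mathbb R^3$ corresponding to $\tfrac12\begin{pmatrix}0&i\\ i&0\end{pmatrix}$, $\tfrac12\begin{pmatrix}0&-1\\ 1&0\end{pmatrix}$, $\tfrac12\begin{pmatrix}i&0\\ 0&-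i\end{pmatrix}$.
   Formalization: Since f_η(0,0)=0 always and the hypotheses are invariant under translation, f=f_η fails literally; the formal claim is f=A f_η+b with A a rotation and b a vector, and f=f_η exactly when f(0,0)=0 and N(0,0)=±e3. *)

(* Defs.v *)
From Stdlib Require Import Reals.
From Coquelicot Require Import Coquelicot.
Open Scope R_scope.

(** * Maps from D = J x J to Euclidean 3-space *)

Definition vec3 : Type := (R * R * R)%type.

Definition vc1 (v : vec3) : R := fst (fst v).
Definition vc2 (v : vec3) : R := snd (fst v).
Definition vc3 (v : vec3) : R := snd v.

Definition dot (u v : vec3) : R := vc1 u * vc1 v + vc2 u * vc2 v + vc3 u * vc3 v.

Definition cross (u v : vec3) : vec3 :=
  (vc2 u * vc3 v - vc3 u * vc2 v,
   vc3 u * vc1 v - vc1 u * vc3 v,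
   vc1 u * vc2 v - vc2 u * vc1 v).

Definition vadd (u v : vec3) : vec3 := (vc1 u + vc1 v, vc2 u + vc2 v, vc3 u + vc3 v).
Definition vscal (a : R) (v : vec3) : vec3 := (a * vc1 v, a * vc2 v, a * vc3 v).
Definition vopp (v : vec3) : vec3 := (- vc1 v, - vc2 v, - vc3 v).
Definition vzero : vec3 := (0, 0, 0).
Definition e3 : vec3 := (0, 0, 1).

Definition is_open_interval (J : R -> Prop) : Prop :=
  open J /\ forall a b x, J a -> J b -> a <= x <= b -> J x.

(* [Derive] is total: [dx] and [dy] are meaningful only together with the
   [ex_derive] clauses of [is_C1] and [is_C1M] below.  As D is open, the values of a
   map outside D affect none of the conditions imposed on D. *)
Definition dx (g : R -> R -> vec3) (x y : R) : vec3 :=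
  (Derive (fun s => vc1 (g s y)) x,
   Derive (fun s => vc2 (g s y)) x,
   Derive (fun s => vc3 (g s y)) x).

Definition dy (g : R -> R -> vec3) (x y : R) : vec3 :=
  (Derive (fun t => vc1 (g x t)) y,
   Derive (fun t => vc2 (g x t)) y,
   Derive (fun t => vc3 (g x t)) y).

Definition continuous_on_D (J : R -> Prop) (g : R -> R -> vec3) : Prop :=
  forall x y, J x -> J y ->
    continuous (fun p : R * R => g (fst p) (snd p)) (x, y).

Definition is_C1 (J : R -> Prop) (g : R -> R -> vec3) : Prop :=
  (forall x y, J x -> J y ->
     ex_derive (fun s => g s y) x /\ ex_derive (fun t => g x t) y) /\
  continuous_on_D J (dx g) /\ continuous_on_D J (dy g).

Definition is_C1M (J : R -> Prop) (g : R -> R -> vec3) : Prop :=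
  is_C1 J g /\
  (forall x y, J x -> J y ->
     ex_derive (fun t => dx g x t) y /\ ex_derive (fun s => dy g s y) x) /\
  continuous_on_D J (dy (dx g)) /\ continuous_on_D J (dx (dy g)) /\
  (forall x y, J x -> J y -> dy (dx g) x y = dx (dy g) x y).

Definition weakly_regular (J : R -> Prop) (f : R -> R -> vec3) : Prop :=
  is_C1 J f /\
  forall x y, J x -> J y ->
    dot (dx f x y) (dx f x y) <> 0 /\ dot (dy f x y) (dy f x y) <> 0.

Definition chebyshev (J : R -> Prop) (f : R -> R -> vec3) : Prop :=
  is_C1 J f /\
  forall x y, J x -> J y ->
    dot (dx f x y) (dx f x y) = 1 /\ dot (dy f x y) (dy f x y) = 1.

Definition weakly_harmonic (J : R -> Prop) (N : R -> R -> vec3) : Prop :=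
  weakly_regular J N /\ is_C1M J N /\
  (forall x y, J x -> J y -> dot (N x y) (N x y) = 1) /\
  exists h : R -> R -> R, forall x y, J x -> J y ->
    dy (dx N) x y = vscal (h x y) (N x y) /\
    dx (dy N) x y = vscal (h x y) (N x y).

(* [f] is a ps-front iff [ps_front_with J f N] for some [N]; [N] is kept
   explicit because being asymptotic refers to it. *)
Definition ps_front_with (J : R -> Prop) (f N : R -> R -> vec3) : Prop :=
  weakly_regular J f /\ is_C1M J f /\ weakly_harmonic J N /\
  forall x y, J x -> J y ->
    dx f x y = cross (N x y) (dx N x y) /\
    dy f x y = vopp (cross (N x y) (dy N x y)).

Definition asymptotic (J : R -> Prop) (f N : R -> R -> vec3) : Prop :=
  forall x y, J x -> J y ->
    - dot (dx f x y) (dx N x y) = 0 /\ - dot (dy f x y) (dy N x y) = 0.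

(* A linear map preserving the inner product and the oriented cross product,
   i.e. an element of SO(3); linearity follows from the first clause. *)
Definition rotation (A : vec3 -> vec3) : Prop :=
  (forall u v, dot (A u) (A v) = dot u v) /\
  (forall u v, cross (A u) (A v) = A (cross u v)).

(** * Complex 2x2 matrices and loops *)

Definition M2 : Type := matrix (T := C) 2 2.

Definition mat2 (a b c d : C) : M2 := ((a, (b, tt)), ((c, (d, tt)), tt)).

Definition entry (A : M2) (i j : nat) : C := coeff_mat (RtoC 0) A i j.

Definition mmul (A B : M2) : M2 := Mmult (T := C_Ring) A B.
Definition id2 : M2 := Mone (T := C_Ring).

Definition det2 (A : M2) : C :=
  (entry A 0 0 * entry A 1 1 - entry A 0 1 * entry A 1 0)%C.

Definition inv2 (A : M2) : M2 :=
  mat2 (entry A 1 1 / det2 A)%C (- entry A 0 1 / det2 A)%C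
       (- entry A 1 0 / det2 A)%C (entry A 0 0 / det2 A)%C.

Definition adjoint2 (A : M2) : M2 :=
  mat2 (Cconj (entry A 0 0)) (Cconj (entry A 1 0))
       (Cconj (entry A 0 1)) (Cconj (entry A 1 1)).

Definition SU2 (A : M2) : Prop := mmul A (adjoint2 A) = id2 /\ det2 A = RtoC 1.

Definition sigma3 : M2 := mat2 (RtoC 1) (RtoC 0) (RtoC 0) (RtoC (-1)).

(* Coquelicot puts no norm on matrices, so analysis is done entry by entry. *)

(* derivative with respect to a real variable *)
Definition is_mderive (F : R -> M2) (s : R) (dF : M2) : Prop :=
  forall i j, (i < 2)%nat -> (j < 2)%nat ->
    is_derive (K := R_AbsRing) (V := C_R_NormedModule)
      (fun s => entry (F s) i j) s (entry dF i j).

Definition holomorphic (g : C -> M2) : Prop :=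
  forall i j, (i < 2)%nat -> (j < 2)%nat -> forall l : C, l <> RtoC 0 ->
    ex_derive (K := C_AbsRing) (V := C_NormedModule)
      (fun l => entry (g l) i j) l.

Definition is_mpseries (a : nat -> M2) (z : C) (A : M2) : Prop :=
  forall i j, (i < 2)%nat -> (j < 2)%nat ->
    is_pseries (K := C_AbsRing) (V := C_NormedModule)
      (fun k => entry (a k) i j) z (entry A i j).

Definition twisted (g : C -> M2) : Prop :=
  forall l : C, l <> RtoC 0 -> g (- l)%C = mmul (mmul sigma3 (g l)) (inv2 sigma3).

Definition loop (g : C -> M2) : Prop :=
  twisted g /\ holomorphic g /\ forall r : R, r <> 0 -> SU2 (g (RtoC r)).

Definition plus_loop (g : C -> M2) : Prop :=
  loop g /\
  exists a : nat -> M2, forall l : C, l <> RtoC 0 -> is_mpseries a l (g l).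

Definition minus_loop (g : C -> M2) : Prop :=
  loop g /\
  exists a : nat -> M2, a 0%nat = id2 /\
    forall l : C, l <> RtoC 0 -> is_mpseries a (/ l)%C (g l).

(** * The map f_eta *)

(* exp(i t) *)
Definition expi (t : R) : C := (cos t, sin t).

Definition eta_minus (beta : R -> R) (y : R) (l : C) : M2 :=
  let k := (- (Ci / RtoC 2) * / l)%C in
  mat2 (RtoC 0) (k * expi (beta y))%C (k * expi (- beta y))%C (RtoC 0).

Definition eta_plus (alpha : R -> R) (x : R) (l : C) : M2 :=
  let k := (Ci / RtoC 2 * l)%C in
  mat2 (RtoC 0) (k * expi (- alpha x))%C (k * expi (alpha x))%C (RtoC 0).

(* dU/ds = U eta(s), U(0) = I, on J, for every nonzero complex parameter *)
Definition integrates
    (J : R -> Prop) (eta U : R -> C -> M2) : Prop :=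
  forall l : C, l <> RtoC 0 ->
    U 0 l = id2 /\
    forall s, J s -> is_mderive (fun r => U r l) s (mmul (U s l) (eta s l)).

Definition birkhoff (Um Up Lp Lm : C -> M2) : Prop :=
  plus_loop Lp /\ minus_loop Lm /\
  forall l : C, l <> RtoC 0 ->
    mmul (inv2 (Um l)) (Up l) = mmul (Lp l) (inv2 (Lm l)).

(* the linear isometry of oriented R^3 onto su(2) given by the chosen basis *)
Definition su2 (v : vec3) : M2 :=
  mat2 (0, vc3 v / 2) (- vc2 v / 2, vc1 v / 2)
       (vc2 v / 2, vc1 v / 2) (0, - vc3 v / 2).

(* [g] is f_eta on D for the potential given by [alpha] and [beta].  The
   solutions [Up], [Um] and the Birkhoff factors are unique, so this relation
   determines [g] on D. *)
Definition is_f_eta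
    (J : R -> Prop) (alpha beta : R -> R) (g : R -> R -> vec3) : Prop :=
  exists (Up Um : R -> C -> M2) (Lp Lm : R -> R -> C -> M2),
    integrates J (eta_plus alpha) Up /\
    integrates J (eta_minus beta) Um /\
    forall x y, J x -> J y ->
      birkhoff (Um y) (Up x) (Lp x y) (Lm x y) /\
      let Uhat l := mmul (Um y l) (Lp x y l) in
      exists V : M2,
        is_mderive (fun t => Uhat (RtoC (exp t))) 0 V /\
        su2 (g x y) = mmul V (inv2 (Uhat (RtoC 1))).

(* Since Uhat = I at the origin, f_eta vanishes there and has normal +/- e3
   (replacing N by -N gives the same ps-front).  So equality with some f_eta
   requires this normalization; a general front is brought to it by a proper
   rigid motion. *)
Definition normalized (f N : R -> R -> vec3) : Prop :=
  f 0 0 = vzero /\ (N 0 0 = e3 \/ N 0 0 = vopp e3).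

(* Main.v *)
Require Import Defs.
From Stdlib Require Import Reals Factorial Lra Lia.
From Coquelicot Require Import Coquelicot.
Open Scope R_scope.

(** Identify Euclidean 3-space with su(2) and write p = f_x, q = f_y. The front
    equations become p_y = q_x = [p, q], a multiple kappa N of the normal, together
    with N_x = [p, N] and N_y = [N, q]. For every lambda <> 0 the connection (lambda -
    1) p dx + (1 - 1/lambda) q dy is therefore flat. Let Z ([spectral]) be its
    transport from the origin, so Z_x = (lambda - 1) Z p and Z_y = (1 - 1/lambda) Z q.
    At lambda = 1 the connection vanishes and Z = 1; to first order in t, at lambda =
    exp t, it is t (p dx + q dy) = t df, so the t-derivative of Z at t = 0 is f -
    f(0,0). This already is the Sym formula for f.

    To read off a potential, Z is multiplied by the frame U ([frame]) that is parallel
    along y = 0 and along every line x = const: U_y = - q U and U_x = (p + omega N) U,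
    where omega_y = - kappa and omega = 0 on y = 0. Conjugation by U turns N into a
    constant m ([axis]) and p into a matrix a(x) ([pot_x]) independent of y; with b =
    - U^-1 q U ([pot_y]) the product Uhat = Z U ([ext_frame]) satisfies Uhat_x = Uhat
    (lambda a + omega m) and Uhat_y = Uhat b / lambda. After a constant rotation m is
    diagonal, so a and b, being orthogonal to m and of constant length, are
    off-diagonal with entries of modulus 1/2: on the two axes Uhat solves the
    equations of a potential whose angles are the arguments of a(x) and b(0,y). Only
    continuity is available for these angles because f_x need not be differentiable in
    x.

    The Birkhoff factors are explicit. The solution of L_y = L b / lambda, L = 1 on y
    = 0, is a power series in 1/lambda starting with 1; the solution of L_x = L
    (lambda a + omega m), L = 1 on x = 0, becomes, after splitting off the diagonal
    factor D ([gauge]) with D_x = omega D m, a power series in lambda. Both Uhat(0,y)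
    L_+ and Uhat(x,0) L_- equal Uhat by uniqueness for linear equations.

    The analysis rests on the Peano-Baker series [ordexp] and on the estimate
    [ordexp_perturbation], quadratic in the perturbation. The estimate gives
    holomorphy in lambda ([pencil_diff]) as well as differentiability of a transport
    along y with respect to x ([ordexp_parameter_derive]), whence flat connections
    have path-independent transport ([transport_dx]). Arguments of continuous
    circle-valued functions come from [continuous_angle]; [frame_f_eta] assembles the
    pieces. *)

(** * Complex 2 x 2 matrices as a complete normed algebra *)

Section ProdComplete.
Context (U W : CompleteNormedModule R_AbsRing).

Definition prod_lim (F : (U * W -> Prop) -> Prop) : U * W :=
  (lim (filtermap fst F), lim (filtermap snd F)).

Lemma prod_lim_cauchy (F : (U * W -> Prop) -> Prop) :
  ProperFilter F -> cauchy F ->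
  forall eps : posreal, F (ball (prod_lim F) eps).
Proof.
  intros PF HF eps.
  assert (H1 : filtermap fst F (ball (lim (filtermap fst F)) eps)).
  { apply complete_cauchy; [apply filtermap_proper_filter, PF|].
    intros e; destruct (HF e) as [x Hx]; exists (fst x).
    apply (filter_imp (ball x e) (fun y => ball (fst x) e (fst y))); [intros y Hy; apply Hy | exact Hx]. }
  assert (H2 : filtermap snd F (ball (lim (filtermap snd F)) eps)).
  { apply complete_cauchy; [apply filtermap_proper_filter, PF|].
    intros e; destruct (HF e) as [x Hx]; exists (snd x).
    apply (filter_imp (ball x e) (fun y => ball (snd x) e (snd y))); [intros y Hy; apply Hy | exact Hx]. }
  apply (filter_imp (fun y => ball (lim (filtermap fst F)) eps (fst y) /\
                              ball (lim (filtermap snd F)) eps (snd y))).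
  - intros y [A B]; split; assumption.
  - apply filter_and; assumption.
Qed.

Lemma prod_lim_close (F1 F2 : (U * W -> Prop) -> Prop) :
  filter_le F1 F2 -> filter_le F2 F1 -> close (prod_lim F1) (prod_lim F2).
Proof.
  intros H1 H2 eps; split.
  - exact (close_lim (filtermap fst F1) (filtermap fst F2)
             (fun P => H1 (fun y => P (fst y))) (fun P => H2 (fun y => P (fst y))) eps).
  - exact (close_lim (filtermap snd F1) (filtermap snd F2)
             (fun P => H1 (fun y => P (snd y))) (fun P => H2 (fun y => P (snd y))) eps).
Qed.

Definition prod_complete_mixin : CompleteSpace.mixin_of (prod_UniformSpace U W) :=
  CompleteSpace.Mixin (prod_UniformSpace U W) prod_lim prod_lim_cauchy prod_lim_close.

Definition prod_CompleteNormedModule : CompleteNormedModule R_AbsRing :=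
  CompleteNormedModule.Pack R_AbsRing (U * W)
    (CompleteNormedModule.Class R_AbsRing (U * W)
       (NormedModule.class R_AbsRing (prod_NormedModule R_AbsRing U W))
       prod_complete_mixin) (U * W).
End ProdComplete.

(** The norm of a product of normed modules is Euclidean, so matrices carry the
    Frobenius norm, which is submultiplicative. *)
Definition Mat : NormedModule R_AbsRing :=
  prod_NormedModule R_AbsRing
    (prod_NormedModule R_AbsRing C_R_NormedModule C_R_NormedModule)
    (prod_NormedModule R_AbsRing C_R_NormedModule C_R_NormedModule).

(** The same module with its completeness, which integrals and sums of series require. *)
Definition MatC : CompleteNormedModule R_AbsRing :=
  prod_CompleteNormedModule
    (prod_CompleteNormedModule C_R_CompleteNormedModule C_R_CompleteNormedModule)
    (prod_CompleteNormedModule C_R_CompleteNormedModule C_R_CompleteNormedModule).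

Definition mk (a b c d : C) : Mat := ((a, b), (c, d)).
Definition m11 (A : Mat) : C := fst (fst A).
Definition m12 (A : Mat) : C := snd (fst A).
Definition m21 (A : Mat) : C := fst (snd A).
Definition m22 (A : Mat) : C := snd (snd A).

Definition mul (A B : Mat) : Mat :=
  mk (m11 A * m11 B + m12 A * m21 B)%C (m11 A * m12 B + m12 A * m22 B)%C
     (m21 A * m11 B + m22 A * m21 B)%C (m21 A * m12 B + m22 A * m22 B)%C.
Definition mone : Mat := mk (RtoC 1) (RtoC 0) (RtoC 0) (RtoC 1).
Definition cscal (l : C) (A : Mat) : Mat :=
  mk (l * m11 A)%C (l * m12 A)%C (l * m21 A)%C (l * m22 A)%C.

Lemma mat_eq (A B : Mat) :
  m11 A = m11 B -> m12 A = m12 B -> m21 A = m21 B -> m22 A = m22 B -> A = B.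
Proof.
  destruct A as [[a b] [c d]], B as [[a' b'] [c' d']].
  unfold m11, m12, m21, m22; simpl; intros; subst; reflexivity.
Qed.

Definition madd (A B : Mat) : Mat :=
  mk (m11 A + m11 B)%C (m12 A + m12 B)%C (m21 A + m21 B)%C (m22 A + m22 B)%C.
Definition mneg (A : Mat) : Mat := mk (- m11 A)%C (- m12 A)%C (- m21 A)%C (- m22 A)%C.
Definition mnull : Mat := mk (RtoC 0) (RtoC 0) (RtoC 0) (RtoC 0).

Lemma scalE (r : R) (A : Mat) : scal r A = cscal (RtoC r) A.
Proof.
  apply mat_eq; apply injective_projections;
  unfold cscal, m11, m12, m21, m22, mk; simpl; unfold scal; simpl; unfold mult; simpl; ring.
Qed.

(** The tactic [ring] finds its carrier from the type of the left-hand side; padding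
    with an explicit complex addition makes that type syntactically [C]. *)
Lemma Cplus_0_cancel (a b : C) : (a + 0)%C = (b + 0)%C -> a = b.
Proof. rewrite !Cplus_0_r; trivial. Qed.

Lemma minus_coord (A B : Mat) : minus A B = madd A (mneg B).
Proof. reflexivity. Qed.
Lemma plus_coord (A B : Mat) : plus A B = madd A B.
Proof. reflexivity. Qed.
Lemma opp_coord (A : Mat) : opp A = mneg A.
Proof. reflexivity. Qed.
Lemma zero_coord : zero = mnull.
Proof. reflexivity. Qed.

(** Reduces an identity between matrices to four identities between complex entries. *)
Ltac mcoord :=
  repeat match goal with
  | |- context [@minus ?G ?x ?y] => rewrite (minus_coord x y : @minus G x y = _)
  | |- context [@plus ?G ?x ?y] => rewrite (plus_coord x y : @plus G x y = _)
  | |- context [@opp ?G ?x] => rewrite (opp_coord x : @opp G x = _)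
  | |- context [@zero ?G] => rewrite (zero_coord : @zero G = _)
  end; rewrite ?scalE;
  apply mat_eq; unfold mul, cscal, mone, madd, mneg, mnull, m11, m12, m21, m22, mk;
  cbn [fst snd].
Ltac mring := intros; mcoord; apply Cplus_0_cancel; ring.

Lemma mul_assoc (A B D : Mat) : mul A (mul B D) = mul (mul A B) D.
Proof. mring. Qed.
Lemma mul_1_l (A : Mat) : mul mone A = A.
Proof. mring. Qed.
Lemma mul_1_r (A : Mat) : mul A mone = A.
Proof. mring. Qed.
Lemma mul_plus_l (A B D : Mat) : mul (plus A B) D = plus (mul A D) (mul B D).
Proof. mring. Qed.
Lemma mul_minus_r (A B D : Mat) : mul A (minus B D) = minus (mul A B) (mul A D).
Proof. mring. Qed.

Lemma mul_plus_r (A B D : Mat) : mul A (plus B D) = plus (mul A B) (mul A D).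
Proof. mring. Qed.
Lemma mul_minus_l (A B D : Mat) : mul (minus A B) D = minus (mul A D) (mul B D).
Proof. mring. Qed.
Lemma mul_opp_l (A B : Mat) : mul (opp A) B = opp (mul A B).
Proof. mring. Qed.
Lemma mul_opp_r (A B : Mat) : mul A (opp B) = opp (mul A B).
Proof. mring. Qed.
Lemma mul_zero_l (A : Mat) : mul zero A = zero.
Proof. mring. Qed.
Lemma mul_zero_r (A : Mat) : mul A zero = zero.
Proof. mring. Qed.
Lemma mul_cscal_l (l : C) (A B : Mat) : mul (cscal l A) B = cscal l (mul A B).
Proof. mring. Qed.
Lemma mul_cscal_r (l : C) (A B : Mat) : mul A (cscal l B) = cscal l (mul A B).
Proof. mring. Qed.

Ltac mexpand :=
  rewrite ?scalE;
  rewrite ?mul_plus_l, ?mul_plus_r, ?mul_minus_l, ?mul_minus_r, ?mul_opp_l, ?mul_opp_r,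
    ?mul_zero_l, ?mul_zero_r, ?mul_1_l, ?mul_1_r, ?mul_cscal_l, ?mul_cscal_r, ?mul_assoc.
(** Identities with several noncommuting factors: expand into monomials first, then
    only a linear identity in the monomials is left to the entrywise [ring]. *)
Ltac mnc :=
  intros; repeat progress mexpand;
  repeat match goal with |- context [mul ?a ?b] => generalize (mul a b); intro end; mring.

Lemma norm_C (z : C) : norm (z : C_R_NormedModule) = Cmod z.
Proof.
  destruct z as [u v]. unfold Cmod; cbn [fst snd].
  change (sqrt (Rabs u ^ 2 + Rabs v ^ 2) = sqrt (u ^ 2 + v ^ 2)).
  rewrite !pow2_abs. reflexivity.
Qed.

Lemma norm_sq (A : Mat) :
  norm A = sqrt (Cmod (m11 A) ^ 2 + Cmod (m12 A) ^ 2 + Cmod (m21 A) ^ 2 + Cmod (m22 A) ^ 2).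
Proof.
  destruct A as [[a b] [c d]].
  change (sqrt (sqrt (norm (a : C_R_NormedModule) ^ 2 + norm (b : C_R_NormedModule) ^ 2) ^ 2
   + sqrt (norm (c : C_R_NormedModule) ^ 2 + norm (d : C_R_NormedModule) ^ 2) ^ 2) =
   sqrt (Cmod a ^ 2 + Cmod b ^ 2 + Cmod c ^ 2 + Cmod d ^ 2)).
  rewrite !norm_C.
  rewrite !pow2_sqrt by nra. f_equal; ring.
Qed.

Lemma norm_mul (A B : Mat) : norm (mul A B) <= norm A * norm B.
Proof.
  rewrite !norm_sq, <- sqrt_mult by nra.
  apply sqrt_le_1_alt.
  unfold mul, mk; cbn [m11 m12 m21 m22 fst snd].
  generalize (m11 A) (m12 A) (m21 A) (m22 A) (m11 B) (m12 B) (m21 B) (m22 B).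
  intros a b c d a' b' c' d'.
  assert (T : forall x y z w : C,
    Cmod (x * y + z * w)%C ^ 2 <= (Cmod x ^ 2 + Cmod z ^ 2) * (Cmod y ^ 2 + Cmod w ^ 2)).
  { intros x y z w.
    pose proof (Cmod_triangle (x * y)%C (z * w)%C) as H.
    rewrite !Cmod_mult in H.
    pose proof (Cmod_ge_0 (x * y + z * w)%C).
    apply Rle_trans with ((Cmod x * Cmod y + Cmod z * Cmod w) ^ 2); [apply pow_incr; split; assumption|].
    pose proof (pow2_ge_0 (Cmod x * Cmod w - Cmod z * Cmod y)). lra. }
  pose proof (T a a' b c'); pose proof (T a b' b d');
  pose proof (T c a' d c'); pose proof (T c b' d d').
  unfold m11, m12, m21, m22; cbn [fst snd]. lra.
Qed.

Lemma norm_cscal (l : C) (A : Mat) : norm (cscal l A) = Cmod l * norm A.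
Proof.
  rewrite !norm_sq.
  rewrite <- (sqrt_pow2 (Cmod l)) at 1 by apply Cmod_ge_0.
  rewrite <- sqrt_mult by nra. f_equal.
  unfold cscal, mk, m11, m12, m21, m22; cbn [fst snd]. rewrite !Cmod_mult. ring.
Qed.

Lemma Cmod_m11 (A : Mat) : Cmod (m11 A) <= norm A.
Proof.
  rewrite norm_sq, <- (sqrt_pow2 (Cmod _)) at 1 by apply Cmod_ge_0.
  apply sqrt_le_1_alt; nra.
Qed.
Lemma Cmod_m12 (A : Mat) : Cmod (m12 A) <= norm A.
Proof.
  rewrite norm_sq, <- (sqrt_pow2 (Cmod _)) at 1 by apply Cmod_ge_0.
  apply sqrt_le_1_alt; nra.
Qed.
Lemma Cmod_m21 (A : Mat) : Cmod (m21 A) <= norm A.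
Proof.
  rewrite norm_sq, <- (sqrt_pow2 (Cmod _)) at 1 by apply Cmod_ge_0.
  apply sqrt_le_1_alt; nra.
Qed.
Lemma Cmod_m22 (A : Mat) : Cmod (m22 A) <= norm A.
Proof.
  rewrite norm_sq, <- (sqrt_pow2 (Cmod _)) at 1 by apply Cmod_ge_0.
  apply sqrt_le_1_alt; nra.
Qed.

Lemma Rabs_fst_le (z : C) : Rabs (fst z) <= Cmod z.
Proof. eapply Rle_trans; [apply Rmax_l | apply Rmax_Cmod]. Qed.

Lemma Rabs_snd_le (z : C) : Rabs (snd z) <= Cmod z.
Proof. eapply Rle_trans; [apply Rmax_r | apply Rmax_Cmod]. Qed.

(** * Calculus of matrix-valued functions *)

Lemma is_derive_eps {V : NormedModule R_AbsRing} (f : R -> V) (x : R) (l : V) :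
  is_derive f x l <->
  forall eps : posreal, exists delta : posreal, forall y, Rabs (y - x) < delta ->
    norm (minus (minus (f y) (f x)) (scal (y - x) l)) <= eps * Rabs (y - x).
Proof.
  split.
  - intros [_ H] eps.
    destruct (H x (is_filter_lim_filter_le x (fun P HP => HP) (fun P HP => HP)) eps) as [d Hd].
    exists d; intros y Hy. apply (Hd y Hy).
  - intros H; split; [apply is_linear_scal_l|].
    intros z Hz eps.
    rewrite <- (is_filter_lim_locally_unique _ _ Hz).
    destruct (H eps) as [d Hd]; exists d; intros y Hy; apply (Hd y Hy).
Qed.

Lemma continuous_eps {V : NormedModule R_AbsRing} (f : R -> V) (x : R) :
  continuous f x <->
  forall eps : posreal, exists delta : posreal, forall y, Rabs (y - x) < delta ->
    norm (minus (f y) (f x)) < eps.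
Proof.
  pose proof (filterlim_locally_ball_norm (F := locally x) f (f x)) as E; split.
  - intros H eps; apply (proj1 E) with (eps := eps) in H.
    destruct H as [d Hd]; exists d; intros y Hy; apply (Hd y Hy).
  - intros H; apply E; intros eps; destruct (H eps) as [d Hd]; exists d; intros y Hy; apply (Hd y Hy).
Qed.

Lemma mul_diff (A B A0 B0 : Mat) :
  minus (mul A B) (mul A0 B0) = plus (mul (minus A A0) B) (mul A0 (minus B B0)).
Proof. mring. Qed.

Lemma filterlim_mul (A0 B0 : Mat) :
  filterlim (fun z : Mat * Mat => mul (fst z) (snd z))
    (filter_prod (locally A0) (locally B0)) (locally (mul A0 B0)).
Proof.
  refine (proj2 (filterlim_locally_ball_norm (U := Mat)
    (F := filter_prod (locally A0) (locally B0)) _ _) _); intros eps.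
  set (K := norm A0 + norm B0 + 1).
  assert (HK : 0 < K).
  { unfold K; pose proof (norm_ge_0 A0); pose proof (norm_ge_0 B0); lra. }
  assert (Hd : 0 < Rmin 1 (eps / (2 * K))).
  { apply Rmin_pos; [lra|]. apply Rdiv_lt_0_compat; [apply cond_pos | lra]. }
  set (d := mkposreal _ Hd).
  apply Filter_prod with (ball_norm A0 d) (ball_norm B0 d);
    [exact (locally_ball_norm (V := Mat) A0 d) | exact (locally_ball_norm (V := Mat) B0 d) |].
  intros A B HA HB; unfold ball_norm in *; simpl fst; simpl snd.
  rewrite mul_diff.
  eapply Rle_lt_trans; [apply norm_triangle|].
  eapply Rle_lt_trans; [apply Rplus_le_compat; apply norm_mul|].
  assert (E1 : d <= 1) by apply Rmin_l.
  assert (E2 : d <= eps / (2 * K)) by apply Rmin_r.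
  assert (HBn : norm B <= norm B0 + 1).
  { replace B with (plus (minus B B0) B0) by mring.
    eapply Rle_trans; [apply norm_triangle|]. lra. }
  assert (E3 : norm (minus A A0) < eps / (2 * K)) by lra.
  assert (E4 : norm (minus B B0) < eps / (2 * K)) by lra.
  pose proof (norm_ge_0 A0); pose proof (norm_ge_0 B0); pose proof (norm_ge_0 B).
  pose proof (norm_ge_0 (minus A A0)); pose proof (norm_ge_0 (minus B B0)).
  apply Rle_lt_trans with (eps / (2 * K) * (norm B0 + 1) + norm A0 * (eps / (2 * K))).
  { apply Rplus_le_compat; [apply Rmult_le_compat; lra | apply Rmult_le_compat_l; lra]. }
  replace (_ + _) with (eps / 2) by (unfold K in *; field; lra).
  pose proof (cond_pos eps); lra.
Qed.

Lemma continuous_mul {T : UniformSpace} (F G : T -> Mat) (x : T) :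
  continuous F x -> continuous G x -> continuous (fun t => mul (F t) (G t)) x.
Proof.
  intros HF HG.
  apply (filterlim_comp_2 F G mul HF HG). apply filterlim_mul.
Qed.

Lemma derive_mul_identity (F F0 G G0 F' G' : Mat) (h : R) :
  minus (minus (mul F G) (mul F0 G0)) (scal h (plus (mul F' G0) (mul F0 G'))) =
  plus (plus (mul (minus (minus F F0) (scal h F')) G)
        (scal h (mul F' (minus G G0))))
       (mul F0 (minus (minus G G0) (scal h G'))).
Proof. mnc. Qed.

Lemma is_derive_mul (F G : R -> Mat) (x : R) (F' G' : Mat) :
  is_derive F x F' -> is_derive G x G' ->
  is_derive (fun t => mul (F t) (G t)) x (plus (mul F' (G x)) (mul (F x) G')).
Proof.
  intros HF HG. apply is_derive_eps; intros eps.
  assert (CG : continuous G x) by (apply ex_derive_continuous; exists G'; exact HG).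
  rewrite is_derive_eps in HF, HG. rewrite continuous_eps in CG.
  set (K := norm (F x) + norm F' + norm (G x) + 1).
  pose proof (norm_ge_0 (F x)); pose proof (norm_ge_0 (G x)); pose proof (norm_ge_0 F').
  pose proof (cond_pos eps).
  assert (HK : 0 < K) by (unfold K; lra).
  assert (He : 0 < Rmin 1 (eps / (3 * K))).
  { apply Rmin_pos; [lra|]. apply Rdiv_lt_0_compat; lra. }
  set (e := mkposreal _ He).
  assert (E1 : e <= 1) by apply Rmin_l.
  assert (E2 : e <= eps / (3 * K)) by apply Rmin_r.
  assert (E3 : e * K <= eps / 3).
  { apply Rle_trans with (eps / (3 * K) * K); [apply Rmult_le_compat_r; lra|].
    right; field; lra. }
  destruct (HF e) as [d1 B1], (HG e) as [d2 B2], (CG e) as [d3 B3].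
  exists (mkposreal _ (Rmin_stable_in_posreal d1 (mkposreal _ (Rmin_stable_in_posreal d2 d3)))).
  simpl; intros y Hy.
  assert (Y1 : Rabs (y - x) < d1) by (eapply Rlt_le_trans; [exact Hy | apply Rmin_l]).
  assert (Y23 : Rabs (y - x) < Rmin d2 d3) by (eapply Rlt_le_trans; [exact Hy | apply Rmin_r]).
  assert (Y2 : Rabs (y - x) < d2) by (eapply Rlt_le_trans; [exact Y23 | apply Rmin_l]).
  assert (Y3 : Rabs (y - x) < d3) by (eapply Rlt_le_trans; [exact Y23 | apply Rmin_r]).
  specialize (B1 y Y1); specialize (B2 y Y2); specialize (B3 y Y3).
  rewrite derive_mul_identity.
  assert (HGn : norm (G y) <= norm (G x) + 1).
  { replace (G y) with (plus (minus (G y) (G x)) (G x)) by mring.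
    eapply Rle_trans; [apply norm_triangle|]. lra. }
  pose proof (Rabs_pos (y - x)) as Hpos. pose proof (cond_pos e) as He0.
  eapply Rle_trans; [apply norm_triangle|].
  eapply Rle_trans; [apply Rplus_le_compat_r, norm_triangle|].
  assert (T1 : norm (mul (minus (minus (F y) (F x)) (scal (y - x) F')) (G y)) <= eps / 3 * Rabs (y - x)).
  { eapply Rle_trans; [apply norm_mul|].
    apply Rle_trans with (e * Rabs (y - x) * (norm (G x) + 1)).
    - apply Rmult_le_compat; try apply norm_ge_0; assumption.
    - apply Rle_trans with (e * K * Rabs (y - x)); [|apply Rmult_le_compat_r; lra].
      replace (e * Rabs (y - x) * (norm (G x) + 1)) with (e * Rabs (y - x) * (norm (G x) + 1)) by ring.
      replace (e * K * Rabs (y - x)) with (e * Rabs (y - x) * K) by ring.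
      apply Rmult_le_compat_l; [apply Rmult_le_pos; lra | unfold K; lra]. }
  assert (T2 : norm (scal (y - x) (mul F' (minus (G y) (G x)))) <= eps / 3 * Rabs (y - x)).
  { eapply Rle_trans; [apply (norm_scal (V := Mat))|].
    change (abs (y - x)) with (Rabs (y - x)). rewrite Rmult_comm.
    apply Rmult_le_compat_r; [lra|].
    eapply Rle_trans; [apply norm_mul|].
    apply Rle_trans with (K * e); [|lra].
    apply Rmult_le_compat; try apply norm_ge_0; [unfold K; lra | lra]. }
  assert (T3 : norm (mul (F x) (minus (minus (G y) (G x)) (scal (y - x) G'))) <= eps / 3 * Rabs (y - x)).
  { eapply Rle_trans; [apply norm_mul|].
    apply Rle_trans with (K * (e * Rabs (y - x))).
    - apply Rmult_le_compat; try apply norm_ge_0; [unfold K; lra | assumption].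
    - rewrite <- Rmult_assoc. apply Rmult_le_compat_r; lra. }
  lra.
Qed.

Lemma is_derive_mul_l (M : Mat) (F : R -> Mat) (x : R) (F' : Mat) :
  is_derive F x F' -> is_derive (fun t => mul M (F t)) x (mul M F').
Proof.
  intros HF.
  replace (mul M F') with (plus (mul zero (F x)) (mul M F')) by (generalize (F x); mring).
  apply (is_derive_mul (fun _ => M)); [apply (is_derive_const (V := Mat)) | exact HF].
Qed.

Lemma is_derive_mul_r (M : Mat) (F : R -> Mat) (x : R) (F' : Mat) :
  is_derive F x F' -> is_derive (fun t => mul (F t) M) x (mul F' M).
Proof.
  intros HF.
  replace (mul F' M) with (plus (mul F' M) (mul (F x) zero)) by (generalize (F x); mring).
  apply (is_derive_mul F (fun _ => M)); [exact HF | apply (is_derive_const (V := Mat))].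
Qed.

Lemma cscal_mul (l : C) (A : Mat) : cscal l A = mul (cscal l mone) A.
Proof. mring. Qed.

Lemma is_derive_cscal (l : C) (F : R -> Mat) (x : R) (F' : Mat) :
  is_derive F x F' -> is_derive (fun t => cscal l (F t)) x (cscal l F').
Proof.
  intros HF. rewrite cscal_mul.
  apply (is_derive_ext (fun t => mul (cscal l mone) (F t))).
  - intros t; symmetry; apply cscal_mul.
  - apply is_derive_mul_l, HF.
Qed.

Lemma is_derive_scal_const (r : R) (F : R -> Mat) (x : R) (F' : Mat) :
  is_derive F x F' -> is_derive (fun t => scal r (F t)) x (scal r F').
Proof.
  intros HF. rewrite scalE.
  apply (is_derive_ext (fun t => cscal r (F t))).
  - intros t; symmetry; apply scalE.
  - apply is_derive_cscal, HF.
Qed.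

Lemma continuous_cscal {T : UniformSpace} (l : C) (F : T -> Mat) (x : T) :
  continuous F x -> continuous (fun t => cscal l (F t)) x.
Proof.
  intros HF. apply (continuous_ext (fun t => mul (cscal l mone) (F t))).
  - intros t; symmetry; apply cscal_mul.
  - apply continuous_mul; [apply continuous_const | exact HF].
Qed.

Lemma is_derive_scal_fun (f : R -> R) (G : R -> Mat) (x f' : R) (G' : Mat) :
  is_derive f x f' -> is_derive G x G' ->
  is_derive (fun t => scal (f t) (G t)) x (plus (scal f' (G x)) (scal (f x) G')).
Proof.
  intros Hf HG.
  apply (is_derive_ext (fun t => mul (scal (f t) mone) (G t))).
  { intros t. generalize (f t) (G t). mring. }
  replace (plus (scal f' (G x)) (scal (f x) G')) with
    (plus (mul (scal f' mone) (G x)) (mul (scal (f x) mone) G')) by mring.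
  apply (is_derive_mul (fun t => scal (f t) mone)); [|exact HG].
  apply (is_derive_scal_l (K := R_AbsRing) (V := Mat)), Hf.
Qed.

Definition cont_on {V : UniformSpace} (J : R -> Prop) (f : R -> V) : Prop :=
  forall t, J t -> continuous f t.

Lemma interval_conv (J : R -> Prop) (a b t : R) :
  is_open_interval J -> J a -> J b -> Rmin a b <= t <= Rmax a b -> J t.
Proof.
  intros [_ HJ] Ha Hb.
  unfold Rmin, Rmax; destruct (Rle_dec a b); intros Ht.
  - exact (HJ a b t Ha Hb Ht).
  - exact (HJ b a t Hb Ha Ht).
Qed.

Lemma Rabs_segment (s t : R) : Rmin 0 s <= t <= Rmax 0 s -> Rabs t <= Rabs s.
Proof.
  unfold Rmin, Rmax; destruct (Rle_dec 0 s); intros H;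
    unfold Rabs; destruct (Rcase_abs t), (Rcase_abs s); lra.
Qed.

(** Most identities between solutions of differential equations below are proved by
    differentiating a suitable combination and evaluating it at the origin. *)
Lemma const_of_derive_zero {V : NormedModule R_AbsRing} (J : R -> Prop) (F : R -> V) (a b : R) :
  is_open_interval J -> J a -> J b ->
  (forall t, J t -> is_derive F t zero) -> F b = F a.
Proof.
  intros HJ Ha Hb HF.
  destruct (Rtotal_order a b) as [H | [-> | H]]; [|reflexivity|].
  - symmetry; apply eq_is_derive; [|exact H].
    intros t Ht; apply HF; destruct HJ as [_ HJ]; exact (HJ a b t Ha Hb Ht).
  - apply eq_is_derive; [|exact H].
    intros t Ht; apply HF; destruct HJ as [_ HJ]; exact (HJ b a t Hb Ha Ht).
Qed.

Lemma continuous_pair {T U W : UniformSpace} (f : T -> U) (g : T -> W) (x : T) :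
  continuous f x -> continuous g x -> continuous (fun t => (f t, g t)) x.
Proof.
  intros Hf Hg.
  refine (proj2 (filterlim_locally (F := locally x) (fun t => (f t, g t)) (f x, g x)) _).
  intros eps.
  apply (filter_and (F := locally x)).
  - exact (proj1 (filterlim_locally (F := locally x) f (f x)) Hf eps).
  - exact (proj1 (filterlim_locally (F := locally x) g (g x)) Hg eps).
Qed.

Lemma is_derive_contraction {V W : NormedModule R_AbsRing} (L : V -> W) (F : R -> V) (x : R) (F' : V) :
  (forall a b, L (minus a b) = minus (L a) (L b)) ->
  (forall r a, L (scal r a) = scal r (L a)) ->
  (forall a, norm (L a) <= norm a) ->
  is_derive F x F' -> is_derive (fun t => L (F t)) x (L F').
Proof.
  intros H1 H2 H3 HF. apply is_derive_eps; intros eps.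
  destruct (proj1 (is_derive_eps _ _ _) HF eps) as [d Hd].
  exists d; intros y Hy. rewrite <- H2, <- !H1.
  eapply Rle_trans; [apply H3 | apply Hd, Hy].
Qed.

Lemma continuous_contraction {T : UniformSpace} {V W : NormedModule R_AbsRing} (L : V -> W) (F : T -> V) (x : T) :
  (forall a b, L (minus a b) = minus (L a) (L b)) ->
  (forall a, norm (L a) <= norm a) ->
  continuous F x -> continuous (fun t => L (F t)) x.
Proof.
  intros H1 H2 HF.
  refine (proj2 (filterlim_locally_ball_norm (U := W) (F := locally x) _ _) _). intros eps.
  generalize (proj1 (filterlim_locally_ball_norm (U := V) (F := locally x) _ _) HF eps).
  apply filter_imp. intros t Ht. unfold ball_norm in *. rewrite <- H1.
  eapply Rle_lt_trans; [apply H2 | exact Ht].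
Qed.

Lemma joint_cont_1 {W : UniformSpace} (J : R -> Prop) (g : R -> R -> W) (y : R) :
  (forall x y, J x -> J y -> continuous (fun p : R * R => g (fst p) (snd p)) (x, y)) -> J y ->
  cont_on J (fun x => g x y).
Proof.
  intros H Hy x Hx.
  apply (continuous_comp (fun x => (x, y)) (fun p => g (fst p) (snd p)) x); [|apply H; assumption].
  apply continuous_pair; [apply continuous_id | apply continuous_const].
Qed.

Lemma joint_cont_2 {W : UniformSpace} (J : R -> Prop) (g : R -> R -> W) (x : R) :
  (forall x y, J x -> J y -> continuous (fun p : R * R => g (fst p) (snd p)) (x, y)) -> J x ->
  cont_on J (g x).
Proof.
  intros H Hx y Hy.
  apply (continuous_comp (fun y => (x, y)) (fun p => g (fst p) (snd p)) y); [|apply H; assumption].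
  apply continuous_pair; [apply continuous_const | apply continuous_id].
Qed.

Lemma compact_bound {V : NormedModule R_AbsRing} (f : R -> V) (a b : R) :
  (forall t, Rmin a b <= t <= Rmax a b -> continuous f t) ->
  exists M, 0 < M /\ forall t, Rmin a b <= t <= Rmax a b -> norm (f t) <= M.
Proof.
  intros Hf.
  destruct (continuity_ab_maj (fun t => norm (f t)) (Rmin a b) (Rmax a b)) as [m [Hm _]].
  - apply Rle_trans with a; [apply Rmin_l | apply Rmax_l].
  - intros t Ht. apply continuity_pt_filterlim.
    eapply filterlim_comp; [apply Hf; exact Ht | apply filterlim_norm].
  - exists (norm (f m) + 1); split.
    + pose proof (norm_ge_0 (f m)); lra.
    + intros t Ht; specialize (Hm t Ht); lra.
Qed.

(** Mean value inequality in the form that also yields derivatives: take c the value of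
    F' at one end and K small. *)
Lemma derive_increment (F F' : R -> Mat) (c : Mat) (K a b : R) :
  (forall t, Rmin a b <= t <= Rmax a b ->
     is_derive F t (F' t) /\ continuous F' t /\ norm (minus (F' t) c) <= K) ->
  norm (minus (minus (F b) (F a)) (scal (b - a) c)) <= K * Rabs (b - a).
Proof.
  intros H.
  assert (HI : is_RInt (fun t => minus (F' t) c) a b
                 (minus (minus (F b) (F a)) (scal (b - a) c))).
  { apply (is_RInt_minus (V := Mat)); [|apply (is_RInt_const (V := Mat))].
    apply (is_RInt_derive (V := MatC) F F' a b); intros t Ht; apply (H t Ht). }
  destruct (Rle_dec a b) as [Hab | Hab].
  - rewrite Rabs_pos_eq by lra. rewrite Rmult_comm.
    apply (norm_RInt_le_const (V := Mat) (fun t => minus (F' t) c)); [exact Hab | | exact HI].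
    intros t Ht; apply H. rewrite Rmin_left, Rmax_right; lra.
  - rewrite Rabs_left by lra. rewrite Rmult_comm, Ropp_minus_distr, <- norm_opp.
    apply (norm_RInt_le_const (V := Mat) (fun t => minus (F' t) c)); [lra | |].
    + intros t Ht; apply H. rewrite Rmin_right, Rmax_left; lra.
    + apply is_RInt_swap in HI. exact HI.
Qed.

Lemma derive_bound (F F' : R -> Mat) (K a b : R) :
  (forall t, Rmin a b <= t <= Rmax a b ->
     is_derive F t (F' t) /\ continuous F' t /\ norm (F' t) <= K) ->
  norm (minus (F b) (F a)) <= K * Rabs (b - a).
Proof.
  intros H.
  replace (minus (F b) (F a)) with (minus (minus (F b) (F a)) (scal (b - a) (zero : Mat))) by mring.
  apply (derive_increment F F').
  intros t Ht; destruct (H t Ht) as [H1 [H2 H3]]; split; [exact H1 | split; [exact H2|]].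
  match goal with |- norm ?z <= _ => replace z with (F' t) by mring end; exact H3.
Qed.

(** Case s < 0 follows from the case s > 0 for t -> F(-t). *)
Lemma derive_pow_bound (F F' : R -> Mat) (K s : R) (n : nat) :
  F 0 = zero ->
  (forall t, Rmin 0 s <= t <= Rmax 0 s ->
     is_derive F t (F' t) /\ continuous F' t /\ norm (F' t) <= K * Rabs t ^ n) ->
  norm (F s) <= K * Rabs s ^ S n / INR (S n).
Proof.
  assert (Hpos : forall F F' : R -> Mat, forall s, 0 <= s -> F 0 = zero ->
    (forall t, 0 <= t <= s ->
       is_derive F t (F' t) /\ continuous F' t /\ norm (F' t) <= K * Rabs t ^ n) ->
    norm (F s) <= K * Rabs s ^ S n / INR (S n)).
  { clear F F' s; intros F F' s Hs F0 H.
    replace (F s) with (minus (F s) (F 0)) by (rewrite F0; mring).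
    apply (norm_RInt_le (V := Mat) F' (fun t => K * t ^ n) 0 s); [exact Hs | | |].
    - intros t Ht. destruct (H t Ht) as [_ [_ B]]. rewrite Rabs_pos_eq in B; [exact B | lra].
    - apply (is_RInt_derive (V := MatC) F F' 0 s);
        intros t; rewrite Rmin_left, Rmax_right by exact Hs; intros Ht; apply (H t Ht).
    - rewrite Rabs_pos_eq by exact Hs.
      replace (K * s ^ S n / INR (S n)) with
        (minus (K * s ^ S n / INR (S n)) (K * 0 ^ S n / INR (S n))).
      2:{ unfold minus, plus, opp; simpl pow; simpl AbelianGroup.opp. simpl. unfold Rdiv. ring. }
      apply (is_RInt_derive (V := R_CompleteNormedModule) (fun t => K * t ^ S n / INR (S n))).
      + intros t _. auto_derive; [trivial|]. pose proof (not_0_INR (S n) ltac:(discriminate)) as Hn.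
        cbn [INR] in Hn. cbn [INR]. field. exact Hn.
      + intros t _. apply continuity_pt_filterlim. reg. }
  intros F0 H. destruct (Rle_dec 0 s) as [Hs | Hs].
  - apply (Hpos F F' s Hs F0). intros t Ht; apply H. rewrite Rmin_left, Rmax_right; lra.
  - rewrite <- (Rabs_Ropp s). rewrite <- (Ropp_involutive s) at 1.
    apply (Hpos (fun t => F (- t)) (fun t => opp (F' (- t)))); [lra | rewrite Ropp_0; exact F0 |].
    intros t Ht.
    destruct (H (- t)) as [H1 [H2 H3]]; [rewrite Rmin_right, Rmax_left; lra|].
    split; [|split].
    + replace (opp (F' (- t))) with (scal (-1) (F' (- t))) by mring.
      apply (is_derive_comp (V := Mat) F Ropp); [exact H1|].
      auto_derive; [trivial | ring].
    + apply (continuous_opp (V := Mat) (fun t => F' (- t))).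
      apply (continuous_comp Ropp F'); [|exact H2].
      apply continuity_pt_filterlim; reg.
    + rewrite norm_opp. rewrite Rabs_Ropp in H3; exact H3.
Qed.

Definition integral (f : R -> Mat) (a b : R) : Mat := RInt (V := MatC) f a b.

Section Integral.
Context (J : R -> Prop) (HJ : is_open_interval J).

Lemma is_RInt_integral (f : R -> Mat) (a b : R) :
  cont_on J f -> J a -> J b -> is_RInt f a b (integral f a b).
Proof.
  intros Hf Ha Hb. apply (RInt_correct (V := MatC)).
  apply (ex_RInt_continuous (V := MatC)).
  intros t Ht; apply Hf; exact (interval_conv J a b t HJ Ha Hb Ht).
Qed.

Lemma integral_point (f : R -> Mat) (a : R) : integral f a a = zero.
Proof. exact (RInt_point (V := MatC) a f). Qed.

Lemma is_derive_integral (f : R -> Mat) (a s : R) :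
  cont_on J f -> J a -> J s -> is_derive (integral f a) s (f s).
Proof.
  intros Hf Ha Hs. apply (is_derive_RInt (V := Mat) f _ a); [|apply Hf; exact Hs].
  destruct HJ as [Ho _]. generalize (Ho s Hs); apply filter_imp.
  intros t Ht. apply is_RInt_integral; assumption.
Qed.

End Integral.

Lemma derive_unique (F : R -> Mat) (x : R) (l l' : Mat) :
  is_derive F x l -> is_derive F x l' -> l = l'.
Proof.
  intros H H'.
  assert (E : norm (minus l l') <= 0).
  { apply le_epsilon. intros e He. rewrite Rplus_0_l.
    assert (He2 : 0 < e / 2) by lra.
    destruct (proj1 (is_derive_eps F x l) H (mkposreal _ He2)) as [d1 D1].
    destruct (proj1 (is_derive_eps F x l') H' (mkposreal _ He2)) as [d2 D2]. simpl in D1, D2.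
    set (h := Rmin d1 d2 / 2).
    assert (Hm : 0 < Rmin d1 d2) by (apply Rmin_pos; apply cond_pos).
    assert (Hh : 0 < h) by (unfold h; lra).
    pose proof (Rmin_l d1 d2); pose proof (Rmin_r d1 d2).
    assert (Eh : x + h - x = h) by ring.
    specialize (D1 (x + h)). specialize (D2 (x + h)). rewrite Eh in D1, D2.
    rewrite (Rabs_pos_eq h) in D1, D2 by lra.
    specialize (D1 ltac:(unfold h in *; lra)). specialize (D2 ltac:(unfold h in *; lra)).
    set (Y := minus (F (x + h)) (F x)) in *.
    apply Rmult_le_reg_l with h; [exact Hh|].
    replace (h * norm (minus l l')) with (norm (minus (minus Y (scal h l')) (minus Y (scal h l)))).
    - unfold minus at 1. eapply Rle_trans; [apply norm_triangle|]. rewrite norm_opp. lra.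
    - replace (minus (minus Y (scal h l')) (minus Y (scal h l))) with (scal h (minus l l'))
        by (generalize Y; mring).
      rewrite scalE, norm_cscal, Cmod_R, Rabs_pos_eq by lra. reflexivity. }
  assert (Z : minus l l' = zero).
  { apply norm_eq_zero, Rle_antisym; [exact E | apply norm_ge_0]. }
  replace l with (plus (minus l l') l') by mring. rewrite Z. mring.
Qed.

(** The first partial derivative is bounded near the point, so the values change by
    O(|u - x|) horizontally, uniformly in the other variable; vertically, continuity is
    assumed. *)
Lemma continuous_of_partial (J : R -> Prop) (F Fx : R -> R -> Mat) (x y : R) :
  is_open_interval J -> J x -> J y ->
  (forall u v, J u -> J v -> is_derive (fun u => F u v) u (Fx u v)) ->
  (forall u v, J u -> J v -> continuous (fun p : R * R => Fx (fst p) (snd p)) (u, v)) ->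
  continuous (F x) y ->
  continuous (fun p : R * R => F (fst p) (snd p)) (x, y).
Proof.
  intros HJ Hx Hy DF CF Cy.
  refine (proj2 (filterlim_locally_ball_norm (U := Mat) (F := locally (x, y)) _ _) _). intros eps.
  destruct (proj1 (filterlim_locally_ball_norm (U := Mat) (F := locally (x, y))
     (fun p : R * R => Fx (fst p) (snd p)) (Fx x y)) (CF x y Hx Hy) (mkposreal 1 Rlt_0_1)) as [d1 H1].
  destruct (proj1 HJ x Hx) as [d2 H2]. destruct (proj1 HJ y Hy) as [d3 H3].
  pose proof (cond_pos eps) as He.
  assert (He2 : 0 < eps / 2) by lra.
  destruct (proj1 (continuous_eps (F x) y) Cy (mkposreal _ He2)) as [d4 H4]. simpl in H4.
  set (K := norm (Fx x y) + 1).
  assert (HK : 0 < K) by (unfold K; pose proof (norm_ge_0 (Fx x y)); lra).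
  assert (He3 : 0 < eps / (2 * K)) by (apply Rdiv_lt_0_compat; lra).
  set (d := mkposreal _ (Rmin_stable_in_posreal d1 (mkposreal _ (Rmin_stable_in_posreal d2
    (mkposreal _ (Rmin_stable_in_posreal d3 (mkposreal _ (Rmin_stable_in_posreal d4 (mkposreal _ He3))))))))).
  assert (Hd : d <= d1 /\ d <= d2 /\ d <= d3 /\ d <= d4 /\ d <= eps / (2 * K)).
  { unfold d; simpl. repeat split; repeat (apply Rmin_l || (eapply Rle_trans; [apply Rmin_r|]));
      apply Rle_refl. }
  destruct Hd as [E1 [E2 [E3 [E4 E5]]]].
  exists d. intros [u v] [Bu Bv]. simpl in Bu, Bv.
  change (Rabs (u - x) < d) in Bu. change (Rabs (v - y) < d) in Bv.
  assert (Jv : J v) by (apply H3; change (Rabs (v - y) < d3); lra).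
  assert (B : norm (minus (F u v) (F x v)) <= K * Rabs (u - x)).
  { apply (derive_bound (fun u => F u v) (fun u => Fx u v)). intros w Hw.
    assert (Hwx : Rabs (w - x) <= Rabs (u - x)).
    { revert Hw; unfold Rmin, Rmax; destruct (Rle_dec x u); intros Hw;
        unfold Rabs; destruct (Rcase_abs (u - x)), (Rcase_abs (w - x)); lra. }
    assert (Jw : J w) by (apply H2; change (Rabs (w - x) < d2); lra).
    split; [apply DF; assumption | split].
    - apply (continuous_comp (fun w => (w, v)) (fun p => Fx (fst p) (snd p)) w); [|apply CF; assumption].
      apply continuous_pair; [apply continuous_id | apply continuous_const].
    - assert (Hb : norm (minus (Fx w v) (Fx x y)) < 1).
      { apply (H1 (w, v)). split; simpl; [change (Rabs (w - x) < d1) | change (Rabs (v - y) < d1)]; lra. }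
      replace (Fx w v) with (plus (minus (Fx w v) (Fx x y)) (Fx x y)) by mring.
      eapply Rle_trans; [apply norm_triangle|]. unfold K; lra. }
  specialize (H4 v ltac:(lra)).
  unfold ball_norm; simpl.
  replace (minus (F u v) (F x y)) with (plus (minus (F u v) (F x v)) (minus (F x v) (F x y))) by mring.
  eapply Rle_lt_trans; [apply norm_triangle|].
  assert (K * Rabs (u - x) <= eps / 2).
  { apply Rle_trans with (K * (eps / (2 * K))); [apply Rmult_le_compat_l; lra | right; field; lra]. }
  lra.
Qed.

(** The integrand is uniformly continuous on the compact segment. *)
Lemma RInt_parameter_continuous (J : R -> Prop) (k : R -> R -> R) (x y : R) :
  is_open_interval J -> J 0 -> J x -> J y ->
  (forall u v, J u -> J v -> continuous (fun p : R * R => k (fst p) (snd p)) (u, v)) ->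
  continuous (fun u => RInt (k u) 0 y) x.
Proof.
  intros HJ HJ0 Hx Hy Ck.
  assert (Ck2 : forall u, J u -> cont_on J (k u)).
  { intros u Ju v Jv.
    apply (continuous_comp (fun v => (u, v)) (fun p => k (fst p) (snd p)) v); [|apply Ck; assumption].
    apply continuous_pair; [apply continuous_const | apply continuous_id]. }
  assert (Ex : forall u, J u -> ex_RInt (k u) 0 y).
  { intros u Ju. apply (ex_RInt_continuous (V := R_CompleteNormedModule)).
    intros t Ht. apply (Ck2 u Ju), (interval_conv J 0 y t HJ HJ0 Hy Ht). }
  apply (proj2 (continuous_eps (V := R_NormedModule) (fun u => RInt (k u) 0 y) x)).
  intros eps. pose proof (cond_pos eps) as He. pose proof (Rabs_pos y) as Hpy.
  assert (He2 : 0 < eps / (Rabs y + 1)) by (apply Rdiv_lt_0_compat; lra).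
  destruct (uniform_continuity_2d_1d (fun t u => k u t) (Rmin 0 y) (Rmax 0 y) x) with (eps := mkposreal _ He2)
    as [d Hd].
  { intros t Ht. apply continuity_2d_pt_filterlim.
    apply (continuous_comp (fun z : R * R => (snd z, fst z)) (fun p => k (fst p) (snd p)) (t, x)).
    - apply continuous_pair; [apply continuous_snd | apply continuous_fst].
    - apply Ck; [exact Hx | exact (interval_conv J 0 y t HJ HJ0 Hy Ht)]. }
  simpl in Hd. destruct (proj1 HJ x Hx) as [r Hr].
  exists (mkposreal _ (Rmin_stable_in_posreal d r)); simpl; intros u Hu.
  assert (U1 : Rabs (u - x) < d) by (eapply Rlt_le_trans; [exact Hu | apply Rmin_l]).
  assert (U2 : Rabs (u - x) < r) by (eapply Rlt_le_trans; [exact Hu | apply Rmin_r]).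
  assert (Ju : J u) by (apply Hr; exact U2).
  assert (Hb : forall t, Rmin 0 y <= t <= Rmax 0 y -> Rabs (k u t - k x t) <= eps / (Rabs y + 1)).
  { intros t Ht. left. apply Rabs_lt_between in U1. pose proof (cond_pos d).
    apply (Hd t x t u Ht); try lra. rewrite Rminus_diag, Rabs_R0. lra. }
  change (Rabs (RInt (k u) 0 y - RInt (k x) 0 y) < eps).
  rewrite <- (RInt_minus (V := R_CompleteNormedModule) (k u) (k x)) by (apply Ex; assumption).
  apply Rle_lt_trans with (Rabs y * (eps / (Rabs y + 1))).
  2:{ apply Rlt_le_trans with ((Rabs y + 1) * (eps / (Rabs y + 1))).
      - apply Rmult_lt_compat_r; lra.
      - right; field; lra. }
  destruct (Rle_dec 0 y) as [P | P].
  - rewrite Rmin_left, Rmax_right in Hb by lra.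
    apply Rle_trans with ((y - 0) * (eps / (Rabs y + 1)));
      [|apply Rmult_le_compat_r; [lra | rewrite Rabs_pos_eq; lra]].
    apply abs_RInt_le_const; [exact P | | exact Hb].
    apply (ex_RInt_minus (V := R_NormedModule)); apply Ex; assumption.
  - rewrite Rmin_right, Rmax_left in Hb by lra.
    rewrite <- (opp_RInt_swap (V := R_CompleteNormedModule)).
    2:{ apply ex_RInt_swap, (ex_RInt_minus (V := R_NormedModule)); apply Ex; assumption. }
    change (Rabs (- RInt (fun x0 => minus (k u x0) (k x x0)) y 0) <= Rabs y * (eps / (Rabs y + 1))).
    rewrite Rabs_Ropp. apply Rle_trans with ((0 - y) * (eps / (Rabs y + 1)));
      [|apply Rmult_le_compat_r; [lra | rewrite Rabs_left; lra]].
    apply abs_RInt_le_const; [lra | | exact Hb].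
    apply ex_RInt_swap, (ex_RInt_minus (V := R_NormedModule)); apply Ex; assumption.
Qed.

(** * Ordered exponentials *)

(** The n-th term of the Peano-Baker series, an n-fold iterated integral of the
    products A(t_1) ... A(t_n) over 0 < t_1 < ... < t_n < s. *)
Fixpoint dyson_term (A : R -> Mat) (n : nat) (s : R) : Mat :=
  match n with
  | O => mone
  | S n => integral (fun t => mul (dyson_term A n t) (A t)) 0 s
  end.

(** The solution of V' = V A, V(0) = 1, as the sum of the Peano-Baker series. The
    series form is used again: scaling A by lambda makes it a power series in lambda. *)
Definition ordexp (A : R -> Mat) (s : R) : Mat :=
  iota (T := MatC) (fun l => is_series (V := Mat) (fun n => dyson_term A n s) l).

Lemma fact_S_div (x : R) (n : nat) :
  x ^ n / INR (fact n) * x / INR (S n) = x ^ S n / INR (fact (S n)).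
Proof.
  rewrite fact_simpl, mult_INR. simpl pow. field.
  split; [apply INR_fact_neq_0 | apply not_0_INR; discriminate].
Qed.

Lemma exp_series (x : R) : is_series (fun n => x ^ n / INR (fact n)) (exp x).
Proof.
  generalize (is_exp_Reals x). apply is_series_ext. intros n.
  rewrite pow_n_pow. unfold scal; simpl; unfold mult; simpl. reflexivity.
Qed.

Lemma series_norm_le {V : NormedModule R_AbsRing} (u : nat -> V) (l : V) (K : R) :
  filterlim u eventually (locally l) -> (forall n, norm (u n) <= K) -> norm l <= K.
Proof.
  intros Hu HK.
  assert (HL : is_lim_seq (fun n => norm (u n)) (norm l)).
  { eapply filterlim_comp; [exact Hu | apply filterlim_norm]. }
  exact (is_lim_seq_le _ _ _ _ HK HL (is_lim_seq_const K)).
Qed.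

Lemma exp_le_compat (x y : R) : x <= y -> exp x <= exp y.
Proof. intros [H | ->]; [left; apply exp_increasing, H | right; reflexivity]. Qed.

Lemma exp_partial_sum (x : R) (n : nat) : 0 <= x ->
  sum_n (fun k => x ^ k / INR (fact k)) n <= exp x.
Proof.
  intros Hx.
  assert (P : forall k, 0 <= x ^ k / INR (fact k)).
  { intros k. apply Rdiv_le_0_compat; [apply pow_le, Hx | apply INR_fact_lt_0]. }
  assert (HL := exp_series x).
  apply (is_lim_seq_le_loc (fun _ => sum_n (fun k => x ^ k / INR (fact k)) n)
           (sum_n (fun k => x ^ k / INR (fact k))) (sum_n (fun k => x ^ k / INR (fact k)) n) (exp x)).
  - exists n. intros m Hm. induction Hm; [apply Rle_refl|].
    eapply Rle_trans; [exact IHHm|]. rewrite sum_Sn.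
    rewrite <- (Rplus_0_r (sum_n _ m)) at 1.
    exact (Rplus_le_compat_l _ _ _ (P (S m))).
  - apply is_lim_seq_const.
  - exact HL.
Qed.

Section PeanoBaker.
Context (J : R -> Prop) (HJ : is_open_interval J) (HJ0 : J 0).
Context (A : R -> Mat) (HA : cont_on J A).

Lemma dyson_term_continuous (n : nat) : cont_on J (dyson_term A n).
Proof.
  induction n as [|n IH]; intros s Hs; simpl.
  - apply continuous_const.
  - apply (ex_derive_continuous (V := Mat)). eexists.
    apply (is_derive_integral J HJ (fun t => mul (dyson_term A n t) (A t))); [|exact HJ0 | exact Hs].
    intros t Ht; apply continuous_mul; [apply IH | apply HA]; exact Ht.
Qed.

Lemma dyson_term_derive (n : nat) (s : R) :
  J s -> is_derive (dyson_term A (S n)) s (mul (dyson_term A n s) (A s)).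
Proof.
  intros Hs.
  apply (is_derive_integral J HJ (fun t => mul (dyson_term A n t) (A t))); [|exact HJ0 | exact Hs].
  intros t Ht; apply continuous_mul; [apply dyson_term_continuous | apply HA]; exact Ht.
Qed.

Lemma dyson_term_bound (M s : R) (n : nat) :
  J s -> (forall t, Rmin 0 s <= t <= Rmax 0 s -> norm (A t) <= M) ->
  norm (dyson_term A n s) <= norm mone * ((M * Rabs s) ^ n / INR (fact n)).
Proof.
  revert s; induction n as [|n IH]; intros s Hs HM.
  - simpl. lra.
  - assert (HM0 : 0 <= M).
    { apply Rle_trans with (norm (A 0)); [apply norm_ge_0 | apply HM].
      split; [apply Rmin_l | apply Rmax_l]. }
    rewrite <- fact_S_div.
    replace (norm mone * ((M * Rabs s) ^ n / INR (fact n) * (M * Rabs s) / INR (S n)))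
      with (norm mone * (M ^ n / INR (fact n)) * M * Rabs s ^ S n / INR (S n)).
    2:{ rewrite Rpow_mult_distr. simpl pow. field.
        split; [apply INR_fact_neq_0 | apply not_0_INR; discriminate]. }
    apply (derive_pow_bound _ (fun t => mul (dyson_term A n t) (A t))).
    + simpl; apply integral_point.
    + intros t Ht. pose proof (interval_conv J 0 s t HJ HJ0 Hs Ht) as HJt.
      split; [apply dyson_term_derive; exact HJt | split].
      * apply continuous_mul; [apply dyson_term_continuous | apply HA]; exact HJt.
      * eapply Rle_trans; [apply norm_mul|].
        assert (Hsub : forall u, Rmin 0 t <= u <= Rmax 0 t -> Rmin 0 s <= u <= Rmax 0 s).
        { revert Ht; unfold Rmin, Rmax; destruct (Rle_dec 0 s), (Rle_dec 0 t); intros; lra. }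
        replace (norm mone * (M ^ n / INR (fact n)) * M * Rabs t ^ n) with
          (norm mone * ((M * Rabs t) ^ n / INR (fact n)) * M)
          by (rewrite Rpow_mult_distr; field; apply INR_fact_neq_0).
        apply Rmult_le_compat; try apply norm_ge_0.
        -- apply IH; [exact HJt|]. intros u Hu; apply HM, Hsub, Hu.
        -- apply HM, Ht.
Qed.

Lemma ordexp_series (s : R) : J s -> is_series (fun n => dyson_term A n s) (ordexp A s).
Proof.
  intros Hs.
  destruct (compact_bound A 0 s) as [M [HM0 HM]].
  { intros t Ht; apply HA; exact (interval_conv J 0 s t HJ HJ0 Hs Ht). }
  assert (HE : ex_series (V := Mat) (fun n => dyson_term A n s)).
  { apply (ex_series_le (V := MatC) _ (fun n => norm mone * ((M * Rabs s) ^ n / INR (fact n)))).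
    - intros n; apply (dyson_term_bound M s n Hs HM).
    - eexists; exact (is_series_scal_l (K := R_AbsRing) (norm mone) _ _ (exp_series (M * Rabs s))). }
  destruct HE as [l Hl].
  apply (iota_correct (V := MatC) (fun l => is_series (V := Mat) (fun n => dyson_term A n s) l)).
  exists l; split; [exact Hl|].
  intros l' Hl'. apply (filterlim_locally_unique (V := Mat) _ _ _ Hl Hl').
Qed.

Lemma dyson_sum_bound (M s : R) (n : nat) :
  J s -> (forall t, Rmin 0 s <= t <= Rmax 0 s -> norm (A t) <= M) ->
  norm (sum_n (fun k => dyson_term A k s) n) <= norm mone * exp (M * Rabs s).
Proof.
  intros Hs HM.
  assert (HM0 : 0 <= M).
  { apply Rle_trans with (norm (A 0)); [apply norm_ge_0 | apply HM].
    split; [apply Rmin_l | apply Rmax_l]. }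
  apply Rle_trans with (norm mone * sum_n (fun k => (M * Rabs s) ^ k / INR (fact k)) n).
  - induction n as [|n IH].
    + rewrite !sum_O. apply dyson_term_bound; assumption.
    + rewrite !sum_Sn. eapply Rle_trans; [apply norm_triangle|].
      match goal with |- _ <= _ * ?p => match p with plus ?a ?b => change p with (a + b) end end. rewrite Rmult_plus_distr_l.
      apply Rplus_le_compat; [exact IH | exact (dyson_term_bound M s (S n) Hs HM)].
  - apply Rmult_le_compat_l; [apply norm_ge_0|]. apply exp_partial_sum.
    apply Rmult_le_pos; [exact HM0 | apply Rabs_pos].
Qed.

Lemma ordexp_bound (M s : R) :
  J s -> (forall t, Rmin 0 s <= t <= Rmax 0 s -> norm (A t) <= M) ->
  norm (ordexp A s) <= norm mone * exp (M * Rabs s).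
Proof.
  intros Hs HM. apply (series_norm_le _ _ _ (ordexp_series s Hs)).
  intros n; apply dyson_sum_bound; assumption.
Qed.

Lemma ordexp_0 : ordexp A 0 = mone.
Proof.
  assert (H0 : is_series (fun n => dyson_term A n 0) mone).
  { apply (filterlim_ext (fun _ => mone)); [|apply filterlim_const].
    intros n; induction n as [|n IH]; [rewrite sum_O; reflexivity|].
    rewrite sum_Sn, <- IH. simpl. rewrite integral_point. mring. }
  exact (filterlim_locally_unique (V := Mat) _ _ _ (ordexp_series 0 HJ0) H0).
Qed.

Lemma dyson_sum_derive (n : nat) (s : R) : J s ->
  is_derive (fun s => sum_n (fun k => dyson_term A k s) (S n)) s
    (mul (sum_n (fun k => dyson_term A k s) n) (A s)).
Proof.
  intros Hs; induction n as [|n IH].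
  - apply (is_derive_ext (fun s => plus mone (dyson_term A 1 s))).
    { intros t; rewrite sum_Sn, sum_O; reflexivity. }
    rewrite sum_O.
    replace (mul (dyson_term A 0 s) (A s)) with (plus zero (mul (dyson_term A 0 s) (A s))) by mring.
    apply (is_derive_plus (V := Mat)); [apply is_derive_const | apply dyson_term_derive, Hs].
  - apply (is_derive_ext (fun s => plus (sum_n (fun k => dyson_term A k s) (S n)) (dyson_term A (S (S n)) s))).
    { intros t; rewrite (sum_Sn _ (S n)); reflexivity. }
    rewrite (sum_Sn _ n), mul_plus_l.
    apply (is_derive_plus (V := Mat)); [exact IH | apply dyson_term_derive, Hs].
Qed.

Lemma dyson_sum_continuous (n : nat) : cont_on J (fun s => sum_n (fun k => dyson_term A k s) n).
Proof.
  intros s Hs; induction n as [|n IH].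
  - apply (continuous_ext (fun s => dyson_term A 0 s)); [intros; rewrite sum_O; reflexivity|].
    apply dyson_term_continuous, Hs.
  - apply (ex_derive_continuous (V := Mat)); eexists; apply dyson_sum_derive, Hs.
Qed.

(** The partial sums S_n satisfy S_(n+1)' = S_n A with bounds uniform in n, so the
    first-order increment estimate holds for S_n with a modulus independent of n and
    passes to the limit. *)
Lemma ordexp_derive (s : R) : J s -> is_derive (ordexp A) s (mul (ordexp A s) (A s)).
Proof.
  intros Hs. apply is_derive_eps; intros eps.
  destruct (proj1 HJ s Hs) as [d0 Hd0].
  (* Work on the hull of 0 and [s - r, s + r], which is a compact part of J. *)
  set (r := d0 / 2).
  assert (Hr : 0 < r) by (unfold r; pose proof (cond_pos d0); lra).
  assert (Jr : forall x, Rabs (x - s) <= r -> J x).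
  { intros x Hx. apply Hd0. unfold ball; simpl; unfold AbsRing_ball, abs, minus, plus, opp; simpl.
    unfold r in *; pose proof (cond_pos d0); unfold Rminus in Hx; lra. }
  set (a := Rmin 0 (s - r)). set (b := Rmax 0 (s + r)).
  assert (Ja : J a).
  { unfold a, Rmin; destruct (Rle_dec 0 (s - r)); [exact HJ0 | apply Jr].
    replace (s - r - s) with (- r) by ring. rewrite Rabs_Ropp, Rabs_pos_eq; lra. }
  assert (Jb : J b).
  { unfold b, Rmax; destruct (Rle_dec 0 (s + r)); [apply Jr | exact HJ0].
    replace (s + r - s) with r by ring. rewrite Rabs_pos_eq; lra. }
  destruct (compact_bound A a b) as [M [HM0 HM]].
  { intros t Ht; apply HA; exact (interval_conv J a b t HJ Ja Jb Ht). }
  assert (Hab : a <= 0 <= b) by (split; [apply Rmin_l | apply Rmax_l]).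
  assert (Hrs : a <= s - r /\ s + r <= b) by (split; [apply Rmin_r | apply Rmax_r]).
  assert (HM' : forall t, a <= t <= b -> norm (A t) <= M).
  { intros t Ht; apply HM. rewrite Rmin_left, Rmax_right; lra. }
  assert (HMs : forall x, Rabs (x - s) <= r ->
            forall t, Rmin 0 x <= t <= Rmax 0 x -> norm (A t) <= M).
  { intros x Hx t Ht; apply HM'. apply Rabs_le_between in Hx.
    revert Ht; unfold Rmin, Rmax; destruct (Rle_dec 0 x); lra. }
  set (E := norm mone * exp (M * (Rabs s + r))).
  assert (HE : forall n x, Rabs (x - s) <= r -> norm (sum_n (fun k => dyson_term A k x) n) <= E).
  { intros n x Hx. eapply Rle_trans; [apply (dyson_sum_bound M x n (Jr x Hx) (HMs x Hx))|].
    apply Rmult_le_compat_l; [apply norm_ge_0|]. apply exp_le_compat.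
    apply Rmult_le_compat_l; [lra|].
    replace x with (s + (x - s)) by ring. eapply Rle_trans; [apply Rabs_triang | lra]. }
  assert (HE0 : 0 <= E) by (apply Rle_trans with (1 := norm_ge_0 (sum_n (fun k => dyson_term A k s) 0)); apply HE; rewrite Rminus_diag, Rabs_R0; lra).
  pose proof (cond_pos eps) as Heps.
  assert (He : 0 < eps / (2 * (E + 1))) by (apply Rdiv_lt_0_compat; lra).
  destruct (proj1 (continuous_eps A s) (HA s Hs) (mkposreal _ He)) as [d1 Hd1]. simpl in Hd1.
  assert (Hd2 : 0 < eps / (2 * (E * M * M + 1))).
  { apply Rdiv_lt_0_compat; [lra|]. pose proof (Rmult_le_pos (E*M) M). nra. }
  assert (Hd : 0 < Rmin r (Rmin d1 (eps / (2 * (E * M * M + 1))))).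
  { apply Rmin_pos; [exact Hr|]. apply Rmin_pos; [apply cond_pos | exact Hd2]. }
  exists (mkposreal _ Hd); simpl; intros y Hy.
  assert (Y1 : Rabs (y - s) < r) by (eapply Rlt_le_trans; [exact Hy | apply Rmin_l]).
  assert (Y2 : Rabs (y - s) < d1).
  { eapply Rlt_le_trans; [exact Hy|]. eapply Rle_trans; [apply Rmin_r | apply Rmin_l]. }
  assert (Y3 : Rabs (y - s) < eps / (2 * (E * M * M + 1))).
  { eapply Rlt_le_trans; [exact Hy|]. eapply Rle_trans; [apply Rmin_r | apply Rmin_r]. }
  set (u := fun n => minus (minus (sum_n (fun k => dyson_term A k y) (S n)) (sum_n (fun k => dyson_term A k s) (S n)))
              (scal (y - s) (mul (sum_n (fun k => dyson_term A k s) n) (A s)))).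
  apply (series_norm_le u).
  - assert (HSy := ordexp_series y (Jr y (Rlt_le _ _ Y1))).
    assert (HSs := ordexp_series s Hs).
    assert (Hsh : forall x, J x -> filterlim (fun n => sum_n (fun k => dyson_term A k x) (S n)) eventually (locally (ordexp A x))).
    { intros x Hx. apply (filterlim_comp _ _ _ S (sum_n (fun k => dyson_term A k x)) _ eventually);
        [apply eventually_subseq; intros; lia | exact (ordexp_series x Hx)]. }
    unfold u, minus.
    refine (filterlim_comp_2 _ _ plus _ _ (filterlim_plus (V := Mat) _ _)).
    + refine (filterlim_comp_2 _ _ plus _ _ (filterlim_plus (V := Mat) _ _)).
      * apply Hsh, (Jr y (Rlt_le _ _ Y1)).
      * apply (filterlim_comp _ _ _ _ opp _ _ _ (Hsh s Hs) (filterlim_opp (V := Mat) _)).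
    + refine (filterlim_comp _ _ _ _ opp _ _ _ _ (filterlim_opp (V := Mat) _)).
      refine (filterlim_comp _ _ _ _ (scal (y - s)) _ _ _ _ (filterlim_scal_r (V := Mat) _ _)).
      refine (filterlim_comp_2 _ _ mul HSs _ (filterlim_mul _ _)).
      apply filterlim_const.
  - intros n; unfold u.
    apply (derive_increment (fun x => sum_n (fun k => dyson_term A k x) (S n))
             (fun x => mul (sum_n (fun k => dyson_term A k x) n) (A x))).
    intros t Ht.
    assert (Hts : Rabs (t - s) <= Rabs (y - s)).
    { revert Ht; unfold Rmin, Rmax; destruct (Rle_dec s y); intros Ht;
        unfold Rabs; destruct (Rcase_abs (t - s)), (Rcase_abs (y - s)); lra. }
    assert (Jt : J t) by (apply Jr; lra).
    split; [apply dyson_sum_derive; exact Jt | split].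
    { apply continuous_mul; [apply dyson_sum_continuous | apply HA]; exact Jt. }
    rewrite mul_diff.
    eapply Rle_trans; [apply norm_triangle|].
    eapply Rle_trans; [apply Rplus_le_compat; apply norm_mul|].
    assert (B1 : norm (minus (sum_n (fun k => dyson_term A k t) n) (sum_n (fun k => dyson_term A k s) n)) <= E * M * Rabs (t - s)).
    { destruct n as [|n].
      - rewrite !sum_O. cbn [dyson_term]. match goal with |- norm ?z <= _ => replace z with (zero : Mat) by mring end.
        rewrite norm_zero. pose proof (Rabs_pos (t - s)). apply Rmult_le_pos; [apply Rmult_le_pos|]; lra.
      - apply (derive_bound (fun x => sum_n (fun k => dyson_term A k x) (S n))
             (fun x => mul (sum_n (fun k => dyson_term A k x) n) (A x))).
        intros v Hv.
        assert (Hvs : Rabs (v - s) <= Rabs (t - s)).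
        { revert Hv; unfold Rmin, Rmax; destruct (Rle_dec s t); intros Hv;
            unfold Rabs; destruct (Rcase_abs (t - s)), (Rcase_abs (v - s)); lra. }
        assert (Jv : J v) by (apply Jr; lra).
        split; [apply dyson_sum_derive; exact Jv | split].
        { apply continuous_mul; [apply dyson_sum_continuous | apply HA]; exact Jv. }
        eapply Rle_trans; [apply norm_mul|].
        apply Rmult_le_compat; try apply norm_ge_0; [apply HE; lra|].
        apply HM'. assert (Hvr : Rabs (v - s) <= r) by lra. apply Rabs_le_between in Hvr. lra. }
    assert (B2 : norm (A t) <= M).
    { apply HM'. assert (Hvr : Rabs (t - s) <= r) by lra. apply Rabs_le_between in Hvr. lra. }
    assert (B3 : norm (sum_n (fun k => dyson_term A k s) n) <= E).
    { apply HE. rewrite Rminus_diag, Rabs_R0; lra. }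
    assert (B4 : norm (minus (A t) (A s)) <= eps / (2 * (E + 1))) by (left; apply Hd1; lra).
    apply Rle_trans with (E * M * Rabs (t - s) * M + E * (eps / (2 * (E + 1)))).
    { apply Rplus_le_compat; apply Rmult_le_compat; try apply norm_ge_0; assumption. }
    assert (C1 : E * (eps / (2 * (E + 1))) <= eps / 2).
    { apply Rle_trans with ((E + 1) * (eps / (2 * (E + 1)))); [apply Rmult_le_compat_r; lra|].
      right; field; lra. }
    assert (C2 : E * M * Rabs (t - s) * M <= eps / 2).
    { assert (HEM : 0 <= E * M * M) by (apply Rmult_le_pos; [apply Rmult_le_pos|]; lra).
      replace (E * M * Rabs (t - s) * M) with (E * M * M * Rabs (t - s)) by ring.
      apply Rle_trans with ((E * M * M + 1) * (eps / (2 * (E * M * M + 1)))).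
      - apply Rmult_le_compat; [exact HEM | apply Rabs_pos | lra | lra].
      - right; field; lra. }
    lra.
Qed.

Lemma ordexp_continuous : cont_on J (ordexp A).
Proof.
  intros s Hs; apply (ex_derive_continuous (V := Mat)); eexists; apply ordexp_derive, Hs.
Qed.
End PeanoBaker.

(** * Adjugate, Hermitian transpose and SU(2) *)

(** For matrices of determinant 1 this is the inverse; unlike the inverse it is linear,
    so it can be differentiated and bounded without side conditions. *)
Definition adj (A : Mat) : Mat := mk (m22 A) (- m12 A)%C (- m21 A)%C (m11 A).
Definition dagger (A : Mat) : Mat :=
  mk (Cconj (m11 A)) (Cconj (m21 A)) (Cconj (m12 A)) (Cconj (m22 A)).
Definition tracefree (A : Mat) : Prop := (m11 A + m22 A)%C = RtoC 0.

Lemma Cmod_conj (z : C) : Cmod (Cconj z) = Cmod z.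
Proof. unfold Cmod, Cconj; simpl; f_equal; ring. Qed.

Lemma norm_adj (A : Mat) : norm (adj A) = norm A.
Proof.
  rewrite !norm_sq. unfold adj, m11, m12, m21, m22, mk; cbn [fst snd].
  rewrite !Cmod_opp. f_equal; ring.
Qed.

Lemma norm_dagger (A : Mat) : norm (dagger A) = norm A.
Proof.
  rewrite !norm_sq. unfold dagger, m11, m12, m21, m22, mk; cbn [fst snd].
  rewrite !Cmod_conj. f_equal; ring.
Qed.

Lemma adj_minus (A B : Mat) : adj (minus A B) = minus (adj A) (adj B).
Proof. unfold adj; mring. Qed.
Lemma adj_scal (r : R) (A : Mat) : adj (scal r A) = scal r (adj A).
Proof. unfold adj; mring. Qed.
Lemma adj_mul (A B : Mat) : adj (mul A B) = mul (adj B) (adj A).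
Proof. unfold adj; mring. Qed.
Lemma dagger_minus (A B : Mat) : dagger (minus A B) = minus (dagger A) (dagger B).
Proof.
  destruct A as [[a b] [c d]], B as [[a' b'] [c' d']].
  unfold dagger; mcoord; apply injective_projections; simpl; ring.
Qed.
Lemma dagger_scal (r : R) (A : Mat) : dagger (scal r A) = scal r (dagger A).
Proof.
  destruct A as [[a b] [c d]].
  unfold dagger; mcoord; apply injective_projections; simpl; ring.
Qed.
Lemma dagger_mul (A B : Mat) : dagger (mul A B) = mul (dagger B) (dagger A).
Proof.
  destruct A as [[a b] [c d]], B as [[a' b'] [c' d']].
  unfold dagger; mcoord; apply injective_projections; simpl; ring.
Qed.
Lemma dagger_1 : dagger mone = mone.
Proof. unfold dagger; mcoord; apply injective_projections; simpl; ring. Qed.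
Lemma adj_1 : adj mone = mone.
Proof. unfold adj; mring. Qed.

Lemma is_derive_adj (F : R -> Mat) (x : R) (F' : Mat) :
  is_derive F x F' -> is_derive (fun t => adj (F t)) x (adj F').
Proof. apply (is_derive_contraction adj); [exact adj_minus | exact adj_scal | intros A; right; apply norm_adj]. Qed.

Lemma is_derive_dagger (F : R -> Mat) (x : R) (F' : Mat) :
  is_derive F x F' -> is_derive (fun t => dagger (F t)) x (dagger F').
Proof. apply (is_derive_contraction dagger); [exact dagger_minus | exact dagger_scal | intros A; right; apply norm_dagger]. Qed.

Lemma continuous_adj (F : R -> Mat) (x : R) :
  continuous F x -> continuous (fun t => adj (F t)) x.
Proof. apply (continuous_contraction adj); [exact adj_minus | intros A; right; apply norm_adj]. Qed.

Lemma adj_tracefree (A : Mat) : tracefree A -> adj A = opp A.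
Proof.
  intros H. assert (E : m22 A = (- m11 A)%C).
  { unfold tracefree in H. rewrite <- (Cplus_0_l (- m11 A)), <- H. ring. }
  unfold adj. rewrite E. apply mat_eq; try reflexivity.
  change (m11 A = (- m22 A)%C). rewrite E. ring.
Qed.

Lemma mul_adj_comm (A : Mat) : mul A (adj A) = mul (adj A) A.
Proof. unfold adj; mring. Qed.

Lemma mul_zero_sum (V A W A' : Mat) :
  A' = opp A -> plus (mul (mul V A) W) (mul V (mul A' W)) = zero.
Proof. intros ->; mring. Qed.

Lemma adj_adj (A : Mat) : adj (adj A) = A.
Proof. unfold adj; mring. Qed.

Lemma dagger_dagger (A : Mat) : dagger (dagger A) = A.
Proof.
  destruct A as [[a b] [c d]].
  unfold dagger; apply mat_eq; apply injective_projections; cbn; ring.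
Qed.

Lemma trace_mul (A B : Mat) :
  (m11 (mul A B) + m22 (mul A B))%C = (m11 (mul B A) + m22 (mul B A))%C.
Proof. unfold mul, mk, m11, m22; cbn [fst snd]. apply Cplus_0_cancel; ring. Qed.

Lemma tracefree_conj (A M B : Mat) : mul B A = mone -> tracefree M -> tracefree (mul (mul A M) B).
Proof.
  unfold tracefree; intros HB HM.
  rewrite trace_mul, mul_assoc, HB, mul_1_l. exact HM.
Qed.

Lemma dagger_plus (A B : Mat) : dagger (plus A B) = plus (dagger A) (dagger B).
Proof.
  destruct A as [[a b] [c d]], B as [[a' b'] [c' d']].
  unfold dagger; mcoord; apply injective_projections; simpl; ring.
Qed.

Lemma dagger_opp (A : Mat) : dagger (opp A) = opp (dagger A).
Proof.
  destruct A as [[a b] [c d]].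
  unfold dagger; mcoord; apply injective_projections; simpl; ring.
Qed.

Lemma tracefree_plus (A B : Mat) : tracefree A -> tracefree B -> tracefree (plus A B).
Proof.
  unfold tracefree; intros HA HB.
  transitivity ((m11 A + m22 A) + (m11 B + m22 B))%C.
  - rewrite plus_coord. unfold madd, mk, m11, m22; cbn [fst snd]. apply Cplus_0_cancel; ring.
  - rewrite HA, HB. ring.
Qed.

Lemma tracefree_opp (A : Mat) : tracefree A -> tracefree (opp A).
Proof.
  unfold tracefree; intros HA.
  transitivity (- (m11 A + m22 A))%C.
  - rewrite opp_coord. unfold mneg, mk, m11, m22; cbn [fst snd]. apply Cplus_0_cancel; ring.
  - rewrite HA. ring.
Qed.

Lemma tracefree_cscal (l : C) (A : Mat) : tracefree A -> tracefree (cscal l A).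
Proof.
  unfold tracefree, cscal, m11, m22, mk; cbn [fst snd]; intros H.
  transitivity (l * (fst (fst A) + snd (snd A)))%C; [apply Cplus_0_cancel; ring|].
  rewrite H. ring.
Qed.

(** The elements of su(2). *)
Definition skew (A : Mat) : Prop := dagger A = opp A /\ tracefree A.

Lemma skew_plus (A B : Mat) : skew A -> skew B -> skew (plus A B).
Proof.
  intros [A1 A2] [B1 B2]; split; [|apply tracefree_plus; assumption].
  rewrite dagger_plus, A1, B1. mring.
Qed.

Lemma skew_opp (A : Mat) : skew A -> skew (opp A).
Proof.
  intros [A1 A2]; split; [|apply tracefree_opp; assumption].
  rewrite dagger_opp, A1. mring.
Qed.

Lemma skew_scal (r : R) (A : Mat) : skew A -> skew (scal r A).
Proof.
  intros [A1 A2]; split; [|rewrite scalE; apply tracefree_cscal, A2].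
  rewrite dagger_scal, A1. mring.
Qed.

Definition SU (A : Mat) : Prop := mul A (dagger A) = mone /\ mul A (adj A) = mone.

Lemma SU_mul (A B : Mat) : SU A -> SU B -> SU (mul A B).
Proof.
  intros [A1 A2] [B1 B2]; split.
  - rewrite dagger_mul, <- mul_assoc, (mul_assoc B), B1, mul_1_l. exact A1.
  - rewrite adj_mul, <- mul_assoc, (mul_assoc B), B2, mul_1_l. exact A2.
Qed.

Lemma SU_dagger (A : Mat) : SU A -> dagger A = adj A.
Proof.
  intros [S1 S2]. rewrite <- (mul_1_l (dagger A)), <- S2, mul_adj_comm, <- mul_assoc, S1. apply mul_1_r.
Qed.

Lemma SU_1 : SU mone.
Proof. split; [rewrite dagger_1 | rewrite adj_1]; apply mul_1_l. Qed.

Lemma SU_adj (A : Mat) : SU A -> SU (adj A).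
Proof.
  intros [H1 H2]. pose proof (SU_dagger A (conj H1 H2)) as E. split.
  - rewrite <- E, dagger_dagger, E, <- mul_adj_comm. exact H2.
  - rewrite adj_adj, <- mul_adj_comm. exact H2.
Qed.

Definition rot (R0 M : Mat) : Mat := mul (mul (adj R0) M) R0.

Lemma rot_skew (R0 M : Mat) : SU R0 -> skew M -> skew (rot R0 M).
Proof.
  intros SR [M1 M2]. unfold rot.
  pose proof (SU_dagger R0 SR) as E.
  split.
  - rewrite !dagger_mul, M1, <- E, dagger_dagger. mnc.
  - apply tracefree_conj; [apply SR | exact M2].
Qed.

Lemma rot_rot (R0 M : Mat) : SU R0 -> rot (adj R0) (rot R0 M) = M.
Proof.
  intros [_ H]. unfold rot. rewrite adj_adj.
  transitivity (mul (mul (mul R0 (adj R0)) M) (mul R0 (adj R0))).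
  - generalize (adj R0). mnc.
  - rewrite H, mul_1_l. apply mul_1_r.
Qed.

Lemma rot_mul (R0 A B : Mat) : SU R0 -> rot R0 (mul A B) = mul (rot R0 A) (rot R0 B).
Proof.
  intros [_ H]. unfold rot.
  transitivity (mul (mul (adj R0) (mul A (mul (mul R0 (adj R0)) B))) R0).
  - rewrite H, mul_1_l. reflexivity.
  - generalize (adj R0). mnc.
Qed.

Lemma rot_plus (R0 A B : Mat) : rot R0 (plus A B) = plus (rot R0 A) (rot R0 B).
Proof. unfold rot. generalize (adj R0). mnc. Qed.

Lemma rot_minus (R0 A B : Mat) : rot R0 (minus A B) = minus (rot R0 A) (rot R0 B).
Proof. unfold rot. generalize (adj R0). mnc. Qed.

Lemma rot_scal_1 (R0 : Mat) (c : R) : SU R0 -> rot R0 (scal c mone) = scal c mone.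
Proof.
  intros [_ H]. unfold rot.
  transitivity (scal c (mul (adj R0) R0)); [generalize (adj R0); mnc|].
  rewrite <- mul_adj_comm, H. reflexivity.
Qed.

Lemma rot_mul_cancel (R0 M V V' : Mat) : SU R0 -> mul V V' = mone ->
  mul (rot R0 (mul M V)) (rot R0 V') = rot R0 M.
Proof.
  intros SR HV. unfold rot.
  transitivity (mul (mul (adj R0) (mul M (mul V (mul (mul R0 (adj R0)) V')))) R0).
  - generalize (adj R0). mnc.
  - rewrite (proj2 SR), mul_1_l, HV, mul_1_r. reflexivity.
Qed.

Lemma adj_rot (R0 M : Mat) : adj (rot R0 M) = rot R0 (adj M).
Proof. unfold rot. rewrite !adj_mul, adj_adj. generalize (adj R0) (adj M). mnc. Qed.

Lemma rot_derive (R0 : Mat) (F : R -> Mat) (x : R) (F' : Mat) :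
  is_derive F x F' -> is_derive (fun t => rot R0 (F t)) x (rot R0 F').
Proof. intros H. apply is_derive_mul_r, is_derive_mul_l, H. Qed.

Lemma rot_cont {T : UniformSpace} (R0 : Mat) (F : T -> Mat) (x : T) :
  continuous F x -> continuous (fun t => rot R0 (F t)) x.
Proof.
  intros H. apply continuous_mul; [|apply continuous_const].
  apply continuous_mul; [apply continuous_const | exact H].
Qed.

Section Unimodular.
Context (J : R -> Prop) (HJ : is_open_interval J) (HJ0 : J 0).

(** (V tau(V))' = V A tau(V) + V tau(A) tau(V) = 0. With tau the Hermitian transpose
    this says that V is unitary, with tau the adjugate that det V = 1. *)
Lemma involution_inverse (tau : Mat -> Mat) (A V : R -> Mat) (s : R) :
  (forall F x F', is_derive F x F' -> is_derive (fun t => tau (F t)) x (tau F')) ->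
  (forall P Q, tau (mul P Q) = mul (tau Q) (tau P)) -> tau mone = mone ->
  (forall t, J t -> tau (A t) = opp (A t)) ->
  (forall t, J t -> is_derive V t (mul (V t) (A t))) -> V 0 = mone -> J s ->
  mul (V s) (tau (V s)) = mone.
Proof.
  intros Hd Hm H1 HA HV V0 Hs.
  rewrite (const_of_derive_zero J (fun t => mul (V t) (tau (V t))) 0 s HJ HJ0 Hs).
  - rewrite V0, H1. apply mul_1_l.
  - intros t Ht. rewrite <- (mul_zero_sum (V t) (A t) (tau (V t)) (tau (A t)) (HA t Ht)).
    rewrite <- Hm. apply is_derive_mul; [|apply Hd]; apply HV, Ht.
Qed.

Context (A : R -> Mat) (HA : cont_on J A) (TA : forall t, J t -> tracefree (A t)).

Lemma ordexp_adj (s : R) : J s -> mul (ordexp A s) (adj (ordexp A s)) = mone.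
Proof.
  intros Hs. apply (involution_inverse adj A (ordexp A)); try assumption.
  - exact is_derive_adj.
  - exact adj_mul.
  - exact adj_1.
  - intros t Ht; apply adj_tracefree, TA, Ht.
  - apply ordexp_derive; assumption.
  - apply ordexp_0 with J; assumption.
Qed.

Lemma adj_ordexp (s : R) : J s -> mul (adj (ordexp A s)) (ordexp A s) = mone.
Proof. intros Hs; rewrite <- mul_adj_comm; apply ordexp_adj, Hs. Qed.

Lemma ordexp_adj_derive (s : R) : J s ->
  is_derive (fun t => adj (ordexp A t)) s (opp (mul (A s) (adj (ordexp A s)))).
Proof.
  intros Hs.
  replace (opp (mul (A s) (adj (ordexp A s)))) with (adj (mul (ordexp A s) (A s))).
  - apply is_derive_adj, (ordexp_derive J); assumption.
  - rewrite adj_mul, (adj_tracefree (A s)) by (apply TA, Hs). mring.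
Qed.

(** F V^-1 has zero derivative. *)
Lemma ordexp_unique (F : R -> Mat) (s : R) :
  (forall t, J t -> is_derive F t (mul (F t) (A t))) -> J s ->
  F s = mul (F 0) (ordexp A s).
Proof.
  intros HF Hs.
  rewrite <- (mul_1_r (F s)), <- (adj_ordexp s Hs), mul_assoc. f_equal.
  rewrite (const_of_derive_zero J (fun t => mul (F t) (adj (ordexp A t))) 0 s HJ HJ0 Hs).
  - rewrite (ordexp_0 J), adj_1, mul_1_r by assumption. reflexivity.
  - intros t Ht.
    replace (zero : Mat) with
      (plus (mul (mul (F t) (A t)) (adj (ordexp A t)))
            (mul (F t) (opp (mul (A t) (adj (ordexp A t)))))) by mring.
    apply is_derive_mul; [apply HF, Ht | apply ordexp_adj_derive, Ht].
Qed.
End Unimodular.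

Lemma ordexp_const_zero (J : R -> Prop) (A : R -> Mat) (s : R) :
  is_open_interval J -> J 0 -> cont_on J A -> (forall t, J t -> A t = zero) -> J s -> ordexp A s = mone.
Proof.
  intros HJ HJ0 CA ZA Hs.
  rewrite <- (ordexp_0 J HJ HJ0 A CA).
  apply (const_of_derive_zero J (ordexp A) 0 s HJ HJ0 Hs). intros t Ht.
  rewrite <- (mul_zero_r (ordexp A t)), <- (ZA t Ht). apply (ordexp_derive J HJ HJ0 A CA t Ht).
Qed.

Section Perturbation.
Context (J : R -> Prop) (HJ : is_open_interval J) (HJ0 : J 0).

Lemma variation_identity (V A W B : Mat) :
  plus (mul (mul V A) W) (mul V (opp (mul B W))) = mul (mul V (minus A B)) W.
Proof. mnc. Qed.

(** Variation of constants. With V_A, V_B the solutions, (V_A V_B^-1)' = V_A (A - B)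
    V_B^-1. Integrated once, this gives V_A - V_B = O(d); replacing V_A by V_B in the
    integrand then costs O(d^2). *)
Lemma ordexp_perturbation (A B : R -> Mat) (M d s : R) :
  cont_on J A -> cont_on J B -> (forall t, J t -> tracefree (B t)) -> J s ->
  (forall t, Rmin 0 s <= t <= Rmax 0 s -> norm (A t) <= M /\ norm (B t) <= M) ->
  (forall t, Rmin 0 s <= t <= Rmax 0 s -> norm (minus (A t) (B t)) <= d) ->
  norm (minus (minus (ordexp A s) (ordexp B s))
    (mul (integral (fun t => mul (mul (ordexp B t) (minus (A t) (B t))) (adj (ordexp B t))) 0 s)
       (ordexp B s)))
  <= (norm mone * exp (M * Rabs s)) ^ 5 * Rabs s ^ 2 * d ^ 2.
Proof.
  intros HA HB TB Hs HM Hd.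
  set (E := norm mone * exp (M * Rabs s)).
  assert (M0 : 0 <= M).
  { pose proof (norm_ge_0 (A 0)). destruct (HM 0) as [B1 _]; [|lra].
    split; [apply Rmin_l | apply Rmax_l]. }
  assert (d0 : 0 <= d).
  { apply Rle_trans with (1 := norm_ge_0 (minus (A 0) (B 0))), Hd; split; [apply Rmin_l | apply Rmax_l]. }
  assert (Hseg : forall t, Rmin 0 s <= t <= Rmax 0 s -> J t).
  { intros t Ht; exact (interval_conv J 0 s t HJ HJ0 Hs Ht). }
  assert (Hsub : forall t u, Rmin 0 s <= t <= Rmax 0 s -> Rmin 0 t <= u <= Rmax 0 t -> Rmin 0 s <= u <= Rmax 0 s).
  { intros t u Ht; revert Ht; unfold Rmin, Rmax; destruct (Rle_dec 0 s), (Rle_dec 0 t); intros; lra. }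
  assert (HE : forall t, Rmin 0 s <= t <= Rmax 0 s -> norm (ordexp A t) <= E /\ norm (ordexp B t) <= E).
  { intros t Ht.
    assert (Hexp : norm mone * exp (M * Rabs t) <= E).
    { apply Rmult_le_compat_l; [apply norm_ge_0|]. apply exp_le_compat.
      apply Rmult_le_compat_l; [exact M0 | apply Rabs_segment, Ht]. }
    split.
    - apply Rle_trans with (2 := Hexp).
      apply (ordexp_bound J HJ HJ0 A HA M t (Hseg t Ht)).
      intros u Hu; destruct (HM u (Hsub t u Ht Hu)) as [B1 _]; exact B1.
    - apply Rle_trans with (2 := Hexp).
      apply (ordexp_bound J HJ HJ0 B HB M t (Hseg t Ht)).
      intros u Hu; destruct (HM u (Hsub t u Ht Hu)) as [_ B1]; exact B1. }
  assert (HEA : forall t, Rmin 0 s <= t <= Rmax 0 s -> norm (ordexp A t) <= E) by (intros t Ht; destruct (HE t Ht); assumption).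
  assert (HEB : forall t, Rmin 0 s <= t <= Rmax 0 s -> norm (ordexp B t) <= E) by (intros t Ht; destruct (HE t Ht); assumption).
  clear HE.
  assert (E0 : 0 <= E) by (apply Rmult_le_pos; [apply norm_ge_0 | left; apply exp_pos]).
  assert (HW : forall t, Rmin 0 s <= t <= Rmax 0 s -> norm (adj (ordexp B t)) <= E).
  { intros t Ht; rewrite norm_adj; apply HEB, Ht. }
  assert (CV : forall F, cont_on J F -> cont_on J (ordexp F)).
  { intros F HF; apply ordexp_continuous; assumption. }
  assert (CD : cont_on J (fun t => minus (A t) (B t))).
  { intros t Ht; apply (continuous_minus (V := Mat)); [apply HA | apply HB]; exact Ht. }
  (* P compares the two solutions; P - 1 is O(d). *)
  set (P := fun t => mul (ordexp A t) (adj (ordexp B t))).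
  assert (DP : forall t, J t -> is_derive P t (mul (mul (ordexp A t) (minus (A t) (B t))) (adj (ordexp B t)))).
  { intros t Ht. rewrite <- variation_identity.
    apply is_derive_mul; [apply (ordexp_derive J) | apply (ordexp_adj_derive J)]; assumption. }
  assert (CP : forall F, cont_on J F -> cont_on J (fun t => mul (mul (F t) (minus (A t) (B t))) (adj (ordexp B t)))).
  { intros F HF t Ht. apply continuous_mul; [apply continuous_mul|].
    - apply HF, Ht.
    - apply CD, Ht.
    - apply continuous_adj, (CV B HB), Ht. }
  assert (P0 : P 0 = mone).
  { unfold P. rewrite !(ordexp_0 J), adj_1, mul_1_l by assumption. reflexivity. }
  assert (BP : forall t, Rmin 0 s <= t <= Rmax 0 s -> norm (minus (P t) mone) <= E * d * E * Rabs s).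
  { intros t Ht. rewrite <- P0.
    apply Rle_trans with (E * d * E * Rabs (t - 0)).
    - apply (derive_bound P (fun t => mul (mul (ordexp A t) (minus (A t) (B t))) (adj (ordexp B t))) (E * d * E) 0 t). intros u Hu.
      assert (Hu' := Hsub t u Ht Hu).
      split; [apply DP, Hseg, Hu' | split].
      + apply (CP (ordexp A)); [apply CV, HA | apply Hseg, Hu'].
      + eapply Rle_trans; [apply norm_mul|].
        apply Rmult_le_compat; try apply norm_ge_0; [|apply HW, Hu'].
        eapply Rle_trans; [apply norm_mul|].
        apply Rmult_le_compat; try apply norm_ge_0; [apply HEA, Hu' | apply Hd, Hu'].
    - rewrite Rminus_0_r. apply Rmult_le_compat_l; [|apply Rabs_segment, Ht].
      apply Rmult_le_pos; [apply Rmult_le_pos|]; assumption. }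
  assert (BV : forall t, Rmin 0 s <= t <= Rmax 0 s ->
            norm (minus (ordexp A t) (ordexp B t)) <= E * d * E * Rabs s * E).
  { intros t Ht.
    replace (minus (ordexp A t) (ordexp B t)) with (mul (minus (P t) mone) (ordexp B t)).
    - eapply Rle_trans; [apply norm_mul|].
      apply Rmult_le_compat; try apply norm_ge_0; [apply BP, Ht | apply HEB, Ht].
    - unfold P.
      transitivity (minus (mul (ordexp A t) (mul (adj (ordexp B t)) (ordexp B t))) (ordexp B t)).
      + generalize (ordexp A t) (ordexp B t) (adj (ordexp B t)). mring.
      + rewrite (adj_ordexp J), mul_1_r; try assumption; [reflexivity | apply Hseg, Ht]. }
  set (I := integral (fun t => mul (mul (ordexp B t) (minus (A t) (B t))) (adj (ordexp B t))) 0).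
  assert (DI : forall t, J t -> is_derive I t (mul (mul (ordexp B t) (minus (A t) (B t))) (adj (ordexp B t)))).
  { intros t Ht.
    apply (is_derive_integral J HJ (fun t => mul (mul (ordexp B t) (minus (A t) (B t))) (adj (ordexp B t))));
      try assumption. apply CP, CV, HB. }
  assert (BQ : norm (minus (minus (P s) (I s)) (minus (P 0) (I 0)))
             <= E * d * E * Rabs s * E * d * E * Rabs (s - 0)).
  { apply (derive_bound (fun t => minus (P t) (I t))
      (fun t => minus (mul (mul (ordexp A t) (minus (A t) (B t))) (adj (ordexp B t)))
                      (mul (mul (ordexp B t) (minus (A t) (B t))) (adj (ordexp B t))))).
    intros t Ht. assert (Jt := Hseg t Ht).
    split; [apply (is_derive_minus (V := Mat)); [apply DP | apply DI]; exact Jt | split].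
    - apply (continuous_minus (V := Mat)); apply CP; try assumption; apply CV; assumption.
    - match goal with |- norm ?z <= _ =>
        replace z with (mul (mul (minus (ordexp A t) (ordexp B t)) (minus (A t) (B t))) (adj (ordexp B t)))
      end.
      + eapply Rle_trans; [apply norm_mul|].
        apply Rmult_le_compat; try apply norm_ge_0; [|apply HW, Ht].
        eapply Rle_trans; [apply norm_mul|].
        apply Rmult_le_compat; try apply norm_ge_0; [apply BV, Ht | apply Hd, Ht].
      + generalize (ordexp A t) (ordexp B t) (adj (ordexp B t)) (minus (A t) (B t)). mring. }
  replace (minus (minus (ordexp A s) (ordexp B s)) (mul (I s) (ordexp B s)))
    with (mul (minus (minus (P s) (I s)) (minus (P 0) (I 0))) (ordexp B s)).
  - eapply Rle_trans; [apply norm_mul|].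
    apply Rle_trans with (E * d * E * Rabs s * E * d * E * Rabs (s - 0) * E).
    + apply Rmult_le_compat; try apply norm_ge_0; [exact BQ|].
      apply HEB. unfold Rmin, Rmax; destruct (Rle_dec 0 s); lra.
    + rewrite Rminus_0_r. right; ring.
  - rewrite P0. unfold I at 2. rewrite integral_point. unfold P.
    transitivity (minus (minus (mul (ordexp A s) (mul (adj (ordexp B s)) (ordexp B s))) (ordexp B s)) (mul (I s) (ordexp B s))).
    + generalize (ordexp A s) (ordexp B s) (adj (ordexp B s)) (I s). mring.
    + rewrite (adj_ordexp J), mul_1_r; try assumption. reflexivity.
Qed.
End Perturbation.

(** * Dependence on parameters and flat connections *)

Section ParamDependence.
Context (J : R -> Prop) (HJ : is_open_interval J) (HJ0 : J 0).
Context (Y Yx : R -> R -> Mat).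
Context (HY : forall x, J x -> cont_on J (Y x)).
Context (DY : forall x y, J x -> J y -> is_derive (fun x => Y x y) x (Yx x y)).
Context (CYx : forall x y, J x -> J y ->
           continuous (fun p : R * R => Yx (fst p) (snd p)) (x, y)).
Context (TY : forall x y, J x -> J y -> tracefree (Y x y)).

Lemma J_radius (x : R) : J x -> exists r : posreal, forall u, Rabs (u - x) < r -> J u.
Proof.
  intros Hx; destruct (proj1 HJ x Hx) as [r Hr]; exists r; intros u Hu; apply Hr, Hu.
Qed.

(** Uniform continuity of Y_x on the compact segment makes the difference quotients in
    x converge uniformly in t. *)
Lemma uniform_derivative (x s : R) (eps : posreal) : J x -> J s ->
  exists delta : posreal, forall u, Rabs (u - x) < delta ->
    J u /\ forall t, Rmin 0 s <= t <= Rmax 0 s ->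
      norm (minus (minus (Y u t) (Y x t)) (scal (u - x) (Yx x t))) <= eps * Rabs (u - x).
Proof.
  intros Hx Hs.
  destruct (uniform_continuity_2d_1d (fun t u => norm (minus (Yx u t) (Yx x t)))
              (Rmin 0 s) (Rmax 0 s) x) with (eps := eps) as [d Hd].
  { intros t Ht. assert (Jt := interval_conv J 0 s t HJ HJ0 Hs Ht).
    apply continuity_2d_pt_filterlim.
    apply (continuous_comp (fun z : R * R => minus (Yx (snd z) (fst z)) (Yx x (fst z))) norm (t, x)).
    - apply (continuous_minus (V := Mat)).
      + apply (continuous_comp (fun z : R * R => (snd z, fst z)) (fun p => Yx (fst p) (snd p)) (t, x)).
        * apply continuous_pair; [apply continuous_snd | apply continuous_fst].
        * apply CYx; assumption.
      + apply (continuous_comp fst (Yx x) (t, x)); [apply continuous_fst | exact (joint_cont_2 J Yx x CYx Hx t Jt)].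
    - apply (filterlim_norm (V := Mat)). }
  destruct (J_radius x Hx) as [r Hr].
  exists (mkposreal _ (Rmin_stable_in_posreal d r)); simpl; intros u Hu.
  assert (U1 : Rabs (u - x) < d) by (eapply Rlt_le_trans; [exact Hu | apply Rmin_l]).
  assert (U2 : Rabs (u - x) < r) by (eapply Rlt_le_trans; [exact Hu | apply Rmin_r]).
  split; [apply Hr, U2|]. intros t Ht.
  assert (Jt := interval_conv J 0 s t HJ HJ0 Hs Ht).
  apply (derive_increment (fun u => Y u t) (fun u => Yx u t)).
  intros v Hv.
  assert (Hvx : Rabs (v - x) <= Rabs (u - x)).
  { revert Hv; unfold Rmin, Rmax; destruct (Rle_dec x u); intros Hv;
      unfold Rabs; destruct (Rcase_abs (u - x)), (Rcase_abs (v - x)); lra. }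
  assert (Jv : J v) by (apply Hr; lra).
  split; [apply DY; assumption | split; [exact (joint_cont_1 J Yx t CYx Jt v Jv)|]].
  assert (Hvd : Rabs (v - x) <= d) by lra.
  apply Rabs_le_between in Hvd.
  assert (B := Hd t x t v Ht).
  assert (Z : norm (minus (Yx x t) (Yx x t)) = 0).
  { rewrite minus_eq_zero. apply norm_zero. }
  rewrite Z, Rminus_0_r, Rminus_diag, Rabs_R0 in B.
  left. apply Rle_lt_trans with (1 := Rle_abs _).
  pose proof (cond_pos d). apply B; try assumption; lra.
Qed.

(** The logarithmic derivative, with respect to the parameter x, of the solution along
    y. *)
Definition conj_integral (x y : R) : Mat :=
  integral (fun t => mul (mul (ordexp (Y x) t) (Yx x t)) (adj (ordexp (Y x) t))) 0 y.

Lemma conj_integrand_cont (x : R) (F : R -> Mat) : J x -> cont_on J F ->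
  cont_on J (fun t => mul (mul (ordexp (Y x) t) (F t)) (adj (ordexp (Y x) t))).
Proof.
  intros Hx HF t Ht.
  assert (CV : continuous (ordexp (Y x)) t) by (apply (ordexp_continuous J HJ HJ0 (Y x) (HY x Hx)), Ht).
  apply continuous_mul; [apply continuous_mul|].
  - exact CV.
  - apply HF, Ht.
  - apply continuous_adj, CV.
Qed.

Lemma split_identity (V1 V0 I T : Mat) (h : R) :
  minus (minus V1 V0) (scal h (mul T V0)) =
  plus (minus (minus V1 V0) (mul I V0)) (mul (minus I (scal h T)) V0).
Proof. mnc. Qed.

Lemma scal_conj (V D W Q : Mat) (h : R) :
  minus (mul (mul V D) W) (scal h (mul (mul V Q) W)) = mul (mul V (minus D (scal h Q))) W.
Proof. mnc. Qed.

(** Apply the quadratic estimate to Y(u,.) and Y(x,.), whose distance is O(|u - x|):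
    only the linear term survives, and there Y(u,.) - Y(x,.) may be replaced by (u - x)
    Y_x. *)
Lemma ordexp_parameter_derive (x s : R) : J x -> J s ->
  is_derive (fun x => ordexp (Y x) s) x (mul (conj_integral x s) (ordexp (Y x) s)).
Proof.
  intros Hx Hs. apply is_derive_eps; intros eps.
  assert (Hseg : forall t, Rmin 0 s <= t <= Rmax 0 s -> J t).
  { intros t Ht; exact (interval_conv J 0 s t HJ HJ0 Hs Ht). }
  assert (H0s : Rmin 0 s <= 0 <= Rmax 0 s) by (split; [apply Rmin_l | apply Rmax_l]).
  assert (Hss : Rmin 0 s <= s <= Rmax 0 s) by (split; [apply Rmin_r | apply Rmax_r]).
  destruct (compact_bound (Y x) 0 s) as [M [M0 HM]].
  { intros t Ht; apply HY; [exact Hx | apply Hseg, Ht]. }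
  destruct (compact_bound (Yx x) 0 s) as [L [L0 HL]].
  { intros t Ht; exact (joint_cont_2 J Yx x CYx Hx t (Hseg t Ht)). }
  destruct (compact_bound (ordexp (Y x)) 0 s) as [K [K0 HK]].
  { intros t Ht; apply (ordexp_continuous J HJ HJ0 (Y x) (HY x Hx)), Hseg, Ht. }
  set (N := M + (L + 1)).
  set (E := (norm mone * exp (N * Rabs s)) ^ 5 * Rabs s ^ 2 * (L + 1) ^ 2).
  assert (E0 : 0 <= E).
  { unfold E. apply Rmult_le_pos; [apply Rmult_le_pos|]; apply pow_le.
    - apply Rmult_le_pos; [apply norm_ge_0 | left; apply exp_pos].
    - apply Rabs_pos.
    - lra. }
  pose proof (cond_pos eps) as Heps.
  set (Q := K * K * Rabs s * K).
  assert (Q0 : 0 <= Q).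
  { unfold Q. pose proof (Rabs_pos s). apply Rmult_le_pos; [apply Rmult_le_pos; [apply Rmult_le_pos|]|]; lra. }
  assert (He : 0 < Rmin 1 (eps / (2 * (Q + 1)))).
  { apply Rmin_pos; [lra | apply Rdiv_lt_0_compat; lra]. }
  set (e := mkposreal _ He).
  assert (e1 : e <= 1) by apply Rmin_l.
  assert (e2 : e <= eps / (2 * (Q + 1))) by apply Rmin_r.
  destruct (uniform_derivative x s e Hx Hs) as [d Hd].
  assert (Hr : 0 < Rmin d (Rmin 1 (eps / (2 * (E + 1))))).
  { apply Rmin_pos; [apply cond_pos | apply Rmin_pos; [lra | apply Rdiv_lt_0_compat; lra]]. }
  exists (mkposreal _ Hr); simpl; intros u Hu.
  assert (U1 : Rabs (u - x) < d) by (eapply Rlt_le_trans; [exact Hu | apply Rmin_l]).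
  assert (U2 : Rabs (u - x) < 1).
  { eapply Rlt_le_trans; [exact Hu|]. eapply Rle_trans; [apply Rmin_r | apply Rmin_l]. }
  assert (U3 : Rabs (u - x) < eps / (2 * (E + 1))).
  { eapply Rlt_le_trans; [exact Hu|]. eapply Rle_trans; [apply Rmin_r | apply Rmin_r]. }
  pose proof (Rabs_pos (u - x)) as Hp.
  destruct (Hd u U1) as [Ju HU].
  assert (HD : forall t, Rmin 0 s <= t <= Rmax 0 s ->
             norm (minus (Y u t) (Y x t)) <= (L + 1) * Rabs (u - x)).
  { intros t Ht.
    replace (minus (Y u t) (Y x t)) with
      (plus (minus (minus (Y u t) (Y x t)) (scal (u - x) (Yx x t))) (scal (u - x) (Yx x t))) by mring.
    eapply Rle_trans; [apply norm_triangle|].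
    eapply Rle_trans; [apply Rplus_le_compat; [apply HU, Ht | apply (norm_scal (V := Mat))]|].
    change (abs (u - x)) with (Rabs (u - x)).
    assert (Rabs (u - x) * norm (Yx x t) <= Rabs (u - x) * L) by (apply Rmult_le_compat_l; [exact Hp | apply HL, Ht]).
    assert (e * Rabs (u - x) <= 1 * Rabs (u - x)) by (apply Rmult_le_compat_r; lra).
    lra. }
  set (I := integral (fun t => mul (mul (ordexp (Y x) t) (minus (Y u t) (Y x t))) (adj (ordexp (Y x) t))) 0).
  assert (CI : cont_on J (fun t => minus (Y u t) (Y x t))).
  { intros t Ht; apply (continuous_minus (V := Mat)); [apply HY | apply HY]; assumption. }
  assert (B1 : norm (minus (minus (ordexp (Y u) s) (ordexp (Y x) s)) (mul (I s) (ordexp (Y x) s)))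
            <= E * Rabs (u - x) ^ 2).
  { eapply Rle_trans; [apply (ordexp_perturbation J HJ HJ0 (Y u) (Y x) N ((L + 1) * Rabs (u - x)) s)|].
    - apply HY, Ju.
    - apply HY, Hx.
    - intros t Ht; apply TY; assumption.
    - exact Hs.
    - intros t Ht. specialize (HM t Ht). specialize (HD t Ht).
      assert ((L + 1) * Rabs (u - x) <= (L + 1) * 1) by (apply Rmult_le_compat_l; lra).
      split; [|unfold N; lra].
      replace (Y u t) with (plus (minus (Y u t) (Y x t)) (Y x t)) by mring.
      eapply Rle_trans; [apply norm_triangle|]. unfold N; lra.
    - exact HD.
    - unfold E. rewrite Rpow_mult_distr. right; ring. }
  assert (CYx2 := joint_cont_2 J Yx x CYx Hx).
  assert (B2 : norm (minus (I s) (scal (u - x) (conj_integral x s))) <= K * (e * Rabs (u - x)) * K * Rabs s).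
  { replace (minus (I s) (scal (u - x) (conj_integral x s))) with
      (minus (minus (I s) (scal (u - x) (conj_integral x s))) (minus (I 0) (scal (u - x) (conj_integral x 0)))).
    2:{ unfold I at 2; unfold conj_integral at 2. rewrite !integral_point.
        generalize (I s) (conj_integral x s). mring. }
    replace (Rabs s) with (Rabs (s - 0)) by (rewrite Rminus_0_r; reflexivity).
    apply (derive_bound (fun t => minus (I t) (scal (u - x) (conj_integral x t)))
      (fun t => minus (mul (mul (ordexp (Y x) t) (minus (Y u t) (Y x t))) (adj (ordexp (Y x) t)))
                  (scal (u - x) (mul (mul (ordexp (Y x) t) (Yx x t)) (adj (ordexp (Y x) t)))))).
    intros t Ht. assert (Jt := Hseg t Ht). split; [|split].
    - apply (is_derive_minus (V := Mat)).
      + apply (is_derive_integral J HJ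
          (fun t => mul (mul (ordexp (Y x) t) (minus (Y u t) (Y x t))) (adj (ordexp (Y x) t))));
          [apply (conj_integrand_cont x _ Hx CI) | exact HJ0 | exact Jt].
      + apply is_derive_scal_const.
        apply (is_derive_integral J HJ
          (fun t => mul (mul (ordexp (Y x) t) (Yx x t)) (adj (ordexp (Y x) t))));
          [apply (conj_integrand_cont x _ Hx CYx2) | exact HJ0 | exact Jt].
    - apply (continuous_minus (V := Mat)).
      + apply (conj_integrand_cont x _ Hx CI t Jt).
      + apply (continuous_scal_r (V := Mat) (u - x)).
        apply (conj_integrand_cont x _ Hx CYx2 t Jt).
    - rewrite scal_conj.
      eapply Rle_trans; [apply norm_mul|]. rewrite norm_adj.
      apply Rmult_le_compat; try apply norm_ge_0; [|apply HK, Ht].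
      eapply Rle_trans; [apply norm_mul|].
      apply Rmult_le_compat; try apply norm_ge_0; [apply HK, Ht | apply HU, Ht]. }
  rewrite (split_identity _ _ (I s)).
  eapply Rle_trans; [apply norm_triangle|].
  eapply Rle_trans; [apply Rplus_le_compat; [exact B1 | apply norm_mul]|].
  assert (C1 : E * Rabs (u - x) ^ 2 <= eps / 2 * Rabs (u - x)).
  { replace (E * Rabs (u - x) ^ 2) with (E * Rabs (u - x) * Rabs (u - x)) by ring.
    apply Rmult_le_compat_r; [exact Hp|].
    apply Rle_trans with ((E + 1) * (eps / (2 * (E + 1)))); [apply Rmult_le_compat; lra|].
    right; field; lra. }
  assert (C2 : norm (minus (I s) (scal (u - x) (conj_integral x s))) * norm (ordexp (Y x) s)
             <= eps / 2 * Rabs (u - x)).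
  { apply Rle_trans with (K * (e * Rabs (u - x)) * K * Rabs s * K).
    - apply Rmult_le_compat; try apply norm_ge_0; [exact B2 | apply HK, Hss].
    - replace (K * (e * Rabs (u - x)) * K * Rabs s * K) with (Q * e * Rabs (u - x)) by (unfold Q; ring).
      apply Rmult_le_compat_r; [exact Hp|].
      pose proof (cond_pos e).
      apply Rle_trans with ((Q + 1) * (eps / (2 * (Q + 1)))); [apply Rmult_le_compat; lra|].
      right; field; lra. }
  lra.
Qed.

Context (X : R -> R -> Mat).
Context (HX : cont_on J (fun x => X x 0)).
Context (DX : forall x y, J x -> J y ->
  is_derive (X x) y (plus (Yx x y) (minus (mul (X x y) (Y x y)) (mul (Y x y) (X x y))))).

(** Parallel transport from the origin: first along the x-axis, then upwards. *)
Definition transport (x y : R) : Mat :=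
  mul (ordexp (fun u => X u 0) x) (ordexp (Y x) y).

Lemma transport_dy (x y : R) : J x -> J y ->
  is_derive (transport x) y (mul (transport x y) (Y x y)).
Proof.
  intros Hx Hy. unfold transport. rewrite <- mul_assoc.
  set (V0 := ordexp (fun u => X u 0) x).
  apply is_derive_mul_l, (ordexp_derive J); [exact HJ | exact HJ0 | apply HY, Hx | exact Hy].
Qed.

Lemma gauge_identity (G W X0 Y0 Q : Mat) :
  plus (mul (plus (mul (mul G Y0) X0) (mul G (plus Q (minus (mul X0 Y0) (mul Y0 X0))))) W)
       (mul (mul G X0) (opp (mul Y0 W))) = mul (mul G Q) W.
Proof. mnc. Qed.

(** Flatness: with G the transport along y, (G X G^-1)_y = G (X_y + Y X - X Y) G^-1 = G
    Y_x G^-1. *)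
Lemma gauge_transport (x y : R) : J x -> J y ->
  plus (X x 0) (conj_integral x y) =
  mul (mul (ordexp (Y x) y) (X x y)) (adj (ordexp (Y x) y)).
Proof.
  intros Hx Hy.
  assert (CYx2 := joint_cont_2 J Yx x CYx Hx).
  set (H := fun t => minus (mul (mul (ordexp (Y x) t) (X x t)) (adj (ordexp (Y x) t))) (conj_integral x t)).
  assert (E : H y = H 0).
  { apply (const_of_derive_zero J); try assumption. intros t Ht.
    replace (zero : Mat) with
      (minus (mul (mul (ordexp (Y x) t) (Yx x t)) (adj (ordexp (Y x) t)))
             (mul (mul (ordexp (Y x) t) (Yx x t)) (adj (ordexp (Y x) t)))).
    2:{ generalize (mul (mul (ordexp (Y x) t) (Yx x t)) (adj (ordexp (Y x) t))). mring. }
    apply (is_derive_minus (V := Mat)).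
    - rewrite <- (gauge_identity _ _ (X x t) (Y x t)).
      apply is_derive_mul; [apply is_derive_mul|].
      + apply (ordexp_derive J); [exact HJ | exact HJ0 | apply HY, Hx | exact Ht].
      + apply DX; assumption.
      + apply (ordexp_adj_derive J); [exact HJ | exact HJ0 | apply HY, Hx | | exact Ht].
        intros u Hu; apply TY; assumption.
    - apply (is_derive_integral J HJ
          (fun t => mul (mul (ordexp (Y x) t) (Yx x t)) (adj (ordexp (Y x) t))));
          [apply (conj_integrand_cont x _ Hx CYx2) | exact HJ0 | exact Ht]. }
  unfold H in E. rewrite (ordexp_0 J HJ HJ0 (Y x) (HY x Hx)), adj_1, mul_1_l, mul_1_r in E.
  unfold conj_integral in E at 2. rewrite integral_point in E.
  set (P := mul (mul (ordexp (Y x) y) (X x y)) (adj (ordexp (Y x) y))) in *.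
  replace P with (plus (minus P (conj_integral x y)) (conj_integral x y))
    by (generalize P (conj_integral x y); mring).
  rewrite E. generalize (conj_integral x y). mring.
Qed.

(** By the parameter derivative, moving x changes the transport by the factor X(x,0) +
    conj_integral, conjugated by the vertical transport; flatness identifies it with
    X(x,y). Only Y is differentiated in x, so X may be merely continuous in x. *)
Lemma transport_dx (x y : R) : J x -> J y ->
  is_derive (fun u => transport u y) x (mul (transport x y) (X x y)).
Proof.
  intros Hx Hy. unfold transport.
  set (V0 := ordexp (fun u => X u 0)).
  replace (mul (mul (V0 x) (ordexp (Y x) y)) (X x y)) with
    (plus (mul (mul (V0 x) (X x 0)) (ordexp (Y x) y))
          (mul (V0 x) (mul (conj_integral x y) (ordexp (Y x) y)))).
  - apply (is_derive_mul V0 (fun u => ordexp (Y u) y)).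
    + apply (ordexp_derive J HJ HJ0 (fun u => X u 0) HX x Hx).
    + apply ordexp_parameter_derive; assumption.
  - transitivity (mul (V0 x) (mul (plus (X x 0) (conj_integral x y)) (ordexp (Y x) y))).
    + generalize (V0 x) (ordexp (Y x) y) (conj_integral x y). mring.
    + rewrite gauge_transport by assumption.
      rewrite <- !mul_assoc, (adj_ordexp J HJ HJ0 (Y x) (HY x Hx)), mul_1_r; try assumption; [reflexivity|].
      intros t Ht; apply TY; assumption.
Qed.
End ParamDependence.

Lemma mul_inverses (A B A' B' : Mat) :
  mul A A' = mone -> mul B B' = mone -> mul (mul A B) (mul B' A') = mone.
Proof.
  intros HA HB. transitivity (mul (mul A (mul B B')) A'); [mnc|].
  rewrite HB, mul_1_r. exact HA.
Qed.

Lemma transport_adj (J : R -> Prop) (Y X : R -> R -> Mat) (x y : R) :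
  is_open_interval J -> J 0 -> J x -> J y ->
  cont_on J (fun u => X u 0) -> cont_on J (Y x) ->
  (forall u, J u -> tracefree (X u 0)) -> (forall v, J v -> tracefree (Y x v)) ->
  mul (transport Y X x y) (adj (transport Y X x y)) = mone.
Proof.
  intros HJ HJ0 Hx Hy CX CY TX TY. unfold transport.
  rewrite adj_mul. apply mul_inverses.
  - exact (ordexp_adj J HJ HJ0 _ CX TX x Hx).
  - exact (ordexp_adj J HJ HJ0 (Y x) CY TY y Hy).
Qed.

Lemma transport_dagger (J : R -> Prop) (Y X : R -> R -> Mat) (x y : R) :
  is_open_interval J -> J 0 -> J x -> J y ->
  cont_on J (fun u => X u 0) -> cont_on J (Y x) ->
  (forall u, J u -> dagger (X u 0) = opp (X u 0)) -> (forall v, J v -> dagger (Y x v) = opp (Y x v)) ->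
  mul (transport Y X x y) (dagger (transport Y X x y)) = mone.
Proof.
  intros HJ HJ0 Hx Hy CX CY TX TY. unfold transport.
  rewrite dagger_mul.
  assert (E : forall (A : R -> Mat) s, cont_on J A -> (forall t, J t -> dagger (A t) = opp (A t)) -> J s ->
     mul (ordexp A s) (dagger (ordexp A s)) = mone).
  { intros A s CA SA Hs. apply (involution_inverse J HJ HJ0 dagger A); try assumption.
    - exact is_derive_dagger.
    - exact dagger_mul.
    - exact dagger_1.
    - intros t Ht; apply (ordexp_derive J HJ HJ0 A CA t Ht).
    - apply (ordexp_0 J HJ HJ0 A CA). }
  apply mul_inverses; [exact (E _ x CX TX Hx) | exact (E (Y x) y CY TY Hy)].
Qed.

(** * Ordered exponentials as loops *)

Definition toM2 (A : Mat) : M2 := mat2 (m11 A) (m12 A) (m21 A) (m22 A).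
Definition det (A : Mat) : C := (m11 A * m22 A - m12 A * m21 A)%C.

Lemma entry_toM2 (A : Mat) :
  entry (toM2 A) 0 0 = m11 A /\ entry (toM2 A) 0 1 = m12 A /\
  entry (toM2 A) 1 0 = m21 A /\ entry (toM2 A) 1 1 = m22 A.
Proof. repeat split. Qed.

Lemma mmul_toM2 (A B : Mat) : mmul (toM2 A) (toM2 B) = toM2 (mul A B).
Proof.
  unfold mmul, Mmult. apply (coeff_mat_ext_aux (RtoC 0) (RtoC 0)).
  intros i j Hi Hj. rewrite coeff_mat_bij by assumption.
  change (Init.Nat.pred 2) with 1%nat. rewrite sum_Sn, sum_O.
  destruct i as [|[|i]]; [| |lia]; destruct j as [|[|j]]; try lia; reflexivity.
Qed.

Lemma id2_toM2 : id2 = toM2 mone.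
Proof.
  unfold id2, Mone. apply (coeff_mat_ext_aux (RtoC 0) (RtoC 0)).
  intros i j Hi Hj. rewrite coeff_mat_bij by assumption.
  destruct i as [|[|i]]; [| |lia]; destruct j as [|[|j]]; try lia; reflexivity.
Qed.

Lemma det2_toM2 (A : Mat) : det2 (toM2 A) = det A.
Proof. reflexivity. Qed.

Lemma adjoint2_toM2 (A : Mat) : adjoint2 (toM2 A) = toM2 (dagger A).
Proof. reflexivity. Qed.

Lemma det_of_adj (A : Mat) : mul A (adj A) = mone -> det A = RtoC 1.
Proof.
  intros H. apply (f_equal m11) in H.
  transitivity (m11 (mul A (adj A))); [|exact H].
  unfold det, mul, adj, m11, m12, m21, m22, mk; cbn [fst snd]. apply Cplus_0_cancel; ring.
Qed.

Lemma inv2_toM2 (A : Mat) : det A = RtoC 1 -> inv2 (toM2 A) = toM2 (adj A).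
Proof.
  intros H. unfold inv2. rewrite det2_toM2, H.
  destruct (entry_toM2 A) as [-> [-> [-> ->]]].
  unfold toM2, adj, Cdiv.
  assert (E : (/ RtoC 1)%C = RtoC 1) by (field; apply C1_nz).
  rewrite E, !Cmult_1_r. reflexivity.
Qed.

Lemma sigma3_conj (A : Mat) :
  mmul (mmul sigma3 (toM2 A)) (inv2 sigma3) =
  toM2 (mk (m11 A) (- m12 A)%C (- m21 A)%C (m22 A)).
Proof.
  assert (E : sigma3 = toM2 (mk (RtoC 1) (RtoC 0) (RtoC 0) (RtoC (-1)))) by reflexivity.
  assert (E' : inv2 sigma3 = toM2 (mk (RtoC 1) (RtoC 0) (RtoC 0) (RtoC (-1)))).
  { unfold inv2, sigma3, toM2, det2.
    unfold mk, m11, m12, m21, m22, entry, mat2; cbn [fst snd coeff_mat]. unfold coeff_mat; cbn.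
    repeat f_equal; unfold Cdiv, Cinv, Cmult, Cminus, Cplus, Copp, RtoC; cbn; apply injective_projections; cbn; field. }
  rewrite E', E, !mmul_toM2. f_equal. mring.
Qed.

Lemma is_derive_coord (F : R -> Mat) (s : R) (F' : Mat) (pr : Mat -> C_R_NormedModule) :
  (forall A B : Mat, pr (minus A B) = minus (pr A) (pr B)) ->
  (forall (r : R) A, pr (scal r A) = scal r (pr A)) ->
  (forall A, Cmod (pr A) <= norm A) ->
  is_derive F s F' -> is_derive (fun t => pr (F t)) s (pr F').
Proof.
  intros H1 H2 H3. apply (is_derive_contraction pr); [exact H1 | exact H2 |].
  intros A; rewrite norm_C; apply H3.
Qed.

(** Entries are contractions, so they inherit derivatives. *)
Lemma is_mderive_toM2 (F : R -> Mat) (s : R) (F' : Mat) :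
  is_derive F s F' -> is_mderive (fun t => toM2 (F t)) s (toM2 F').
Proof.
  intros HF i j Hi Hj.
  destruct (entry_toM2 F') as [E1 [E2 [E3 E4]]].
  destruct i as [|[|i]]; [| |lia]; destruct j as [|[|j]]; try lia.
  - apply (is_derive_coord F s F' m11); [reflexivity | reflexivity | apply Cmod_m11 | exact HF].
  - apply (is_derive_coord F s F' m12); [reflexivity | reflexivity | apply Cmod_m12 | exact HF].
  - apply (is_derive_coord F s F' m21); [reflexivity | reflexivity | apply Cmod_m21 | exact HF].
  - apply (is_derive_coord F s F' m22); [reflexivity | reflexivity | apply Cmod_m22 | exact HF].
Qed.

Definition cpow (l : C) (n : nat) : C := pow_n (K := C_Ring) l n.

Lemma cscal_zero (l : C) : cscal l zero = zero.
Proof. mring. Qed.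
Section Loop.
Context (J : R -> Prop) (HJ : is_open_interval J) (HJ0 : J 0).
Context (A : R -> Mat) (HA : cont_on J A) (TA : forall t, J t -> tracefree (A t)).

(** The solution for the coefficient scaled by the spectral parameter l. *)
Definition pencil (l : C) (s : R) : Mat := ordexp (fun t => cscal l (A t)) s.

Lemma scaled_cont (l : C) : cont_on J (fun t => cscal l (A t)).
Proof. intros t Ht; apply continuous_cscal, HA, Ht. Qed.
Lemma scaled_tracefree (l : C) : forall t, J t -> tracefree (cscal l (A t)).
Proof. intros t Ht; apply tracefree_cscal, TA, Ht. Qed.

Lemma pencil_derive (l : C) (s : R) : J s ->
  is_derive (pencil l) s (mul (pencil l s) (cscal l (A s))).
Proof. intros Hs. apply (ordexp_derive J HJ HJ0 _ (scaled_cont l) s Hs). Qed.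

Lemma pencil_0 (l : C) : pencil l 0 = mone.
Proof. apply (ordexp_0 J HJ HJ0 _ (scaled_cont l)). Qed.

Lemma pencil_adj (l : C) (s : R) : J s -> mul (pencil l s) (adj (pencil l s)) = mone.
Proof.
  intros Hs. apply (ordexp_adj J HJ HJ0 _ (scaled_cont l) (scaled_tracefree l) s Hs).
Qed.

(** The n-th iterated integral is homogeneous of degree n in A; hence the Peano-Baker
    series of l A is a power series in l with coefficients independent of l. *)
Lemma dyson_term_scaled (l : C) (n : nat) (s : R) : J s ->
  dyson_term (fun t => cscal l (A t)) n s = cscal (cpow l n) (dyson_term A n s).
Proof.
  revert s; induction n as [|n IH]; intros s Hs.
  - simpl. unfold cpow; simpl. change (@Hierarchy.one C_Ring) with (RtoC 1). mring.
  - set (D := fun t => minus (dyson_term (fun t => cscal l (A t)) (S n) t) (cscal (cpow l (S n)) (dyson_term A (S n) t))).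
    assert (E : D s = D 0).
    { apply (const_of_derive_zero J); try assumption. intros t Ht.
      replace (zero : Mat) with
        (minus (mul (dyson_term (fun t => cscal l (A t)) n t) (cscal l (A t)))
               (cscal (cpow l (S n)) (mul (dyson_term A n t) (A t)))).
      - apply (is_derive_minus (V := Mat)).
        + apply (dyson_term_derive J HJ HJ0 _ (scaled_cont l) n t Ht).
        + apply is_derive_cscal, (dyson_term_derive J HJ HJ0 _ HA n t Ht).
      - rewrite IH by exact Ht. unfold cpow; simpl pow_n.
        change (@mult C_Ring) with Cmult.
        generalize (pow_n (K := C_Ring) l n) (dyson_term A n t) (A t). mring. }
    unfold D in E. simpl dyson_term in E at 3 4. rewrite !integral_point, cscal_zero in E.
    set (P := dyson_term (fun t => cscal l (A t)) (S n) s) in *.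
    set (Q := cscal (cpow l (S n)) (dyson_term A (S n) s)) in *.
    replace P with (plus (minus P Q) Q) by (generalize P Q; mring).
    rewrite E. generalize Q; mring.
Qed.

Lemma pencil_series (l : C) (s : R) : J s ->
  is_series (V := Mat) (fun n => cscal (cpow l n) (dyson_term A n s)) (pencil l s).
Proof.
  intros Hs. generalize (ordexp_series J HJ HJ0 _ (scaled_cont l) s Hs).
  apply is_series_ext. intros n; apply dyson_term_scaled, Hs.
Qed.

(** An automorphism of the algebra maps solutions to solutions. *)
Lemma pencil_conj (tau : Mat -> Mat) (l l' : C) (s : R) :
  (forall F x F', is_derive F x F' -> is_derive (fun t => tau (F t)) x (tau F')) ->
  (forall P Q, tau (mul P Q) = mul (tau P) (tau Q)) -> tau mone = mone ->
  (forall t, J t -> tau (cscal l (A t)) = cscal l' (A t)) -> J s ->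
  tau (pencil l s) = pencil l' s.
Proof.
  intros Hd Hm H1 Ht Hs.
  rewrite (ordexp_unique J HJ HJ0 _ (scaled_cont l') (scaled_tracefree l') (fun s => tau (pencil l s)) s).
  - rewrite pencil_0, H1, mul_1_l. reflexivity.
  - intros t Jt. rewrite <- Ht, <- Hm by exact Jt. apply Hd, pencil_derive, Jt.
  - exact Hs.
Qed.

(** The logarithmic l-derivative of the solution. *)
Definition sandwich (l : C) (s : R) : Mat :=
  integral (fun t => mul (mul (pencil l t) (A t)) (adj (pencil l t))) 0 s.

(** Holomorphy in l, with a quadratic remainder, from the perturbation estimate for the
    coefficients z A and l A. *)
Lemma pencil_diff (l : C) (s : R) : J s ->
  exists K, forall z, Cmod (z - l)%C <= 1 ->
    norm (minus (minus (pencil z s) (pencil l s)) (cscal (z - l)%C (mul (sandwich l s) (pencil l s))))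
    <= K * Cmod (z - l)%C ^ 2.
Proof.
  intros Hs.
  destruct (compact_bound A 0 s) as [M [M0 HM]].
  { intros t Ht; apply HA; exact (interval_conv J 0 s t HJ HJ0 Hs Ht). }
  set (N := (Cmod l + 1) * M).
  exists ((norm mone * exp (N * Rabs s)) ^ 5 * Rabs s ^ 2 * M ^ 2). intros z Hz.
  assert (E : forall t, minus (cscal z (A t)) (cscal l (A t)) = cscal (z - l)%C (A t)) by (intros t; mring).
  assert (CF : forall F, cont_on J F -> cont_on J (fun t => mul (mul (pencil l t) (F t)) (adj (pencil l t)))).
  { intros F HF t Ht.
    assert (CV : continuous (pencil l) t) by (apply (ordexp_continuous J HJ HJ0 _ (scaled_cont l)), Ht).
    apply continuous_mul; [apply continuous_mul|]; [exact CV | apply HF, Ht | apply continuous_adj, CV]. }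
  assert (EI : integral (fun t => mul (mul (pencil l t) (minus (cscal z (A t)) (cscal l (A t)))) (adj (pencil l t))) 0 s
             = cscal (z - l)%C (sandwich l s)).
  { apply (is_RInt_unique (V := MatC)).
    apply (is_RInt_ext (V := Mat) (fun t => cscal (z - l)%C (mul (mul (pencil l t) (A t)) (adj (pencil l t))))).
    { intros t _. rewrite E. mnc. }
    replace (cscal (z - l)%C (sandwich l s)) with
      (minus (cscal (z - l)%C (sandwich l s)) (cscal (z - l)%C (sandwich l 0))).
    2:{ unfold sandwich at 2. rewrite integral_point. generalize (sandwich l s); mring. }
    apply (is_RInt_derive (V := MatC) (fun t => cscal (z - l)%C (sandwich l t))).
    - intros t Ht. apply is_derive_cscal.
      apply (is_derive_integral J HJ (fun t => mul (mul (pencil l t) (A t)) (adj (pencil l t))));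
        [apply CF, HA | exact HJ0 | exact (interval_conv J 0 s t HJ HJ0 Hs Ht)].
    - intros t Ht. apply continuous_cscal, (CF A HA). exact (interval_conv J 0 s t HJ HJ0 Hs Ht). }
  replace (cscal (z - l)%C (mul (sandwich l s) (pencil l s))) with
    (mul (cscal (z - l)%C (sandwich l s)) (pencil l s)) by apply mul_cscal_l.
  rewrite <- EI.
  eapply Rle_trans; [apply (ordexp_perturbation J HJ HJ0 _ _ N (Cmod (z - l)%C * M) s (scaled_cont z) (scaled_cont l) (scaled_tracefree l) Hs)|].
  - intros t Ht. rewrite !norm_cscal. specialize (HM t Ht). pose proof (norm_ge_0 (A t)).
    pose proof (Cmod_ge_0 l). pose proof (Cmod_ge_0 z).
    assert (Cmod z <= Cmod l + 1).
    { replace z with (l + (z - l))%C by ring. eapply Rle_trans; [apply Cmod_triangle|]. lra. }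
    unfold N; split; apply Rmult_le_compat; lra.
  - intros t Ht. rewrite E, norm_cscal. apply Rmult_le_compat_l; [apply Cmod_ge_0 | apply HM, Ht].
  - rewrite Rpow_mult_distr. right; ring.
Qed.
End Loop.

(** At l = 0 the solution is 1, and its derivative is the linear term of the series. *)
Lemma pencil_derive_at_0 (J : R -> Prop) (A : R -> Mat) (s : R) :
  is_open_interval J -> J 0 -> cont_on J A -> (forall t, J t -> tracefree (A t)) -> J s ->
  pencil A (RtoC 0) s = mone /\
  is_derive (fun t : R => pencil A (RtoC t) s) 0 (integral A 0 s).
Proof.
  intros HJ HJ0 CA TA Hs.
  assert (E : forall t, J t -> pencil A (RtoC 0) t = mone).
  { intros t Ht. apply (ordexp_const_zero J); try assumption.
    - intros u Ju; apply continuous_cscal, CA, Ju.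
    - intros u Ju. generalize (A u). mring. }
  split; [apply E, Hs|].
  destruct (pencil_diff J HJ HJ0 A CA TA (RtoC 0) s Hs) as [K HK].
  assert (ES : mul (sandwich A (RtoC 0) s) (pencil A (RtoC 0) s) = integral A 0 s).
  { rewrite E, mul_1_r by exact Hs. apply (RInt_ext (V := MatC)). intros t Ht.
    assert (Jt : J t) by (apply (interval_conv J 0 s t HJ HJ0 Hs); lra).
    rewrite E, adj_1, mul_1_l, mul_1_r by exact Jt. reflexivity. }
  rewrite ES in HK.
  apply is_derive_eps; intros eps. pose proof (cond_pos eps) as He. pose proof (Rabs_pos K) as HK0.
  assert (Hd : 0 < Rmin 1 (eps / (Rabs K + 1))).
  { apply Rmin_pos; [lra | apply Rdiv_lt_0_compat; lra]. }
  exists (mkposreal _ Hd); simpl; intros y Hy.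
  assert (Y1 : Rabs (y - 0) < 1) by (eapply Rlt_le_trans; [exact Hy | apply Rmin_l]).
  assert (Y2 : Rabs (y - 0) < eps / (Rabs K + 1)) by (eapply Rlt_le_trans; [exact Hy | apply Rmin_r]).
  specialize (HK (RtoC y)).
  rewrite <- RtoC_minus, Cmod_R in HK. specialize (HK (Rlt_le _ _ Y1)).
  rewrite scalE. eapply Rle_trans; [exact HK|].
  pose proof (Rabs_pos (y - 0)). pose proof (Rle_abs K).
  replace (K * Rabs (y - 0) ^ 2) with (K * Rabs (y - 0) * Rabs (y - 0)) by ring.
  apply Rmult_le_compat_r; [assumption|].
  apply Rle_trans with ((Rabs K + 1) * (eps / (Rabs K + 1))).
  - apply Rle_trans with ((Rabs K + 1) * Rabs (y - 0)); [apply Rmult_le_compat_r; lra | apply Rmult_le_compat_l; lra].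
  - right; field; lra.
Qed.

Lemma C_derive_quadratic (f : C -> C) (l D : C) (r K : R) :
  0 < r ->
  (forall z, Cmod (z - l)%C < r -> Cmod (f z - f l - (z - l) * D)%C <= K * Cmod (z - l)%C ^ 2) ->
  is_derive (K := C_AbsRing) (V := C_NormedModule) f l D.
Proof.
  intros Hr H. split; [apply (is_linear_scal_l (K := C_AbsRing) (V := C_NormedModule))|].
  intros x Hx eps. rewrite <- (is_filter_lim_locally_unique (V := AbsRing_NormedModule C_AbsRing) _ _ Hx).
  apply (locally_le_locally_norm (V := AbsRing_NormedModule C_AbsRing)).
  pose proof (cond_pos eps) as He.
  assert (Hd : 0 < Rmin r (eps / (Rabs K + 1))).
  { apply Rmin_pos; [exact Hr | apply Rdiv_lt_0_compat; [exact He | pose proof (Rabs_pos K); lra]]. }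
  exists (mkposreal _ Hd). intros z Hz.
  change (Cmod (f z - f l - (z - l) * D)%C <= eps * Cmod (z - l)%C).
  change (Cmod (z - l)%C < Rmin r (eps / (Rabs K + 1))) in Hz.
  assert (Z1 : Cmod (z - l)%C < r) by (eapply Rlt_le_trans; [exact Hz | apply Rmin_l]).
  assert (Z2 : Cmod (z - l)%C < eps / (Rabs K + 1)) by (eapply Rlt_le_trans; [exact Hz | apply Rmin_r]).
  eapply Rle_trans; [apply H, Z1|].
  replace (K * Cmod (z - l)%C ^ 2) with (K * Cmod (z - l)%C * Cmod (z - l)%C) by ring.
  pose proof (Cmod_ge_0 (z - l)%C). pose proof (Rabs_pos K). pose proof (Rle_abs K).
  apply Rmult_le_compat_r; [assumption|].
  apply Rle_trans with ((Rabs K + 1) * (eps / (Rabs K + 1))).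
  - apply Rle_trans with ((Rabs K + 1) * Cmod (z - l)%C).
    + apply Rmult_le_compat_r; lra.
    + apply Rmult_le_compat_l; lra.
  - right; field; lra.
Qed.

(** C carries two uniform structures, one from the modulus and one from its
    coordinates; the inner function of a chain rule has to be differentiable for the
    former. *)
Lemma C_derive_absring (f : C -> C) (l D : C) :
  is_derive (K := C_AbsRing) (V := C_NormedModule) f l D ->
  is_derive (K := C_AbsRing) (V := AbsRing_NormedModule C_AbsRing) f l D.
Proof.
  intros [_ H]; split; [apply (is_linear_scal_l (K := C_AbsRing) (V := AbsRing_NormedModule C_AbsRing))|].
  intros x Hx eps. exact (H x Hx eps).
Qed.

Lemma C_derive_inv (l : C) : l <> RtoC 0 ->
  ex_derive (K := C_AbsRing) (V := AbsRing_NormedModule C_AbsRing) Cinv l.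
Proof.
  intros Hl. exists (- / (l * l))%C.
  assert (Hm : 0 < Cmod l) by (apply Cmod_gt_0, Hl).
  apply C_derive_absring, (C_derive_quadratic Cinv l _ (Cmod l / 2) (2 / Cmod l ^ 3)); [lra|].
  intros z Hz.
  assert (Hz2 : Cmod l / 2 < Cmod z).
  { assert (Cmod l <= Cmod z + Cmod (z - l)%C).
    { replace l with (z - (z - l))%C at 1 by ring. unfold Cminus at 1.
      eapply Rle_trans; [apply Cmod_triangle|]. rewrite Cmod_opp. lra. }
    lra. }
  assert (Hz0 : z <> RtoC 0) by (apply Cmod_gt_0; lra).
  replace (/ z - / l - (z - l) * - / (l * l))%C with ((z - l) * (z - l) * / (l * l * z))%C
    by (field; split; assumption).
  rewrite !Cmod_mult, Cmod_inv, !Cmod_mult.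
  2:{ apply Cmult_neq_0; [apply Cmult_neq_0|]; assumption. }
  replace (Cmod (z - l)%C * Cmod (z - l)%C * / (Cmod l * Cmod l * Cmod z))
    with (/ (Cmod l * Cmod l * Cmod z) * Cmod (z - l)%C ^ 2) by ring.
  apply Rmult_le_compat_r; [apply pow2_ge_0|].
  replace (2 / Cmod l ^ 3) with (/ (Cmod l * Cmod l * (Cmod l / 2))) by (field; lra).
  apply Rinv_le_contravar.
  - apply Rmult_lt_0_compat; [apply Rmult_lt_0_compat|]; lra.
  - apply Rmult_le_compat_l; [apply Rmult_le_pos|]; lra.
Qed.

(** Conjugation by sigma_3. *)
Definition twist (A : Mat) : Mat := mk (m11 A) (- m12 A)%C (- m21 A)%C (m22 A).

Lemma twist_minus (A B : Mat) : twist (minus A B) = minus (twist A) (twist B).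
Proof. unfold twist; mring. Qed.
Lemma twist_scal (r : R) (A : Mat) : twist (scal r A) = scal r (twist A).
Proof. unfold twist; mring. Qed.
Lemma twist_mul (A B : Mat) : twist (mul A B) = mul (twist A) (twist B).
Proof. unfold twist; mring. Qed.
Lemma twist_1 : twist mone = mone.
Proof. unfold twist; mring. Qed.
Lemma norm_twist (A : Mat) : norm (twist A) = norm A.
Proof.
  rewrite !norm_sq. unfold twist, m11, m12, m21, m22, mk; cbn [fst snd].
  rewrite !Cmod_opp. reflexivity.
Qed.
Lemma is_derive_twist (F : R -> Mat) (x : R) (F' : Mat) :
  is_derive F x F' -> is_derive (fun t => twist (F t)) x (twist F').
Proof. apply (is_derive_contraction twist); [exact twist_minus | exact twist_scal | intros A; right; apply norm_twist]. Qed.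

Lemma SU2_toM2 (A : Mat) : SU A -> SU2 (toM2 A).
Proof.
  intros [H1 H2]; split.
  - rewrite adjoint2_toM2, mmul_toM2, H1, id2_toM2. reflexivity.
  - rewrite det2_toM2. apply det_of_adj, H2.
Qed.

Lemma is_series_mul_r (u : nat -> Mat) (S D : Mat) :
  is_series (V := Mat) u S -> is_series (V := Mat) (fun n => mul (u n) D) (mul S D).
Proof.
  intros H.
  apply (filterlim_ext (fun n => mul (sum_n u n) D)).
  - intros n; induction n as [|n IH]; [rewrite !sum_O; reflexivity|].
    rewrite !sum_Sn, <- IH. apply mul_plus_l.
  - refine (filterlim_comp_2 _ _ mul H _ (filterlim_mul _ _)). apply filterlim_const.
Qed.

Lemma is_series_coord (pr : Mat -> C) (u : nat -> Mat) (S : Mat) :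
  (forall A B : Mat, pr (plus A B) = (pr A + pr B)%C) ->
  (forall A B : Mat, pr (minus A B) = (pr A - pr B)%C) ->
  (forall A, Cmod (pr A) <= norm A) ->
  is_series (V := Mat) u S -> is_series (K := C_AbsRing) (V := C_NormedModule) (fun n => pr (u n)) (pr S).
Proof.
  intros H1 H2 H3 H.
  apply (filterlim_ext (fun n => pr (sum_n u n))).
  - intros n; induction n as [|n IH]; [rewrite !sum_O; reflexivity|].
    rewrite !sum_Sn, <- IH. apply H1.
  - refine (proj2 (filterlim_locally_ball_norm (U := C_NormedModule) (F := eventually) _ _) _).
    intros eps.
    generalize (proj1 (filterlim_locally_ball_norm (U := Mat) (F := eventually) _ _) H eps).
    apply filter_imp. intros n Hn.
    change (Cmod (pr (sum_n u n) - pr S)%C < eps). rewrite <- H2.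
    eapply Rle_lt_trans; [apply H3 | exact Hn].
Qed.

Lemma is_mpseries_toM2 (a : nat -> Mat) (z : C) (S : Mat) :
  is_series (V := Mat) (fun n => cscal (cpow z n) (a n)) S ->
  is_mpseries (fun n => toM2 (a n)) z (toM2 S).
Proof.
  intros H i j Hi Hj. unfold is_pseries.
  destruct i as [|[|i]]; [| |lia]; destruct j as [|[|j]]; try lia.
  - exact (is_series_coord m11 (fun n => cscal (cpow z n) (a n)) S
             (fun _ _ => eq_refl) (fun _ _ => eq_refl) Cmod_m11 H).
  - exact (is_series_coord m12 (fun n => cscal (cpow z n) (a n)) S
             (fun _ _ => eq_refl) (fun _ _ => eq_refl) Cmod_m12 H).
  - exact (is_series_coord m21 (fun n => cscal (cpow z n) (a n)) S
             (fun _ _ => eq_refl) (fun _ _ => eq_refl) Cmod_m21 H).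
  - exact (is_series_coord m22 (fun n => cscal (cpow z n) (a n)) S
             (fun _ _ => eq_refl) (fun _ _ => eq_refl) Cmod_m22 H).
Qed.

Definition offdiag (A : Mat) : Prop := m11 A = RtoC 0 /\ m22 A = RtoC 0.

Lemma offdiag_tracefree (A : Mat) : offdiag A -> tracefree A.
Proof. intros [H1 H2]; unfold tracefree; rewrite H1, H2. ring. Qed.

Lemma offdiag_opp (A : Mat) : offdiag A -> offdiag (opp A).
Proof.
  intros [H1 H2]. rewrite opp_coord. split; unfold mneg, mk.
  - change (- m11 A = 0)%C. rewrite H1. ring.
  - change (- m22 A = 0)%C. rewrite H2. ring.
Qed.

Lemma offdiag_conj (D A D' : Mat) :
  m12 D = RtoC 0 -> m21 D = RtoC 0 -> m12 D' = RtoC 0 -> m21 D' = RtoC 0 ->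
  offdiag A -> offdiag (mul (mul D A) D').
Proof.
  destruct A as [[a b] [c d]], D as [[a1 b1] [c1 d1]], D' as [[a2 b2] [c2 d2]].
  unfold offdiag, mul, mk, m11, m12, m21, m22; cbn [fst snd].
  intros -> -> -> -> [-> ->]. split; apply Cplus_0_cancel; ring.
Qed.

Lemma diag_of_twist (A : Mat) : twist A = A -> m12 A = RtoC 0 /\ m21 A = RtoC 0.
Proof.
  intros H.
  pose proof (f_equal m12 H) as H1. pose proof (f_equal m21 H) as H2.
  change (- m12 A = m12 A)%C in H1. change (- m21 A = m21 A)%C in H2.
  assert (K : forall z : C, (- z)%C = z -> z = RtoC 0).
  { intros [u v] E. injection E as E1 E2. apply injective_projections; cbn; lra. }
  split; apply K; assumption.
Qed.

Lemma twist_diag (D : Mat) : m12 D = RtoC 0 -> m21 D = RtoC 0 -> twist D = D.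
Proof.
  destruct D as [[a b] [c d]]. unfold twist, m12, m21; simpl. intros -> ->. mring.
Qed.

Lemma twist_offdiag (z : C) (A : Mat) : offdiag A -> twist (cscal z A) = cscal (- z)%C A.
Proof.
  destruct A as [[a b] [c d]]. unfold offdiag, twist, m11, m22; simpl. intros [-> ->]. mring.
Qed.

Section Loops.
Context (J : R -> Prop) (HJ : is_open_interval J) (HJ0 : J 0).
Context (A : R -> Mat) (HA : cont_on J A).
Context (OA : forall t, J t -> offdiag (A t)) (SA : forall t, J t -> dagger (A t) = opp (A t)).
Context (D : Mat) (SD : SU D) (D12 : m12 D = RtoC 0) (D21 : m21 D = RtoC 0).
Context (s : R) (Hs : J s).

(** A constant right factor D allows for the diagonal part of a plus loop. *)
Definition dressed (z : C) : Mat := mul (pencil A z s) D.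

Lemma TA_of_OA : forall t, J t -> tracefree (A t).
Proof. intros t Ht; apply offdiag_tracefree, OA, Ht. Qed.

(** Off-diagonal coefficients change sign under [twist], as they do under z -> -z. *)
Lemma pencil_twisted (z : C) : dressed (- z)%C = twist (dressed z).
Proof.
  unfold dressed. rewrite twist_mul.
  rewrite (pencil_conj J HJ HJ0 A HA TA_of_OA twist z (- z)%C s).
  - rewrite (twist_diag D D12 D21). reflexivity.
  - exact is_derive_twist.
  - exact twist_mul.
  - exact twist_1.
  - intros t Ht. apply twist_offdiag, OA, Ht.
  - exact Hs.
Qed.

Lemma pencil_SU (r : R) : SU (dressed (RtoC r)).
Proof.
  apply SU_mul; [split|exact SD].
  - apply (involution_inverse J HJ HJ0 dagger (fun t => cscal (RtoC r) (A t))).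
    + exact is_derive_dagger.
    + exact dagger_mul.
    + exact dagger_1.
    + intros t Ht. rewrite <- scalE, dagger_scal, (SA t Ht). mring.
    + intros t Ht. apply (pencil_derive J HJ HJ0 A HA _ t Ht).
    + apply (pencil_0 J HJ HJ0 A HA).
    + exact Hs.
  - apply (pencil_adj J HJ HJ0 A HA TA_of_OA _ s Hs).
Qed.

Lemma pencil_det (z : C) : mul (dressed z) (adj (dressed z)) = mone.
Proof.
  unfold dressed. rewrite adj_mul, <- mul_assoc, (mul_assoc D), (proj2 SD), mul_1_l.
  apply (pencil_adj J HJ HJ0 A HA TA_of_OA _ s Hs).
Qed.

Lemma pencil_coord_derive (pr : Mat -> C) (z : C) :
  (forall A B : Mat, pr (minus A B) = (pr A - pr B)%C) ->
  (forall l A, pr (cscal l A) = (l * pr A)%C) ->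
  (forall A, Cmod (pr A) <= norm A) ->
  ex_derive (K := C_AbsRing) (V := C_NormedModule) (fun z => pr (dressed z)) z.
Proof.
  intros H1 H2 H3.
  destruct (pencil_diff J HJ HJ0 A HA TA_of_OA z s Hs) as [K HK].
  eexists. apply (C_derive_quadratic (fun z => pr (dressed z)) z
    (pr (mul (mul (sandwich A z s) (pencil A z s)) D)) 1 (K * norm D)); [lra|].
  intros w Hw. rewrite <- H1, <- H2, <- H1. eapply Rle_trans; [apply H3|].
  unfold dressed. rewrite <- mul_cscal_l, <- !mul_minus_l.
  eapply Rle_trans; [apply norm_mul|].
  replace (K * norm D * Cmod (w - z)%C ^ 2) with (K * Cmod (w - z)%C ^ 2 * norm D) by ring.
  apply Rmult_le_compat_r; [apply norm_ge_0 | apply HK; lra].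
Qed.

(** Used with g the identity for plus loops and with g the inversion for minus loops. *)
Lemma pencil_loop (g : C -> C) :
  (forall l, l <> RtoC 0 -> g (- l)%C = (- g l)%C) ->
  (forall r : R, r <> 0 -> exists r' : R, g (RtoC r) = RtoC r') ->
  (forall l, l <> RtoC 0 -> ex_derive (K := C_AbsRing) (V := AbsRing_NormedModule C_AbsRing) g l) ->
  loop (fun l => toM2 (dressed (g l))).
Proof.
  intros G1 G2 G3. split; [|split].
  - intros l Hl. rewrite sigma3_conj, G1, pencil_twisted by exact Hl. reflexivity.
  - intros i j Hi Hj l Hl.
    assert (P : forall pr : Mat -> C,
      (forall A B : Mat, pr (minus A B) = (pr A - pr B)%C) ->
      (forall l A, pr (cscal l A) = (l * pr A)%C) ->
      (forall A, Cmod (pr A) <= norm A) ->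
      ex_derive (K := C_AbsRing) (V := C_NormedModule) (fun l => pr (dressed (g l))) l).
    { intros pr H1 H2 H3.
      apply (ex_derive_comp (K := C_AbsRing) (V := C_NormedModule) (fun z => pr (dressed z)) g l).
      - apply pencil_coord_derive; assumption.
      - apply G3, Hl. }
    destruct i as [|[|i]]; [| |lia]; destruct j as [|[|j]]; try lia.
    + apply (P m11); [reflexivity | reflexivity | apply Cmod_m11].
    + apply (P m12); [reflexivity | reflexivity | apply Cmod_m12].
    + apply (P m21); [reflexivity | reflexivity | apply Cmod_m21].
    + apply (P m22); [reflexivity | reflexivity | apply Cmod_m22].
  - intros r Hr. destruct (G2 r Hr) as [r' ->]. apply SU2_toM2, pencil_SU.
Qed.

Lemma pencil_mpseries (z : C) :
  is_mpseries (fun n => toM2 (mul (dyson_term A n s) D)) z (toM2 (dressed z)).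
Proof.
  apply is_mpseries_toM2.
  apply (is_series_ext (fun n => mul (cscal (cpow z n) (dyson_term A n s)) D)).
  - intros n; apply mul_cscal_l.
  - apply is_series_mul_r, (pencil_series J HJ HJ0 A HA z s Hs).
Qed.

Lemma pencil_plus_loop : plus_loop (fun l => toM2 (dressed l)).
Proof.
  split.
  - apply (pencil_loop (fun l => l)).
    + reflexivity.
    + intros r _; exists r; reflexivity.
    + intros l _. apply ex_derive_id.
  - exists (fun n => toM2 (mul (dyson_term A n s) D)). intros l _. apply pencil_mpseries.
Qed.

Lemma pencil_minus_loop : D = mone -> minus_loop (fun l => toM2 (dressed (/ l)%C)).
Proof.
  intros HD. split.
  - apply (pencil_loop Cinv).
    + intros l Hl. field; exact Hl.
    + intros r Hr; exists (/ r). symmetry; apply RtoC_inv; exact Hr.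
    + exact C_derive_inv.
  - exists (fun n => toM2 (mul (dyson_term A n s) D)). split.
    + rewrite HD, mul_1_r, id2_toM2. reflexivity.
    + intros l _. apply pencil_mpseries.
Qed.
End Loops.

(** * Continuous arguments of circle-valued functions *)

Lemma unit_angle (c s : R) : c ^ 2 + s ^ 2 = 1 -> exists t, cos t = c /\ sin t = s.
Proof.
  intros H.
  assert (Hc : -1 <= c <= 1) by (split; nra).
  assert (Hs : sqrt (1 - Rsqr c) = Rabs s).
  { rewrite <- sqrt_Rsqr_abs. f_equal. unfold Rsqr; nra. }
  destruct (Rle_dec 0 s) as [P | P].
  - exists (acos c). rewrite cos_acos, sin_acos, Hs, Rabs_pos_eq by lra. split; reflexivity.
  - exists (- acos c). rewrite cos_neg, sin_neg, cos_acos, sin_acos, Hs, Rabs_left by lra.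
    split; ring.
Qed.

Lemma atan_angle (c s : R) : c ^ 2 + s ^ 2 = 1 -> 0 < c ->
  cos (atan (s / c)) = c /\ sin (atan (s / c)) = s.
Proof.
  intros H Hc. rewrite cos_atan, sin_atan.
  assert (E : 1 + (s / c)² = (1 / c)²).
  { transitivity ((c ^ 2 + s ^ 2) * / c ^ 2); [unfold Rsqr; field; lra | rewrite H; unfold Rsqr; field; lra]. }
  rewrite E, sqrt_Rsqr by (left; apply Rdiv_lt_0_compat; lra).
  split; field; lra.
Qed.

Lemma cos_eq_1 (e : R) : Rabs e < PI -> cos e = 1 -> e = 0.
Proof.
  intros He Hc.
  destruct (Req_dec e 0) as [|Hn]; [assumption|exfalso].
  assert (Hs : 0 < sin (Rabs e / 2)).
  { pose proof (Rabs_pos_lt e Hn). apply sin_gt_0; lra. }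
  assert (Hc' : cos (Rabs e) = 1).
  { unfold Rabs; destruct (Rcase_abs e); rewrite ?cos_neg; exact Hc. }
  replace (Rabs e) with (2 * (Rabs e / 2)) in Hc' by field.
  rewrite cos_2a_sin in Hc'. nra.
Qed.

Section Lift.
Context (J : R -> Prop) (HJ : is_open_interval J) (HJ0 : J 0).
Context (c s : R -> R) (Hc : cont_on J c) (Hs : cont_on J s).
Context (Hcs : forall x, J x -> c x ^ 2 + s x ^ 2 = 1).
Context (t0 : R) (Ht0 : cos t0 = c 0 /\ sin t0 = s 0).

Definition is_lift (a b : R) (th : R -> R) : Prop :=
  a < 0 < b /\ J a /\ J b /\ th 0 = t0 /\
  forall x, a < x < b -> continuous th x /\ cos (th x) = c x /\ sin (th x) = s x.

(** On the segment from 0 to x cut into steps of length h x, add up the small rotation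
    angles, each given by atan as long as the angle is less than a right angle. *)
Fixpoint radial_angle (h : R) (k : nat) (x : R) : R :=
  match k with
  | O => t0
  | S k => let u := INR k * h * x in let v := INR (S k) * h * x in
     radial_angle h k x + atan ((c u * s v - s u * c v) / (c u * c v + s u * s v))
  end.

Lemma radial_angle_0 (h : R) (k : nat) : radial_angle h k 0 = t0.
Proof.
  induction k as [|k IH]; [reflexivity|]. cbn [radial_angle]; rewrite IH, !Rmult_0_r.
  replace (c 0 * s 0 - s 0 * c 0) with 0 by ring.
  unfold Rdiv; rewrite Rmult_0_l, atan_0. ring.
Qed.

Lemma continuous_dilation (g : R -> R) (k x : R) :
  continuous g (k * x) -> continuous (fun x => g (k * x)) x.
Proof.
  intros H. apply (continuous_comp (fun x => k * x) g); [|exact H].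
  apply continuity_pt_filterlim; reg.
Qed.

Lemma radial_angle_spec (h x : R) (n : nat) :
  (forall k, (k <= n)%nat -> J (INR k * h * x)) ->
  (forall k, (k < n)%nat ->
     let u := INR k * h * x in let v := INR (S k) * h * x in 0 < c u * c v + s u * s v) ->
  continuous (radial_angle h n) x /\
  cos (radial_angle h n x) = c (INR n * h * x) /\ sin (radial_angle h n x) = s (INR n * h * x).
Proof.
  induction n as [|n IH]; intros HJn Hpos.
  - cbn [radial_angle INR]. rewrite !Rmult_0_l. split; [apply continuous_const | exact Ht0].
  - destruct IH as [I1 [I2 I3]].
    { intros k Hk; apply HJn; lia. }
    { intros k Hk; apply Hpos; lia. }
    assert (P := Hpos n (Nat.lt_succ_diag_r n)). cbv zeta in P.
    assert (Ju := HJn n (Nat.le_succ_diag_r n)). assert (Jv := HJn (S n) (le_n _)).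
    cbn [radial_angle]. cbv zeta.
    set (u := INR n * h * x) in *. set (v := INR (S n) * h * x) in *.
    split.
    + apply (continuous_plus (V := R_NormedModule) (radial_angle h n)); [exact I1|].
      apply (continuous_comp _ atan).
      2:{ apply continuity_pt_filterlim, derivable_continuous_pt, derivable_pt_atan. }
      assert (Cc : forall k, J (k * h * x) -> continuous (fun x => c (k * h * x)) x).
      { intros k Hk; apply (continuous_dilation c (k * h)), Hc, Hk. }
      assert (Cs : forall k, J (k * h * x) -> continuous (fun x => s (k * h * x)) x).
      { intros k Hk; apply (continuous_dilation s (k * h)), Hs, Hk. }
      pose proof (Cc _ Ju) as A1; pose proof (Cc _ Jv) as A2;
      pose proof (Cs _ Ju) as B1; pose proof (Cs _ Jv) as B2.
      apply continuity_pt_filterlim in A1, A2, B1, B2.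
      apply continuity_pt_filterlim.
      apply (continuity_pt_div
        (fun x => c (INR n * h * x) * s (INR (S n) * h * x) - s (INR n * h * x) * c (INR (S n) * h * x))
        (fun x => c (INR n * h * x) * c (INR (S n) * h * x) + s (INR n * h * x) * s (INR (S n) * h * x))).
      * apply (continuity_pt_minus (fun x => c (INR n * h * x) * s (INR (S n) * h * x))
          (fun x => s (INR n * h * x) * c (INR (S n) * h * x)));
          [apply (continuity_pt_mult (fun x => c (INR n * h * x)) (fun x => s (INR (S n) * h * x)))
          |apply (continuity_pt_mult (fun x => s (INR n * h * x)) (fun x => c (INR (S n) * h * x)))]; assumption.
      * apply (continuity_pt_plus (fun x => c (INR n * h * x) * c (INR (S n) * h * x))
          (fun x => s (INR n * h * x) * s (INR (S n) * h * x)));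
          [apply (continuity_pt_mult (fun x => c (INR n * h * x)) (fun x => c (INR (S n) * h * x)))
          |apply (continuity_pt_mult (fun x => s (INR n * h * x)) (fun x => s (INR (S n) * h * x)))]; assumption.
      * fold u v. lra.
    + assert (Eu := Hcs u Ju). assert (Ev := Hcs v Jv).
      destruct (atan_angle (c u * c v + s u * s v) (c u * s v - s u * c v)) as [A1 A2];
        [nra | exact P |].
      rewrite cos_plus, sin_plus, A1, A2, I2, I3.
      split.
      * transitivity ((c u ^ 2 + s u ^ 2) * c v); [ring | rewrite Eu; ring].
      * transitivity ((c u ^ 2 + s u ^ 2) * s v); [ring | rewrite Eu; ring].
Qed.

(** On a compact interval the function is uniformly continuous, so a fixed number n of
    steps makes all of the small angles less than a right angle, for all x at once. *)
Lemma lift_exists (a b : R) : a < 0 < b -> J a -> J b -> exists th, is_lift a b th.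
Proof.
  intros Hab Ja Jb.
  assert (Hcomp : forall x, a <= x <= b -> J x) by (intros x Hx; exact (proj2 HJ a b x Ja Jb Hx)).
  destruct (unifcont_normed_1d (V := R_NormedModule) c a b) with (eps := mkposreal (1/2) ltac:(lra))
    as [d1 H1]; [intros x Hx; apply Hc, Hcomp, Hx|].
  destruct (unifcont_normed_1d (V := R_NormedModule) s a b) with (eps := mkposreal (1/2) ltac:(lra))
    as [d2 H2]; [intros x Hx; apply Hs, Hcomp, Hx|].
  set (d := Rmin d1 d2).
  assert (Hd : 0 < d) by (apply Rmin_pos; apply cond_pos).
  destruct (archimed_cor1 (d / (b - a))) as [n [Hn Hn0]]; [apply Rdiv_lt_0_compat; lra|].
  assert (HnR : 0 < INR n) by (apply lt_0_INR; exact Hn0).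
  exists (radial_angle (/ INR n) n). split; [exact Hab | split; [exact Ja | split; [exact Jb | split; [apply radial_angle_0|]]]].
  intros x Hx.
  assert (Hh : 0 < / INR n) by (apply Rinv_0_lt_compat; exact HnR).
  assert (Hk : forall k, (k <= n)%nat -> a <= INR k * / INR n * x <= b).
  { intros k Hk. apply le_INR in Hk. pose proof (pos_INR k).
    assert (K : 0 <= INR k * / INR n <= 1).
    { split; [apply Rmult_le_pos; lra|]. apply Rmult_le_reg_r with (INR n); [exact HnR|].
      field_simplify; lra. }
    split; nra. }
  destruct (radial_angle_spec (/ INR n) x n) as [C1 [C2 C3]].
  - intros k Hk'; apply Hcomp, Hk, Hk'.
  - intros k Hk'. cbv zeta.
    assert (Ku := Hk k ltac:(lia)). assert (Kv := Hk (S k) ltac:(lia)).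
    set (u := INR k * / INR n * x) in *. set (v := INR (S k) * / INR n * x) in *.
    assert (Huv : Rabs (v - u) < d).
    { replace (v - u) with (/ INR n * x) by (unfold u, v; rewrite S_INR; ring).
      rewrite Rabs_mult, (Rabs_pos_eq (/ INR n)) by lra.
      apply Rlt_le_trans with (d / (b - a) * (b - a)).
      - assert (Rabs x < b - a) by (apply Rabs_lt_between; lra).
        pose proof (Rabs_pos x). apply Rmult_le_0_lt_compat; lra.
      - right; field; lra. }
    assert (D1 : Rabs (c v - c u) < 1 / 2).
    { apply (H1 u v Ku Kv). eapply Rlt_le_trans; [exact Huv | apply Rmin_l]. }
    assert (D2 : Rabs (s v - s u) < 1 / 2).
    { apply (H2 u v Ku Kv). eapply Rlt_le_trans; [exact Huv | apply Rmin_r]. }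
    apply Rabs_lt_between in D1, D2.
    assert (Eu := Hcs u (Hcomp u Ku)). assert (Ev := Hcs v (Hcomp v Kv)).
    assert (Q1 : (c v - c u) ^ 2 < 1) by nra. assert (Q2 : (s v - s u) ^ 2 < 1) by nra.
    nra.
  - assert (En : INR n * / INR n * x = x) by (field; lra).
    rewrite En in C2, C3. split; [exact C1 | split; assumption].
Qed.

(** The difference of two lifts has cosine 1; by continuity it is locally constant,
    hence constant. *)
Lemma lift_unique (a b a' b' : R) (th th' : R -> R) (x : R) :
  is_lift a b th -> is_lift a' b' th' -> a < x < b -> a' < x < b' -> th x = th' x.
Proof.
  intros [Hab [Ja [Jb [H0 H]]]] [Hab' [Ja' [Jb' [H0' H']]]] Hx Hx'.
  set (I := fun y => a < y < b /\ a' < y < b').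
  assert (HI : is_open_interval I).
  { split.
    - apply open_and; apply open_and; [apply open_gt | apply open_lt | apply open_gt | apply open_lt].
    - intros u v y [Hu Hu'] [Hv Hv'] Hy; unfold I; lra. }
  assert (D : th x - th' x = th 0 - th' 0).
  { apply (const_of_derive_zero (V := R_NormedModule) I (fun y => th y - th' y)); try (unfold I; lra); [exact HI|].
    intros y [Hy Hy'].
    destruct (H y Hy) as [C1 [E1 F1]], (H' y Hy') as [C2 [E2 F2]].
    assert (CD : continuous (fun y => th y - th' y) y).
    { apply (continuous_minus (V := R_NormedModule)); assumption. }
    destruct (proj1 (continuous_eps (V := R_NormedModule) _ y) CD (mkposreal PI PI_RGT_0)) as [d Hd].
    apply (is_derive_ext_loc (fun _ => th y - th' y)); [|apply (is_derive_const (V := R_NormedModule))].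
    destruct (proj1 HI y (conj Hy Hy')) as [d' Hd'].
    exists (mkposreal _ (Rmin_stable_in_posreal d d')). intros z Hz.
    assert (Z1 : Rabs (z - y) < d) by (eapply Rlt_le_trans; [exact Hz | apply Rmin_l]).
    assert (Z2 : Rabs (z - y) < d') by (eapply Rlt_le_trans; [exact Hz | apply Rmin_r]).
    specialize (Hd z Z1). destruct (Hd' z Z2) as [Iz Iz'].
    destruct (H z Iz) as [_ [E3 F3]], (H' z Iz') as [_ [E4 F4]].
    assert (Cos1 : forall w, a < w < b -> cos (th w) = c w -> sin (th w) = s w ->
             cos (th' w) = c w -> sin (th' w) = s w -> cos (th w - th' w) = 1 /\ sin (th w - th' w) = 0).
    { intros w Hw A1 A2 A3 A4. assert (Jw : J w) by (apply (proj2 HJ a b w Ja Jb); lra).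
      specialize (Hcs w Jw). rewrite cos_minus, sin_minus, A1, A2, A3, A4. split; nra. }
    destruct (Cos1 y Hy E1 F1 E2 F2) as [Y1 Y2]. destruct (Cos1 z Iz E3 F3 E4 F4) as [Z3 Z4].
    enough (K : (th z - th' z) - (th y - th' y) = 0) by (simpl in *; lra).
    apply cos_eq_1; [exact Hd|]. rewrite cos_minus, Y1, Y2, Z3, Z4. ring. }
  rewrite H0, H0' in D. lra.
Qed.

Lemma lift_around (x : R) : J x -> exists a b th, a < x < b /\ is_lift a b th.
Proof.
  intros Hx.
  assert (Hl : forall y, J y -> exists u v, u < y < v /\ J u /\ J v).
  { intros y Hy; destruct (proj1 HJ y Hy) as [d Hd]. pose proof (cond_pos d).
    exists (y - d / 2), (y + d / 2). split; [lra|]. split; apply Hd; unfold ball; simpl;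
      unfold AbsRing_ball, abs, minus, plus, opp; simpl; apply Rabs_lt_between; lra. }
  destruct (Hl x Hx) as [u [v [Huv [Ju Jv]]]]. destruct (Hl 0 HJ0) as [u' [v' [Huv' [Ju' Jv']]]].
  assert (Jm : J (Rmin u u')) by (unfold Rmin; destruct (Rle_dec u u'); assumption).
  assert (JM : J (Rmax v v')) by (unfold Rmax; destruct (Rle_dec v v'); assumption).
  pose proof (Rmin_l u u'); pose proof (Rmin_r u u'); pose proof (Rmax_l v v'); pose proof (Rmax_r v v').
  destruct (lift_exists (Rmin u u') (Rmax v v')) as [th Hth]; try assumption; [lra|].
  exists (Rmin u u'), (Rmax v v'), th. split; [lra | exact Hth].
Qed.

(** Lifts over compact intervals agree where they overlap, so their common value is a
    definite description. *)
Definition glued_lift (x : R) : R :=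
  iota (T := R_CompleteNormedModule)
    (fun t => exists a b th, a < x < b /\ is_lift a b th /\ th x = t).

Lemma glued_lift_eq (a b : R) (th : R -> R) (x : R) :
  is_lift a b th -> a < x < b -> glued_lift x = th x.
Proof.
  intros Hth Hx. apply (iota_unique (V := R_CompleteNormedModule)).
  - intros t [a' [b' [th' [Hx' [Hth' <-]]]]]. apply (lift_unique a' b' a b); assumption.
  - exists a, b, th. split; [exact Hx | split; [exact Hth | reflexivity]].
Qed.

Lemma glued_lift_spec (x : R) : J x ->
  continuous glued_lift x /\ cos (glued_lift x) = c x /\ sin (glued_lift x) = s x.
Proof.
  intros Hx. destruct (lift_around x Hx) as [a [b [th [Hab Hth]]]].
  rewrite (glued_lift_eq a b th x Hth Hab).
  destruct (proj2 (proj2 (proj2 (proj2 Hth))) x Hab) as [C1 C2].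
  split; [|exact C2].
  apply (continuous_ext_loc glued_lift th x); [|exact C1].
  assert (Ho : open (fun y => a < y < b)) by (apply open_and; [apply open_gt | apply open_lt]).
  generalize (Ho x Hab). apply filter_imp. intros y Hy. symmetry. apply (glued_lift_eq a b); assumption.
Qed.
End Lift.

Lemma continuous_angle (J : R -> Prop) (c s : R -> R) :
  is_open_interval J -> J 0 -> cont_on J c -> cont_on J s ->
  (forall x, J x -> c x ^ 2 + s x ^ 2 = 1) ->
  exists th, forall x, J x -> continuous th x /\ cos (th x) = c x /\ sin (th x) = s x.
Proof.
  intros HJ HJ0 Hc Hs Hcs.
  destruct (unit_angle (c 0) (s 0) (Hcs 0 HJ0)) as [t0 Ht0].
  exists (glued_lift J c s t0). intros x Hx. apply glued_lift_spec; assumption.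
Qed.

(** * Euclidean 3-space as su(2) *)

Definition su (v : vec3) : Mat :=
  mk (0, vc3 v / 2) (- vc2 v / 2, vc1 v / 2) (vc2 v / 2, vc1 v / 2) (0, - vc3 v / 2).

Lemma su_minus (u v : vec3) : su (minus u v) = minus (su u) (su v).
Proof.
  destruct u as [[a b] c], v as [[a' b'] c']. unfold su, vc1, vc2, vc3.
  cbn [fst snd]. mcoord; apply injective_projections; cbn; unfold mult, minus, plus, opp; cbn; field.
Qed.
Lemma su_scal (r : R) (v : vec3) : su (scal r v) = scal r (su v).
Proof.
  destruct v as [[a b] c]. unfold su, vc1, vc2, vc3.
  mcoord; apply injective_projections; cbn; unfold scal, mult; cbn; field.
Qed.
Lemma su_vscal (r : R) (v : vec3) : su (vscal r v) = scal r (su v).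
Proof. exact (su_scal r v). Qed.

Lemma su_cross (u v : vec3) : su (cross u v) = minus (mul (su u) (su v)) (mul (su v) (su u)).
Proof.
  destruct u as [[a b] c], v as [[a' b'] c']. unfold su, cross, vc1, vc2, vc3.
  mcoord; apply injective_projections; cbn; field.
Qed.
(** With the normalization of the basis, the anticommutator is the scalar -<u,v>/2. *)
Lemma su_dot (u v : vec3) :
  plus (mul (su u) (su v)) (mul (su v) (su u)) = scal (- dot u v / 2) mone.
Proof.
  destruct u as [[a b] c], v as [[a' b'] c']. unfold su, dot, vc1, vc2, vc3.
  mcoord; apply injective_projections; cbn; field.
Qed.
Lemma su_inj (u v : vec3) : su u = su v -> u = v.
Proof.
  destruct u as [[a b] c], v as [[a' b'] c']. intros H.
  pose proof (f_equal (fun A => snd (m11 A)) H) as H1.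
  pose proof (f_equal (fun A => snd (m21 A)) H) as H2.
  pose proof (f_equal (fun A => fst (m21 A)) H) as H3.
  cbn in H1, H2, H3. f_equal; [f_equal|]; lra.
Qed.
Lemma su_dagger (v : vec3) : dagger (su v) = opp (su v).
Proof.
  destruct v as [[a b] c]. unfold dagger, su, vc1, vc2, vc3.
  mcoord; apply injective_projections; cbn; field.
Qed.
Lemma su_tracefree (v : vec3) : tracefree (su v).
Proof. unfold tracefree, su; cbn. apply injective_projections; cbn; field. Qed.

Lemma skew_su (v : vec3) : skew (su v).
Proof. split; [apply su_dagger | apply su_tracefree]. Qed.

(** The inverse of [su] on trace-free skew-Hermitian matrices. *)
Definition unsu (M : Mat) : vec3 := (2 * snd (m21 M), 2 * fst (m21 M), 2 * snd (m11 M)).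

Lemma unsu_su (v : vec3) : unsu (su v) = v.
Proof.
  destruct v as [[a b] c]. unfold unsu, su, vc1, vc2, vc3; cbn.
  apply f_equal2; [apply f_equal2|]; field.
Qed.

Lemma su_unsu (M : Mat) : skew M -> su (unsu M) = M.
Proof.
  intros [H T]. unfold tracefree in T.
  destruct M as [[[a a'] [b b']] [[c c'] [d d']]].
  pose proof (f_equal (fun A => fst (m11 A)) H) as H1.
  pose proof (f_equal (fun A => fst (m12 A)) H) as H2.
  pose proof (f_equal (fun A => snd (m12 A)) H) as H3.
  pose proof (f_equal (fun A => fst (m22 A)) H) as H4.
  cbn in H1, H2, H3, H4. injection T as T1 T2.
  unfold su, unsu, vc1, vc2, vc3; apply mat_eq; apply injective_projections; cbn; lra.
Qed.

(** In the Frobenius norm su(2) is embedded as a contraction; hence derivatives and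
    continuity transfer. *)
Lemma norm_su (v : vec3) : norm (su v) <= norm v.
Proof.
  rewrite norm_sq.
  destruct v as [[a b] c].
  change (norm (a, b, c)) with (sqrt (sqrt (Rabs a ^ 2 + Rabs b ^ 2) ^ 2 + Rabs c ^ 2)).
  apply sqrt_le_1_alt. rewrite pow2_sqrt by nra.
  unfold su, m11, m12, m21, m22, mk, vc1, vc2, vc3, Cmod; cbn [fst snd].
  rewrite !pow2_sqrt by nra. rewrite !pow2_abs. nra.
Qed.

Lemma is_derive_su (g : R -> vec3) (x : R) (l : vec3) :
  is_derive g x l -> is_derive (fun s => su (g s)) x (su l).
Proof. apply (is_derive_contraction su); [exact su_minus | exact su_scal | exact norm_su]. Qed.

Lemma continuous_su {T : UniformSpace} (g : T -> vec3) (x : T) :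
  continuous g x -> continuous (fun s => su (g s)) x.
Proof. apply (continuous_contraction su); [exact su_minus | exact norm_su]. Qed.

Lemma vec_derive (g : R -> vec3) (x : R) : ex_derive g x ->
  is_derive g x (Derive (fun s => vc1 (g s)) x, Derive (fun s => vc2 (g s)) x, Derive (fun s => vc3 (g s)) x).
Proof.
  intros [[[l1 l2] l3] Hl].
  assert (N : forall v : vec3, Rabs (vc1 v) <= norm v /\ Rabs (vc2 v) <= norm v /\ Rabs (vc3 v) <= norm v).
  { intros [[a b] c]. unfold vc1, vc2, vc3; cbn [fst snd].
    change (norm (a, b, c)) with (sqrt (sqrt (Rabs a ^ 2 + Rabs b ^ 2) ^ 2 + Rabs c ^ 2)).
    rewrite pow2_sqrt by nra.
    rewrite <- (sqrt_pow2 (Rabs a)) at 1 by apply Rabs_pos.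
    rewrite <- (sqrt_pow2 (Rabs b)) at 2 by apply Rabs_pos.
    rewrite <- (sqrt_pow2 (Rabs c)) at 3 by apply Rabs_pos.
    repeat split; apply sqrt_le_1_alt; nra. }
  assert (E1 : is_derive (fun s => vc1 (g s)) x l1).
  { apply (is_derive_contraction (W := R_NormedModule) vc1 g x (l1, l2, l3)); try reflexivity; [apply N | exact Hl]. }
  assert (E2 : is_derive (fun s => vc2 (g s)) x l2).
  { apply (is_derive_contraction (W := R_NormedModule) vc2 g x (l1, l2, l3)); try reflexivity; [apply N | exact Hl]. }
  assert (E3 : is_derive (fun s => vc3 (g s)) x l3).
  { apply (is_derive_contraction (W := R_NormedModule) vc3 g x (l1, l2, l3)); try reflexivity; [apply N | exact Hl]. }
  match goal with |- is_derive g x ?l => replace l with (l1, l2, l3) end; [exact Hl|].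
  f_equal; [f_equal|]; symmetry; apply is_derive_unique; assumption.
Qed.

Ltac vring := intros;
  repeat match goal with v : vec3 |- _ => destruct v as [[? ?] ?] end;
  unfold cross, dot, vscal, vadd, vopp, vzero, vc1, vc2, vc3; cbn [fst snd];
  repeat match goal with |- (_, _) = (_, _) => apply f_equal2 end; ring.

Lemma cross_cross_r (u n : vec3) :
  cross (cross n u) n = vadd (vscal (dot n n) u) (vscal (- dot n u) n).
Proof. vring. Qed.

Lemma cross_of_normal_crosses (n u v : vec3) :
  cross (cross n u) (cross n v) = vscal (dot n (cross u v)) n.
Proof. vring. Qed.

Lemma cross_expand (n w : vec3) :
  vscal (dot n n) w = vadd (vscal (dot n w) n) (vopp (cross n (cross n w))).
Proof. vring. Qed.

Lemma cross_bac (n u v : vec3) :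
  cross n (cross u v) = vadd (vscal (dot n v) u) (vscal (- dot n u) v).
Proof. vring. Qed.

(** Both tangent vectors are orthogonal to n, so their cross product is a multiple of
    n. *)
Lemma cross_tangent (n u v : vec3) :
  dot n n = 1 -> dot n u = 0 -> dot n v = 0 -> cross u v = vscal (dot n (cross u v)) n.
Proof.
  intros H1 H2 H3.
  assert (E : vscal 1 (cross u v) = cross u v) by vring.
  rewrite <- E at 1. rewrite <- H1, cross_expand, (cross_bac n u v), H2, H3. generalize (dot n (cross u v)). vring.
Qed.

Lemma mul_sq_of_dot (u : vec3) : dot u u = 1 -> mul (su u) (su u) = scal (-1/4) mone.
Proof.
  intros H. pose proof (su_dot u u) as E. rewrite H in E.
  replace (mul (su u) (su u)) with (scal (1/2) (plus (mul (su u) (su u)) (mul (su u) (su u)))).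
  - rewrite E. mcoord; apply injective_projections; cbn; field.
  - generalize (mul (su u) (su u)). intros [[[a a'] [b b']] [[c c'] [e e']]].
    mcoord; apply injective_projections; cbn; field.
Qed.

Lemma anticommute_of_dot (u v : vec3) : dot u v = 0 ->
  plus (mul (su u) (su v)) (mul (su v) (su u)) = zero.
Proof.
  intros H. rewrite su_dot, H. mcoord; apply injective_projections; cbn; field.
Qed.

Lemma dot_of_anticommute (u v : vec3) :
  plus (mul (su u) (su v)) (mul (su v) (su u)) = zero -> dot u v = 0.
Proof.
  rewrite su_dot. intros H.
  pose proof (f_equal (fun A => fst (m11 A)) H) as E.
  rewrite scalE in E. cbn in E. lra.
Qed.

(** Orthogonality to the diagonal direction. *)
Lemma offdiag_of_anticommute (A : Mat) (e : R) : e <> 0 ->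
  plus (mul A (scal e (su e3))) (mul (scal e (su e3)) A) = zero -> offdiag A.
Proof.
  intros He H. rewrite scalE in H.
  destruct A as [[[a a'] [b b']] [[c c'] [d d']]].
  pose proof (f_equal (fun A => fst (m11 A)) H) as H1.
  pose proof (f_equal (fun A => snd (m11 A)) H) as H2.
  pose proof (f_equal (fun A => fst (m22 A)) H) as H3.
  pose proof (f_equal (fun A => snd (m22 A)) H) as H4.
  cbn in H1, H2, H3, H4.
  assert (K : forall z, e * z = 0 -> z = 0) by (intros z Hz; apply Rmult_integral in Hz; tauto).
  split; apply injective_projections; cbn; apply K; lra.
Qed.

Lemma rot_su (R0 : Mat) (v : vec3) : SU R0 -> su (unsu (rot R0 (su v))) = rot R0 (su v).
Proof. intros HR. apply su_unsu, rot_skew; [exact HR | apply skew_su]. Qed.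

(** The inner product and the cross product are expressed by matrix products, which
    conjugation preserves. *)
Lemma rotation_of_SU (R0 : Mat) : SU R0 -> rotation (fun v => unsu (rot R0 (su v))).
Proof.
  intros HR. split.
  - intros u v.
    pose proof (su_dot (unsu (rot R0 (su u))) (unsu (rot R0 (su v)))) as E.
    rewrite !rot_su, <- !rot_mul, <- rot_plus, su_dot, rot_scal_1 in E by exact HR.
    pose proof (f_equal (fun A => fst (m11 A)) E) as E1.
    rewrite !scalE in E1. cbn in E1. lra.
  - intros u v. apply su_inj.
    rewrite su_cross, !rot_su, su_cross, rot_minus, !rot_mul by exact HR. reflexivity.
Qed.

(** Half-angle formula: for v = (a, b, c) with c <> -1 the matrix has diagonal entry k,
    k^2 = (1 + c)/2. In both cases v = e3 and v = -e3 the identity will do, at the cost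
    of the sign. *)
Lemma rotation_to_e3 (v : vec3) : dot v v = 1 ->
  exists (R0 : Mat) (sgn : R), SU R0 /\ sgn <> 0 /\ rot R0 (su v) = scal sgn (su e3) /\
    (v = e3 \/ v = vopp e3 -> R0 = mone).
Proof.
  intros Hv.
  assert (R1 : rot mone (su v) = su v).
  { unfold rot. rewrite adj_1, mul_1_l. apply mul_1_r. }
  destruct v as [[a b] c]. unfold dot, vc1, vc2, vc3 in Hv; cbn [fst snd] in Hv.
  destruct (Req_dec c (-1)) as [Hc | Hc].
  - assert (a = 0) by nra. assert (b = 0) by nra. subst.
    exists mone, (-1). split; [apply SU_1 | split; [lra | split; [|reflexivity]]].
    rewrite R1, <- su_vscal. f_equal. unfold vscal, e3, vc1, vc2, vc3; cbn.
    apply f_equal2; [apply f_equal2|]; ring.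
  - assert (Hc1 : 0 < 1 + c) by nra.
    set (k := sqrt ((1 + c) / 2)).
    assert (Hk : 0 < k) by (apply sqrt_lt_R0; lra).
    assert (Hk2 : k * k = (1 + c) / 2) by (apply sqrt_sqrt; lra).
    set (p := - a / (2 * k)). set (q := - b / (2 * k)).
    assert (Hp : p * k = - a / 2) by (unfold p; field; lra).
    assert (Hq : q * k = - b / 2) by (unfold q; field; lra).
    assert (Hpq : p * p + q * q = (1 - c) / 2).
    { apply Rmult_eq_reg_r with (k * k); [|nra].
      transitivity ((p * k) * (p * k) + (q * k) * (q * k)); [ring|].
      rewrite Hp, Hq, Hk2. nra. }
    exists (mk (k, 0) (p, q) (- p, q) (k, 0)), 1.
    assert (HS : SU (mk (k, 0) (p, q) (- p, q) (k, 0))).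
    { split; unfold dagger, adj; mcoord; apply injective_projections; cbn; nra. }
    split; [exact HS | split; [lra | split]].
    + replace (su (a, b, c)) with (rot (adj (mk (k, 0) (p, q) (- p, q) (k, 0))) (su e3)).
      * rewrite <- (adj_adj (mk (k, 0) (p, q) (- p, q) (k, 0))) at 1.
        rewrite rot_rot by (apply SU_adj, HS). mring.
      * unfold rot, adj, su, e3, vc1, vc2, vc3; mcoord; apply injective_projections; cbn; nra.
    + intros [E | E]; injection E as Ea Eb Ec; [|lra].
      assert (Hk1 : k = 1).
      { unfold k. rewrite Ec. replace ((1 + 1) / 2) with 1 by field. apply sqrt_1. }
      unfold p, q. rewrite Ea, Eb, Hk1.
      apply mat_eq; apply injective_projections; cbn; field.
Qed.

(** * Structure equations of a pseudospherical front *)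

Lemma C1_dx (J : R -> Prop) (g : R -> R -> vec3) (x y : R) : is_C1 J g -> J x -> J y ->
  is_derive (fun s => g s y) x (dx g x y).
Proof. intros [H _] Hx Hy. exact (vec_derive (fun s => g s y) x (proj1 (H x y Hx Hy))). Qed.

Lemma C1_dy (J : R -> Prop) (g : R -> R -> vec3) (x y : R) : is_C1 J g -> J x -> J y ->
  is_derive (fun t => g x t) y (dy g x y).
Proof. intros [H _] Hx Hy. exact (vec_derive (fun t => g x t) y (proj2 (H x y Hx Hy))). Qed.

Lemma C1M_dxdy (J : R -> Prop) (g : R -> R -> vec3) (x y : R) : is_C1M J g -> J x -> J y ->
  is_derive (fun t => dx g x t) y (dy (dx g) x y).
Proof. intros [_ [H _]] Hx Hy. exact (vec_derive (fun t => dx g x t) y (proj1 (H x y Hx Hy))). Qed.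

Lemma C1M_dydx (J : R -> Prop) (g : R -> R -> vec3) (x y : R) : is_C1M J g -> J x -> J y ->
  is_derive (fun s => dy g s y) x (dx (dy g) x y).
Proof. intros [_ [H _]] Hx Hy. exact (vec_derive (fun s => dy g s y) x (proj2 (H x y Hx Hy))). Qed.

Section Front.
Context (J : R -> Prop) (HJ : is_open_interval J) (f N : R -> R -> vec3).
Context (HF : ps_front_with J f N).

Let f2 : is_C1M J f := proj1 (proj2 HF).
Let N1 : is_C1 J N := proj1 (proj1 (proj1 (proj2 (proj2 HF)))).
Let N2 : is_C1M J N := proj1 (proj2 (proj1 (proj2 (proj2 HF)))).

Lemma normal_unit (x y : R) : J x -> J y -> dot (N x y) (N x y) = 1.
Proof. intros; apply (proj1 (proj2 (proj2 (proj1 (proj2 (proj2 HF)))))); assumption. Qed.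

Lemma front_dx (x y : R) : J x -> J y -> dx f x y = cross (N x y) (dx N x y).
Proof. intros; apply (proj2 (proj2 (proj2 HF))); assumption. Qed.
Lemma front_dy (x y : R) : J x -> J y -> dy f x y = vopp (cross (N x y) (dy N x y)).
Proof. intros; apply (proj2 (proj2 (proj2 HF))); assumption. Qed.

(** Differentiate the constant matrix su(g)^2 = -1/4. *)
Lemma unit_derive_orthogonal (g : R -> vec3) (x : R) (l : vec3) :
  J x -> (forall s, J s -> dot (g s) (g s) = 1) -> is_derive g x l -> dot (g x) l = 0.
Proof.
  intros Hx Hu Hg. apply dot_of_anticommute.
  apply (derive_unique (fun s => mul (su (g s)) (su (g s))) x).
  - rewrite plus_comm. apply is_derive_mul; apply is_derive_su, Hg.
  - apply (is_derive_ext_loc (fun _ => scal (-1/4) mone)); [|apply (is_derive_const (V := Mat))].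
    generalize (proj1 HJ x Hx). apply filter_imp. intros s Js.
    symmetry; apply mul_sq_of_dot, Hu, Js.
Qed.

Lemma normal_dx (x y : R) : J x -> J y -> dot (N x y) (dx N x y) = 0.
Proof.
  intros Hx Hy. apply (unit_derive_orthogonal (fun s => N s y)); [exact Hx | | apply (C1_dx J); assumption].
  intros s Js; apply normal_unit; assumption.
Qed.
Lemma normal_dy (x y : R) : J x -> J y -> dot (N x y) (dy N x y) = 0.
Proof.
  intros Hx Hy. apply (unit_derive_orthogonal (fun t => N x t)); [exact Hy | | apply (C1_dy J); assumption].
  intros s Js; apply normal_unit; assumption.
Qed.

Lemma normal_dx_cross (x y : R) : J x -> J y -> dx N x y = cross (dx f x y) (N x y).
Proof.
  intros Hx Hy. rewrite front_dx, cross_cross_r, normal_unit, normal_dx by assumption.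
  generalize (dx N x y) (N x y). vring.
Qed.
Lemma normal_dy_cross (x y : R) : J x -> J y -> dy N x y = cross (N x y) (dy f x y).
Proof.
  intros Hx Hy. rewrite front_dy by assumption.
  transitivity (cross (cross (N x y) (dy N x y)) (N x y)).
  - rewrite cross_cross_r, normal_unit, normal_dy by assumption.
    generalize (dy N x y) (N x y). vring.
  - generalize (dy N x y) (N x y). vring.
Qed.

(** From f_x = N x N_x: the term N x N_xy drops out as N_xy is a multiple of N. *)
Lemma front_dxdy (x y : R) : J x -> J y -> dy (dx f) x y = cross (dy N x y) (dx N x y).
Proof.
  intros Hx Hy. apply su_inj.
  apply (derive_unique (fun t => su (dx f x t)) y); [apply is_derive_su, (C1M_dxdy J); assumption|].
  apply (is_derive_ext_loc (fun t => su (cross (N x t) (dx N x t)))).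
  { generalize (proj1 HJ y Hy). apply filter_imp. intros t Jt. rewrite front_dx by assumption. reflexivity. }
  apply (is_derive_ext (fun t => minus (mul (su (N x t)) (su (dx N x t))) (mul (su (dx N x t)) (su (N x t))))).
  { intros t; symmetry; apply su_cross. }
  destruct (proj2 (proj2 (proj2 (proj1 (proj2 (proj2 HF)))))) as [h Hh].
  destruct (Hh x y Hx Hy) as [Hxy _].
  assert (D1 : is_derive (fun t => su (N x t)) y (su (dy N x y))) by (apply is_derive_su, (C1_dy J); assumption).
  assert (D2 : is_derive (fun t => su (dx N x t)) y (scal (h x y) (su (N x y)))).
  { rewrite <- su_vscal, <- Hxy. apply is_derive_su, (C1M_dxdy J); assumption. }
  rewrite su_cross.
  replace (minus (mul (su (dy N x y)) (su (dx N x y))) (mul (su (dx N x y)) (su (dy N x y)))) with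
    (minus (plus (mul (su (dy N x y)) (su (dx N x y))) (mul (su (N x y)) (scal (h x y) (su (N x y)))))
           (plus (mul (scal (h x y) (su (N x y))) (su (N x y))) (mul (su (dx N x y)) (su (dy N x y)))))
    by mnc.
  apply (is_derive_minus (V := Mat)).
  - apply (is_derive_mul (fun t => su (N x t)) (fun t => su (dx N x t))); assumption.
  - apply (is_derive_mul (fun t => su (dx N x t)) (fun t => su (N x t))); assumption.
Qed.

(** Zero curvature equation in disguise: f_x x f_y = -(N x N_x) x (N x N_y) = N_y x
    N_x. *)
Lemma front_dxdy_cross (x y : R) : J x -> J y -> dy (dx f) x y = cross (dx f x y) (dy f x y).
Proof.
  intros Hx Hy. rewrite front_dxdy, (front_dx x y), (front_dy x y) by assumption.
  transitivity (vopp (cross (cross (N x y) (dx N x y)) (cross (N x y) (dy N x y)))).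
  - rewrite cross_of_normal_crosses, <- cross_tangent.
    + generalize (dx N x y) (dy N x y). vring.
    + apply normal_unit; assumption.
    + apply normal_dx; assumption.
    + apply normal_dy; assumption.
  - generalize (dx N x y) (dy N x y) (N x y). vring.
Qed.

Definition kappa (x y : R) : R := dot (N x y) (dy (dx f) x y).

Lemma front_dxdy_normal (x y : R) : J x -> J y -> dy (dx f) x y = vscal (kappa x y) (N x y).
Proof.
  intros Hx Hy. unfold kappa. rewrite front_dxdy by assumption.
  apply cross_tangent; [apply normal_unit | apply normal_dy | apply normal_dx]; assumption.
Qed.

Lemma front_normal_dx (x y : R) : J x -> J y -> dot (dx f x y) (N x y) = 0.
Proof. intros Hx Hy. rewrite front_dx by assumption. generalize (dx N x y) (N x y). vring. Qed.
Lemma front_normal_dy (x y : R) : J x -> J y -> dot (dy f x y) (N x y) = 0.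
Proof. intros Hx Hy. rewrite front_dy by assumption. generalize (dy N x y) (N x y). vring. Qed.
End Front.

(** Joint continuity of N follows from that of its partial derivatives; kappa is then
    read off from the product su(N) su(f_xy). *)
Lemma kappa_cont (J : R -> Prop) (f N : R -> R -> vec3) (x y : R) :
  is_open_interval J -> ps_front_with J f N -> J x -> J y ->
  continuous (fun p : R * R => kappa f N (fst p) (snd p)) (x, y).
Proof.
  intros HJ HF Hx Hy.
  assert (CN : continuous (fun p : R * R => su (N (fst p) (snd p))) (x, y)).
  { destruct HF as [_ [_ [[[N1 _] _] _]]].
    apply (continuous_of_partial J (fun x y => su (N x y)) (fun x y => su (dx N x y))); try assumption.
    - intros u v Ju Jv. apply is_derive_su, (C1_dx J); assumption.
    - intros u v Ju Jv. apply continuous_su. apply (proj1 (proj2 N1)); assumption.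
    - apply (ex_derive_continuous (V := Mat) (fun y => su (N x y))). eexists.
      apply is_derive_su, (C1_dy J); assumption. }
  assert (Cr : continuous (fun p : R * R => su (dy (dx f) (fst p) (snd p))) (x, y)).
  { apply continuous_su. destruct HF as [_ [[_ [_ [H _]]] _]]. apply H; assumption. }
  apply (continuous_ext (fun p : R * R => -4 * fst (m11 (mul (su (N (fst p) (snd p))) (su (dy (dx f) (fst p) (snd p))))))).
  { intros p. unfold kappa.
    destruct (N (fst p) (snd p)) as [[u1 u2] u3], (dy (dx f) (fst p) (snd p)) as [[v1 v2] v3].
    unfold dot, su, vc1, vc2, vc3; cbn. field. }
  apply (continuous_scal_r (V := R_NormedModule) (-4)).
  apply (continuous_contraction (V := Mat) (W := R_NormedModule) (fun M => fst (m11 M))).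
  - reflexivity.
  - intros M. eapply Rle_trans; [apply Rabs_fst_le | apply Cmod_m11].
  - apply continuous_mul; assumption.
Qed.

(** * The extended frame and its Birkhoff factors *)

Lemma conj_derive (W U M : R -> Mat) (x : R) (A M' : Mat) :
  is_derive W x (mul (W x) A) -> is_derive U x (opp (mul A (U x))) -> is_derive M x M' ->
  is_derive (fun t => mul (mul (W t) (M t)) (U t)) x
    (mul (mul (W x) (plus M' (minus (mul A (M x)) (mul (M x) A)))) (U x)).
Proof.
  intros HW HU HM.
  replace (mul (mul (W x) (plus M' (minus (mul A (M x)) (mul (M x) A)))) (U x)) with
    (plus (mul (plus (mul (mul (W x) A) (M x)) (mul (W x) M')) (U x))
          (mul (mul (W x) (M x)) (opp (mul A (U x))))).
  2:{ generalize (W x) (M x) (U x). mnc. }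
  apply (is_derive_mul (fun t => mul (W t) (M t))); [|exact HU].
  apply is_derive_mul; assumption.
Qed.

(** Rewrites a coefficient standing between Z and U as a coefficient standing to the
    right of the rotated product Z U. *)
Lemma insert_inverses (R' R Z U W E : Mat) :
  mul R R' = mone -> mul U W = mone ->
  mul (mul (mul R' (mul Z U)) R) (mul (mul R' (mul (mul W E) U)) R) =
  mul (mul R' (mul (mul Z E) U)) R.
Proof.
  intros HR HU.
  transitivity (mul (mul R' (mul (mul (mul Z (mul U (mul (mul R R') W))) E) U)) R); [mnc|].
  rewrite HR, mul_1_l, HU, mul_1_r. reflexivity.
Qed.

(** Such a matrix is determined by one complex number of modulus 1/2, whose argument
    will be an angle of the potential. *)
Lemma offdiag_skew_shape (A : Mat) :
  offdiag A -> dagger A = opp A -> mul A A = scal (-1/4) mone ->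
  A = mk (RtoC 0) (m12 A) (- Cconj (m12 A))%C (RtoC 0) /\
  (2 * snd (m12 A)) ^ 2 + (2 * fst (m12 A)) ^ 2 = 1.
Proof.
  intros [O1 O2] HS HA.
  destruct A as [[a0 [z z']] [[w w'] d]].
  unfold m11, m22 in O1, O2; cbn [fst snd] in O1, O2. subst a0 d.
  pose proof (f_equal (fun A => fst (m21 A)) HS) as H1.
  pose proof (f_equal (fun A => snd (m21 A)) HS) as H2.
  cbn in H1, H2.
  pose proof (f_equal (fun A => fst (m11 A)) HA) as H3.
  rewrite scalE in H3. cbn in H3.
  assert (E1 : w = - z) by lra. assert (E2 : w' = z') by lra. subst w w'.
  unfold m12; cbn [fst snd]. split; [|lra].
  unfold mk, Cconj, Copp; cbn [fst snd]. repeat f_equal; ring.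
Qed.

Lemma eta_plus_coord (al : R -> R) (x : R) (l z : C) :
  cos (al x) = 2 * snd z -> sin (al x) = 2 * fst z ->
  eta_plus al x l = toM2 (cscal l (mk (RtoC 0) z (- Cconj z)%C (RtoC 0))).
Proof.
  intros Hc Hs. unfold eta_plus, toM2, cscal, mk, m11, m12, m21, m22; cbn [fst snd].
  unfold expi. rewrite cos_neg, sin_neg, Hc, Hs.
  destruct z as [u v], l as [p q].
  apply (f_equal4 mat2); apply injective_projections; cbn; field.
Qed.

Lemma eta_minus_coord (be : R -> R) (y : R) (l z : C) : l <> RtoC 0 ->
  cos (be y) = - 2 * snd z -> sin (be y) = 2 * fst z ->
  eta_minus be y l = toM2 (cscal (/ l)%C (mk (RtoC 0) z (- Cconj z)%C (RtoC 0))).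
Proof.
  intros Hl Hc Hs. unfold eta_minus, toM2, cscal, mk, m11, m12, m21, m22; cbn [fst snd].
  unfold expi. rewrite cos_neg, sin_neg, Hc, Hs.
  generalize (/ l)%C. intros [p q]. destruct z as [u v].
  apply (f_equal4 mat2); apply injective_projections; cbn; field.
Qed.

Lemma is_mderive_ext (F G : R -> M2) (s : R) (V : M2) :
  (forall t, F t = G t) -> is_mderive F s V -> is_mderive G s V.
Proof.
  intros E H i j Hi Hj.
  apply (is_derive_ext (fun t => entry (F t) i j)); [intros t; rewrite E; reflexivity | apply H; assumption].
Qed.

Section Frame.
Context (J : R -> Prop) (HJ : is_open_interval J) (HJ0 : J 0).
Context (P Q n r : R -> R -> Mat) (k : R -> R -> R).
Context (CP : cont_on J (fun x => P x 0)) (CQ : forall x, J x -> cont_on J (Q x)).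
Context (DP : forall x y, J x -> J y -> is_derive (P x) y (r x y)).
Context (DQ : forall x y, J x -> J y -> is_derive (fun x => Q x y) x (r x y)).
Context (Cr : forall x y, J x -> J y -> continuous (fun p : R * R => r (fst p) (snd p)) (x, y)).
Context (Ck : forall x y, J x -> J y -> continuous (fun p : R * R => k (fst p) (snd p)) (x, y)).
Context (Dnx : forall x y, J x -> J y ->
  is_derive (fun x => n x y) x (minus (mul (P x y) (n x y)) (mul (n x y) (P x y)))).
Context (Dny : forall x y, J x -> J y ->
  is_derive (n x) y (minus (mul (n x y) (Q x y)) (mul (Q x y) (n x y)))).
Context (r_comm : forall x y, J x -> J y -> r x y = minus (mul (P x y) (Q x y)) (mul (Q x y) (P x y))).
Context (r_normal : forall x y, J x -> J y -> r x y = scal (k x y) (n x y)).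
Context (SP : forall x y, J x -> J y -> skew (P x y)).
Context (SQ : forall x y, J x -> J y -> skew (Q x y)).
Context (Sn : forall x y, J x -> J y -> skew (n x y)).

(** The connection form of the parallel frame: its y-derivative is the Gauss curvature
    -1 times the signed area density kappa of the front. *)
Definition omega (x y : R) : R := - RInt (k x) 0 y.

Lemma omega_0 (x : R) : omega x 0 = 0.
Proof. unfold omega. rewrite (RInt_point (V := R_CompleteNormedModule)). apply Ropp_0. Qed.

Lemma omega_dy (x y : R) : J x -> J y -> is_derive (omega x) y (- k x y).
Proof.
  intros Hx Hy. apply (is_derive_opp (V := R_NormedModule) (fun y => RInt (k x) 0 y)).
  apply (is_derive_RInt (V := R_NormedModule) (k x) _ 0); [|exact (joint_cont_2 J k x Ck Hx y Hy)].
  generalize (proj1 HJ y Hy); apply filter_imp. intros v Jv.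
  apply (RInt_correct (V := R_CompleteNormedModule)), (ex_RInt_continuous (V := R_CompleteNormedModule)).
  intros t Ht; exact (joint_cont_2 J k x Ck Hx t (interval_conv J 0 v t HJ HJ0 Jv Ht)).
Qed.

Lemma omega_cont (y : R) : J y -> cont_on J (fun x => omega x y).
Proof.
  intros Hy x Hx. apply (continuous_opp (V := R_NormedModule) (fun x => RInt (k x) 0 y)).
  apply (RInt_parameter_continuous J); assumption.
Qed.

Definition frame_form (x y : R) : Mat := opp (plus (P x y) (scal (omega x y) (n x y))).

Lemma frame_form_0 (x : R) : frame_form x 0 = opp (P x 0).
Proof. unfold frame_form. rewrite omega_0. generalize (P x 0) (n x 0). mring. Qed.

Lemma frame_form_cont : cont_on J (fun x => frame_form x 0).
Proof.
  intros x Hx. apply (continuous_ext (fun x => opp (P x 0))).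
  - intros t; symmetry; apply frame_form_0.
  - apply (continuous_opp (V := Mat) (fun x => P x 0)), CP, Hx.
Qed.

Lemma frame_form_skew (x y : R) : J x -> J y -> skew (frame_form x y).
Proof. intros; apply skew_opp, skew_plus, skew_scal; auto. Qed.

(** Flatness of the connection - (p + omega N) dx + q dy. The terms containing omega
    cancel because N_y = [N, q], and the rest is omega_y N = - p_y, which holds as p_y
    = kappa N. *)
Lemma frame_form_dy (x y : R) : J x -> J y ->
  is_derive (frame_form x) y (plus (r x y) (minus (mul (frame_form x y) (Q x y)) (mul (Q x y) (frame_form x y)))).
Proof.
  intros Hx Hy.
  replace (plus (r x y) (minus (mul (frame_form x y) (Q x y)) (mul (Q x y) (frame_form x y)))) with
    (opp (plus (r x y) (plus (scal (- k x y) (n x y))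
       (scal (omega x y) (minus (mul (n x y) (Q x y)) (mul (Q x y) (n x y))))))).
  - apply (is_derive_opp (V := Mat) (fun y => plus (P x y) (scal (omega x y) (n x y)))).
    apply (is_derive_plus (V := Mat)); [apply DP; assumption|].
    apply is_derive_scal_fun; [apply omega_dy | apply Dny]; assumption.
  - assert (E : minus (mul (frame_form x y) (Q x y)) (mul (Q x y) (frame_form x y)) =
      opp (plus (minus (mul (P x y) (Q x y)) (mul (Q x y) (P x y)))
                (scal (omega x y) (minus (mul (n x y) (Q x y)) (mul (Q x y) (n x y)))))).
    { unfold frame_form. generalize (P x y) (Q x y) (n x y) (omega x y). mnc. }
    rewrite E, <- r_comm by assumption.
    assert (E2 : scal (- k x y) (n x y) = opp (r x y)).
    { rewrite r_normal by assumption. exact (scal_opp_l (V := Mat) (k x y) (n x y)). }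
    rewrite E2. generalize (r x y) (scal (omega x y) (minus (mul (n x y) (Q x y)) (mul (Q x y) (n x y)))). mring.
Qed.

(** The inverse of the parallel frame. It, rather than the frame, is a transport, since
    transports solve equations with the coefficient on the right. *)
Definition coframe : R -> R -> Mat := transport Q frame_form.
Definition frame (x y : R) : Mat := adj (coframe x y).

Lemma coframe_dy (x y : R) : J x -> J y -> is_derive (coframe x) y (mul (coframe x y) (Q x y)).
Proof. apply (transport_dy J HJ HJ0 Q CQ frame_form). Qed.
Lemma coframe_dx (x y : R) : J x -> J y -> is_derive (fun x => coframe x y) x (mul (coframe x y) (frame_form x y)).
Proof.
  apply (transport_dx J HJ HJ0 Q r CQ DQ Cr); [intros; apply SQ; assumption | exact frame_form_cont | exact frame_form_dy].
Qed.
Lemma coframe_0 : coframe 0 0 = mone.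
Proof.
  unfold coframe, transport.
  rewrite (ordexp_0 J HJ HJ0 _ frame_form_cont), (ordexp_0 J HJ HJ0 _ (CQ 0 HJ0)). apply mul_1_l.
Qed.
Lemma coframe_frame (x y : R) : J x -> J y -> mul (coframe x y) (frame x y) = mone.
Proof.
  intros Hx Hy. apply (transport_adj J); try assumption; [exact frame_form_cont | apply CQ, Hx | |].
  - intros u Hu; apply frame_form_skew; assumption.
  - intros v Hv; apply SQ; assumption.
Qed.
Lemma frame_coframe (x y : R) : J x -> J y -> mul (frame x y) (coframe x y) = mone.
Proof.
  intros Hx Hy. unfold frame. rewrite <- mul_adj_comm. apply coframe_frame; assumption.
Qed.
Lemma coframe_dagger (x y : R) : J x -> J y -> dagger (coframe x y) = frame x y.
Proof.
  intros Hx Hy.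
  assert (E : mul (coframe x y) (dagger (coframe x y)) = mone).
  { apply (transport_dagger J); try assumption; [exact frame_form_cont | apply CQ, Hx | |].
    - intros u Hu; apply frame_form_skew; assumption.
    - intros v Hv; apply SQ; assumption. }
  rewrite <- (mul_1_l (dagger (coframe x y))), <- (frame_coframe x y Hx Hy), <- mul_assoc, E. apply mul_1_r.
Qed.

Lemma adj_derive_skew (F : R -> Mat) (x : R) (A : Mat) :
  skew A -> is_derive F x (mul (F x) A) -> is_derive (fun t => adj (F t)) x (opp (mul A (adj (F x)))).
Proof.
  intros [_ TA] HF. replace (opp (mul A (adj (F x)))) with (adj (mul (F x) A)).
  - apply is_derive_adj, HF.
  - rewrite adj_mul, (adj_tracefree A TA). apply mul_opp_l.
Qed.

Lemma frame_dy (x y : R) : J x -> J y -> is_derive (frame x) y (opp (mul (Q x y) (frame x y))).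
Proof.
  intros Hx Hy. apply (adj_derive_skew (coframe x)); [apply SQ | apply coframe_dy]; assumption.
Qed.
Lemma frame_dx (x y : R) : J x -> J y -> is_derive (fun x => frame x y) x (opp (mul (frame_form x y) (frame x y))).
Proof.
  intros Hx Hy. apply (adj_derive_skew (fun x => coframe x y)); [apply frame_form_skew | apply coframe_dx]; assumption.
Qed.

Definition pulled (M : Mat) (x y : R) : Mat := mul (mul (coframe x y) M) (frame x y).

(** The derivative of the conjugate of N by the coframe vanishes in both directions, as
    N_x = [p, N] and N_y = [N, q]; the term with omega commutes with N. *)
Lemma pulled_normal (x y : R) : J x -> J y -> pulled (n x y) x y = n 0 0.
Proof.
  intros Hx Hy. unfold pulled.
  transitivity (pulled (n x 0) x 0).
  - apply (const_of_derive_zero J (fun y => pulled (n x y) x y) 0 y HJ HJ0 Hy). intros t Ht.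
    replace (zero : Mat) with (mul (mul (coframe x t) (plus (minus (mul (n x t) (Q x t)) (mul (Q x t) (n x t)))
       (minus (mul (Q x t) (n x t)) (mul (n x t) (Q x t))))) (frame x t)).
    2:{ generalize (coframe x t) (frame x t) (n x t) (Q x t). mnc. }
    apply (conj_derive (coframe x) (frame x) (n x)); [apply coframe_dy | apply frame_dy | apply Dny]; assumption.
  - transitivity (pulled (n 0 0) 0 0).
    + apply (const_of_derive_zero J (fun x => pulled (n x 0) x 0) 0 x HJ HJ0 Hx). intros t Ht.
      replace (zero : Mat) with (mul (mul (coframe t 0) (plus (minus (mul (P t 0) (n t 0)) (mul (n t 0) (P t 0)))
         (minus (mul (frame_form t 0) (n t 0)) (mul (n t 0) (frame_form t 0))))) (frame t 0)).
      2:{ rewrite frame_form_0. generalize (coframe t 0) (frame t 0) (n t 0) (P t 0). mnc. }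
      apply (conj_derive (fun x => coframe x 0) (fun x => frame x 0) (fun x => n x 0));
        [apply coframe_dx | apply frame_dx | apply Dnx]; assumption.
    + unfold pulled, frame. rewrite coframe_0, adj_1, mul_1_l, mul_1_r. reflexivity.
Qed.

(** f_x is parallel along the y-lines: p_y = [p, q]. *)
Lemma pulled_dx (x y : R) : J x -> J y -> pulled (P x y) x y = pulled (P x 0) x 0.
Proof.
  intros Hx Hy.
  apply (const_of_derive_zero J (fun y => pulled (P x y) x y) 0 y HJ HJ0 Hy). intros t Ht.
  replace (zero : Mat) with (mul (mul (coframe x t) (plus (r x t)
       (minus (mul (Q x t) (P x t)) (mul (P x t) (Q x t))))) (frame x t)).
  2:{ rewrite r_comm by assumption. generalize (coframe x t) (frame x t) (P x t) (Q x t). mnc. }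
  apply (conj_derive (coframe x) (frame x) (P x)); [apply coframe_dy | apply frame_dy | apply DP]; assumption.
Qed.

Definition spectral_dx (l : C) (x y : R) : Mat := cscal (l - 1)%C (P x y).
Definition spectral_dy (l : C) (x y : R) : Mat := cscal (1 - / l)%C (Q x y).
Definition spectral (l : C) : R -> R -> Mat := transport (spectral_dy l) (spectral_dx l).

Lemma spectral_dy_cont (l : C) (x : R) : J x -> cont_on J (spectral_dy l x).
Proof. intros Hx y Hy; apply continuous_cscal, CQ; assumption. Qed.
Lemma spectral_dx_cont (l : C) : cont_on J (fun x => spectral_dx l x 0).
Proof. intros x Hx; apply continuous_cscal, (CP x Hx). Qed.

Lemma spectral_derive_y (l : C) (x y : R) : J x -> J y -> is_derive (spectral l x) y (mul (spectral l x y) (spectral_dy l x y)).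
Proof. apply (transport_dy J HJ HJ0 (spectral_dy l) (spectral_dy_cont l)). Qed.

(** The curvature is a multiple of R' - [A, B]: the coefficients match because (l - 1)
    = (1 - 1/l) + (l - 1)(1 - 1/l). *)
Lemma spectral_flat (l : C) (R' A B : Mat) : l <> RtoC 0 -> R' = minus (mul A B) (mul B A) ->
  cscal (l - 1)%C R' = plus (cscal (1 - / l)%C R')
    (minus (mul (cscal (l - 1)%C A) (cscal (1 - / l)%C B)) (mul (cscal (1 - / l)%C B) (cscal (l - 1)%C A))).
Proof.
  intros Hl ->.
  transitivity (plus (cscal (1 - / l)%C (minus (mul A B) (mul B A)))
    (cscal ((l - 1) * (1 - / l))%C (minus (mul A B) (mul B A)))).
  - generalize (minus (mul A B) (mul B A)). intros M.
    rewrite plus_coord. apply mat_eq; unfold madd, cscal, mk, m11, m12, m21, m22; cbn [fst snd];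
    apply Cplus_0_cancel; field; exact Hl.
  - f_equal. mnc.
Qed.

Lemma spectral_derive_x (l : C) (x y : R) : l <> RtoC 0 -> J x -> J y ->
  is_derive (fun x => spectral l x y) x (mul (spectral l x y) (spectral_dx l x y)).
Proof.
  intros Hl. apply (transport_dx J HJ HJ0 (spectral_dy l) (fun x y => cscal (1 - / l)%C (r x y)) (spectral_dy_cont l)).
  - intros; apply is_derive_cscal, DQ; assumption.
  - intros; apply continuous_cscal, Cr; assumption.
  - intros; apply tracefree_cscal, SQ; assumption.
  - exact (spectral_dx_cont l).
  - intros u v Ju Jv. unfold spectral_dx, spectral_dy. rewrite <- spectral_flat; [|exact Hl | apply r_comm; assumption].
    apply is_derive_cscal, DP; assumption.
Qed.

Lemma spectral_0 (l : C) : spectral l 0 0 = mone.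
Proof.
  unfold spectral, transport.
  rewrite (ordexp_0 J HJ HJ0 _ (spectral_dx_cont l)), (ordexp_0 J HJ HJ0 _ (spectral_dy_cont l 0 HJ0)). apply mul_1_l.
Qed.
Lemma spectral_adj (l : C) (x y : R) : J x -> J y -> mul (spectral l x y) (adj (spectral l x y)) = mone.
Proof.
  intros Hx Hy.
  refine (transport_adj J (spectral_dy l) (spectral_dx l) x y HJ HJ0 Hx Hy (spectral_dx_cont l) (spectral_dy_cont l x Hx) _ _).
  - intros u Hu; apply tracefree_cscal, SP; assumption.
  - intros v Hv; apply tracefree_cscal, SQ; assumption.
Qed.

Context (R0 : Mat) (SR : SU R0).

(** R0 rotates the normal at the origin to a vertical direction. *)
Definition ext_frame (l : C) (x y : R) : Mat := rot R0 (mul (spectral l x y) (frame x y)).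
Definition pot_x (x : R) : Mat := rot R0 (pulled (P x 0) x 0).
Definition pot_y (x y : R) : Mat := opp (rot R0 (pulled (Q x y) x y)).
Definition axis : Mat := rot R0 (n 0 0).

Lemma ext_frame_insert (l : C) (x y : R) (E : Mat) : J x -> J y ->
  rot R0 (mul (mul (spectral l x y) E) (frame x y)) = mul (ext_frame l x y) (rot R0 (pulled E x y)).
Proof.
  intros Hx Hy. symmetry. apply insert_inverses; [apply SR | apply frame_coframe; assumption].
Qed.

(** Z contributes (l - 1) p and the frame p + omega N; conjugated, the sum is l a +
    omega m. *)
Lemma ext_frame_dx (l : C) (x y : R) : l <> RtoC 0 -> J x -> J y ->
  is_derive (fun x => ext_frame l x y) x
    (mul (ext_frame l x y) (plus (cscal l (pot_x x)) (scal (omega x y) axis))).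
Proof.
  intros Hl Hx Hy.
  replace (plus (cscal l (pot_x x)) (scal (omega x y) axis)) with
    (rot R0 (pulled (plus (cscal l (P x y)) (scal (omega x y) (n x y))) x y)).
  - rewrite <- ext_frame_insert by assumption. apply rot_derive.
    replace (mul (mul (spectral l x y) (plus (cscal l (P x y)) (scal (omega x y) (n x y)))) (frame x y)) with
      (plus (mul (mul (spectral l x y) (spectral_dx l x y)) (frame x y)) (mul (spectral l x y) (opp (mul (frame_form x y) (frame x y))))).
    + apply (is_derive_mul (fun x => spectral l x y) (fun x => frame x y)); [apply spectral_derive_x | apply frame_dx]; assumption.
    + unfold spectral_dx, frame_form. generalize (spectral l x y) (frame x y) (P x y) (n x y) (omega x y). mnc.
  - unfold pot_x, axis. rewrite <- (pulled_dx x y) by assumption. rewrite <- (pulled_normal x y) by assumption.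
    unfold pulled, rot. generalize (coframe x y) (frame x y) (P x y) (n x y) (omega x y). mnc.
Qed.

(** Z contributes (1 - 1/l) q and the frame - q. *)
Lemma ext_frame_dy (l : C) (x y : R) : J x -> J y ->
  is_derive (ext_frame l x) y (mul (ext_frame l x y) (cscal (/ l)%C (pot_y x y))).
Proof.
  intros Hx Hy.
  replace (cscal (/ l)%C (pot_y x y)) with (rot R0 (pulled (cscal (- / l)%C (Q x y)) x y)).
  - rewrite <- ext_frame_insert by assumption.
    apply (rot_derive R0 (fun y => mul (spectral l x y) (frame x y))).
    replace (mul (mul (spectral l x y) (cscal (- / l)%C (Q x y))) (frame x y)) with
      (plus (mul (mul (spectral l x y) (spectral_dy l x y)) (frame x y)) (mul (spectral l x y) (opp (mul (Q x y) (frame x y))))).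
    + apply (is_derive_mul (spectral l x) (frame x)); [apply spectral_derive_y | apply frame_dy]; assumption.
    + unfold spectral_dy. generalize (spectral l x y) (frame x y) (Q x y) (/ l)%C. mnc.
  - unfold pot_y, pulled, rot. generalize (coframe x y) (frame x y) (Q x y) (/ l)%C. mnc.
Qed.

Lemma ext_frame_0 (l : C) : ext_frame l 0 0 = mone.
Proof.
  unfold ext_frame, frame, rot. rewrite spectral_0, coframe_0, adj_1, mul_1_l, mul_1_r, <- mul_adj_comm. apply SR.
Qed.

Lemma ext_frame_adj (l : C) (x y : R) : J x -> J y -> mul (ext_frame l x y) (adj (ext_frame l x y)) = mone.
Proof.
  intros Hx Hy. unfold ext_frame, rot.
  rewrite adj_mul. apply mul_inverses; [|apply SR].
  rewrite adj_mul, adj_adj. apply mul_inverses.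
  - rewrite <- mul_adj_comm. apply SR.
  - rewrite adj_mul. apply mul_inverses; [apply spectral_adj; assumption|].
    unfold frame at 2. rewrite adj_adj. apply frame_coframe; assumption.
Qed.

Lemma ext_frame_1 (x y : R) : J x -> J y -> ext_frame (RtoC 1) x y = rot R0 (frame x y).
Proof.
  intros Hx Hy. unfold ext_frame. f_equal.
  unfold spectral, transport.
  rewrite (ordexp_const_zero J (fun u => spectral_dx (RtoC 1) u 0) x HJ HJ0 (spectral_dx_cont _)).
  - rewrite (ordexp_const_zero J (spectral_dy (RtoC 1) x) y HJ HJ0 (spectral_dy_cont _ x Hx)).
    + rewrite !mul_1_l. reflexivity.
    + intros t _. unfold spectral_dy. replace (1 - / RtoC 1)%C with (RtoC 0) by (field; apply C1_nz).
      generalize (Q x t). mring.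
    + exact Hy.
  - intros t _. unfold spectral_dx. generalize (P t 0). mring.
  - exact Hx.
Qed.

Lemma pulled_skew (M : Mat) (x y : R) : J x -> J y -> skew M -> skew (pulled M x y).
Proof.
  intros Hx Hy [M1 M2]. unfold pulled. split.
  - rewrite !dagger_mul, M1.
    rewrite <- (coframe_dagger x y) by assumption. rewrite dagger_dagger. mnc.
  - apply tracefree_conj; [apply frame_coframe; assumption | exact M2].
Qed.

Context (sgn : R) (Hsgn : sgn <> 0) (Hm : axis = scal sgn (su e3)).
Context (PN : forall x y, J x -> J y -> plus (mul (P x y) (n x y)) (mul (n x y) (P x y)) = zero).
Context (QN : forall x y, J x -> J y -> plus (mul (Q x y) (n x y)) (mul (n x y) (Q x y)) = zero).

(** The algebra automorphism that expresses a matrix in the rotated moving frame. *)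
Definition in_frame (x y : R) (M : Mat) : Mat := rot R0 (pulled M x y).

Lemma in_frame_mul (x y : R) (A B : Mat) : J x -> J y -> in_frame x y (mul A B) = mul (in_frame x y A) (in_frame x y B).
Proof.
  intros Hx Hy. unfold in_frame, rot, pulled.
  transitivity (mul (mul (adj R0) (mul (mul (coframe x y) (mul (mul A (mul (frame x y) (mul (mul R0 (adj R0)) (coframe x y)))) B)) (frame x y))) R0).
  - rewrite (proj1 (conj (proj2 SR) I)), mul_1_l, frame_coframe, mul_1_r by assumption. reflexivity.
  - generalize (coframe x y) (frame x y) (adj R0). mnc.
Qed.
Lemma in_frame_plus (x y : R) (A B : Mat) : in_frame x y (plus A B) = plus (in_frame x y A) (in_frame x y B).
Proof. unfold in_frame, rot, pulled. generalize (coframe x y) (frame x y) (adj R0). mnc. Qed.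
Lemma in_frame_scal (x y r1 : R) (A : Mat) : in_frame x y (scal r1 A) = scal r1 (in_frame x y A).
Proof. unfold in_frame, rot, pulled. generalize (coframe x y) (frame x y) (adj R0). mnc. Qed.
Lemma in_frame_1 (x y : R) : J x -> J y -> in_frame x y mone = mone.
Proof.
  intros Hx Hy. unfold in_frame, pulled, rot. rewrite mul_1_r, coframe_frame, mul_1_r, <- mul_adj_comm by assumption. apply SR.
Qed.

Lemma in_frame_offdiag (x y : R) (A : Mat) : J x -> J y ->
  plus (mul A (n x y)) (mul (n x y) A) = zero -> offdiag (in_frame x y A).
Proof.
  intros Hx Hy H. apply (offdiag_of_anticommute _ sgn Hsgn). rewrite <- Hm.
  assert (E : axis = in_frame x y (n x y)) by (unfold axis, in_frame; rewrite pulled_normal by assumption; reflexivity).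
  rewrite E, <- !in_frame_mul, <- in_frame_plus, H by assumption.
  unfold in_frame, pulled, rot. generalize (coframe x y) (frame x y) (adj R0). mnc.
Qed.

Lemma pot_x_offdiag (x : R) : J x -> offdiag (pot_x x).
Proof.
  intros Hx. apply (in_frame_offdiag x 0); [exact Hx | exact HJ0 | apply PN; assumption].
Qed.
Lemma pot_y_offdiag (x y : R) : J x -> J y -> offdiag (pot_y x y).
Proof.
  intros Hx Hy. apply offdiag_opp, (in_frame_offdiag x y); [exact Hx | exact Hy | apply QN; assumption].
Qed.
Lemma pot_x_skew (x : R) : J x -> skew (pot_x x).
Proof. intros Hx. apply rot_skew; [exact SR | apply pulled_skew; auto]. Qed.
Lemma pot_y_skew (x y : R) : J x -> J y -> skew (pot_y x y).
Proof. intros Hx Hy. apply skew_opp, rot_skew; [exact SR | apply pulled_skew; auto]. Qed.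

Lemma pot_x_cont : cont_on J pot_x.
Proof.
  intros x Hx. apply (rot_cont R0 (fun x => pulled (P x 0) x 0)).
  apply continuous_mul; [apply continuous_mul|].
  - apply (ex_derive_continuous (V := Mat) (fun x => coframe x 0)). eexists; apply coframe_dx; assumption.
  - apply CP, Hx.
  - apply (ex_derive_continuous (V := Mat) (fun x => frame x 0)). eexists; apply frame_dx; assumption.
Qed.
Lemma pot_y_cont (x : R) : J x -> cont_on J (pot_y x).
Proof.
  intros Hx y Hy. apply (continuous_opp (V := Mat) (fun y => rot R0 (pulled (Q x y) x y))).
  apply (rot_cont R0 (fun y => pulled (Q x y) x y)).
  apply continuous_mul; [apply continuous_mul|].
  - apply (ex_derive_continuous (V := Mat) (coframe x)). eexists; apply coframe_dy; assumption.
  - apply CQ; assumption.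
  - apply (ex_derive_continuous (V := Mat) (frame x)). eexists; apply frame_dy; assumption.
Qed.

Definition gauge_form (y x : R) : Mat := scal (omega x y) axis.
(** Integrating factor for the diagonal term omega m. *)
Definition gauge (x y : R) : Mat := ordexp (gauge_form y) x.

Lemma axis_skew : skew axis.
Proof. rewrite Hm. apply skew_scal, skew_su. Qed.

Lemma gauge_form_cont (y : R) : J y -> cont_on J (gauge_form y).
Proof.
  intros Hy x Hx. apply (continuous_scal_l (V := Mat) (fun x => omega x y)).
  apply omega_cont; assumption.
Qed.
Lemma gauge_form_skew (x y : R) : skew (gauge_form y x).
Proof. apply skew_scal, axis_skew. Qed.

Lemma gauge_SU (x y : R) : J x -> J y -> SU (gauge x y).
Proof.
  intros Hx Hy. split.
  - apply (involution_inverse J HJ HJ0 dagger (gauge_form y) (ordexp (gauge_form y))).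
    + exact is_derive_dagger.
    + exact dagger_mul.
    + exact dagger_1.
    + intros t Ht; apply gauge_form_skew.
    + intros t Ht; apply (ordexp_derive J HJ HJ0 _ (gauge_form_cont y Hy) t Ht).
    + apply (ordexp_0 J HJ HJ0 _ (gauge_form_cont y Hy)).
    + exact Hx.
  - apply (ordexp_adj J HJ HJ0 _ (gauge_form_cont y Hy)); [intros t Ht; apply gauge_form_skew | exact Hx].
Qed.

Lemma twist_gauge_form (x y : R) : twist (gauge_form y x) = gauge_form y x.
Proof.
  unfold gauge_form. rewrite twist_scal, Hm, twist_scal. do 2 f_equal.
  unfold su, twist, e3, vc1, vc2, vc3; cbn [fst snd].
  apply mat_eq; apply injective_projections; cbn; field.
Qed.

(** The coefficient is diagonal, so it is fixed by [twist], and so is the solution;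
    hence the solution is diagonal. *)
Lemma gauge_twist (x y : R) : J x -> J y -> twist (gauge x y) = gauge x y.
Proof.
  intros Hx Hy.
  transitivity (mul (twist (gauge 0 y)) (gauge x y)).
  - apply (ordexp_unique J HJ HJ0 (gauge_form y) (gauge_form_cont y Hy)
      (fun t Ht => proj2 (gauge_form_skew t y)) (fun x => twist (gauge x y)) x); [|exact Hx].
    intros t Ht. rewrite <- (twist_gauge_form t y) at 1. rewrite <- twist_mul.
    apply is_derive_twist, (ordexp_derive J HJ HJ0 _ (gauge_form_cont y Hy) t Ht).
  - unfold gauge at 1. rewrite (ordexp_0 J HJ HJ0 _ (gauge_form_cont y Hy)), twist_1. apply mul_1_l.
Qed.

Definition gauged_pot (y x : R) : Mat := mul (mul (gauge x y) (pot_x x)) (adj (gauge x y)).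

Lemma gauged_pot_cont (y : R) : J y -> cont_on J (gauged_pot y).
Proof.
  intros Hy x Hx.
  assert (CD : continuous (fun x => gauge x y) x).
  { apply (ordexp_continuous J HJ HJ0 _ (gauge_form_cont y Hy) x Hx). }
  apply continuous_mul; [apply continuous_mul|].
  - exact CD.
  - apply pot_x_cont, Hx.
  - apply continuous_adj, CD.
Qed.

Lemma gauged_pot_offdiag (x y : R) : J x -> J y -> offdiag (gauged_pot y x).
Proof.
  intros Hx Hy. destruct (diag_of_twist _ (gauge_twist x y Hx Hy)) as [D1 D2].
  apply offdiag_conj; try assumption; [| |apply pot_x_offdiag, Hx].
  - change (- m12 (gauge x y) = 0)%C. rewrite D1. ring.
  - change (- m21 (gauge x y) = 0)%C. rewrite D2. ring.
Qed.

Lemma gauged_pot_dagger (x y : R) : J x -> J y -> dagger (gauged_pot y x) = opp (gauged_pot y x).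
Proof.
  intros Hx Hy. unfold gauged_pot.
  rewrite !dagger_mul, (proj1 (pot_x_skew x Hx)), <- (SU_dagger _ (gauge_SU x y Hx Hy)), dagger_dagger. mnc.
Qed.

(** The solution of L_x = L (l a + omega m): with the integrating factor D the
    coefficient becomes l D a D^-1, which is off-diagonal and homogeneous in l. *)
Definition plus_factor (x y : R) (l : C) : Mat := dressed (gauged_pot y) (gauge x y) x l.
(** The solution of L_y = L b / l; the factor 1 gives it the shape of [dressed]. *)
Definition minus_factor (x y : R) (l : C) : Mat := dressed (pot_y x) mone y (/ l)%C.

Lemma plus_factor_loop (x y : R) : J x -> J y -> plus_loop (fun l => toM2 (plus_factor x y l)).
Proof.
  intros Hx Hy. destruct (diag_of_twist _ (gauge_twist x y Hx Hy)) as [D1 D2].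
  apply (pencil_plus_loop J HJ HJ0 (gauged_pot y) (gauged_pot_cont y Hy)
    (fun t Ht => gauged_pot_offdiag t y Ht Hy) (fun t Ht => gauged_pot_dagger t y Ht Hy)
    (gauge x y) (gauge_SU x y Hx Hy) D1 D2 x Hx).
Qed.

Lemma minus_factor_loop (x y : R) : J x -> J y -> minus_loop (fun l => toM2 (minus_factor x y l)).
Proof.
  intros Hx Hy.
  apply (pencil_minus_loop J HJ HJ0 (pot_y x) (pot_y_cont x Hx)
    (fun t Ht => pot_y_offdiag x t Hx Ht) (fun t Ht => proj1 (pot_y_skew x t Hx Ht))
    mone SU_1 eq_refl eq_refl y Hy eq_refl).
Qed.

Lemma ext_frame_minus (l : C) (x y : R) : l <> RtoC 0 -> J x -> J y ->
  ext_frame l x y = mul (ext_frame l x 0) (minus_factor x y l).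
Proof.
  intros Hl Hx Hy. unfold minus_factor, dressed. rewrite mul_1_r.
  apply (ordexp_unique J HJ HJ0 (fun y => cscal (/ l)%C (pot_y x y))).
  - intros t Ht; apply continuous_cscal, pot_y_cont; assumption.
  - intros t Ht; apply tracefree_cscal, pot_y_skew; assumption.
  - intros t Ht; apply ext_frame_dy; assumption.
  - exact Hy.
Qed.

Lemma gauge_cancel (V D0 A : Mat) (l : C) (M : Mat) : mul (adj D0) D0 = mone ->
  plus (mul (mul V (plus (cscal l A) M)) (adj D0)) (mul V (opp (mul M (adj D0)))) =
  mul (mul V (adj D0)) (cscal l (mul (mul D0 A) (adj D0))).
Proof.
  intros H.
  transitivity (mul (mul V (mul (mul (adj D0) D0) (cscal l A))) (adj D0)).
  - rewrite H, mul_1_l. generalize (adj D0). mnc.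
  - generalize (adj D0). mnc.
Qed.

(** Uhat D^-1 and the pencil of D a D^-1 satisfy the same equation. *)
Lemma ext_frame_plus (l : C) (x y : R) : l <> RtoC 0 -> J x -> J y ->
  ext_frame l x y = mul (ext_frame l 0 y) (plus_factor x y l).
Proof.
  intros Hl Hx Hy. unfold plus_factor, dressed.
  set (F := fun x => mul (ext_frame l x y) (adj (gauge x y))).
  assert (DD : forall t, J t -> mul (adj (gauge t y)) (gauge t y) = mone).
  { intros t Ht. rewrite <- mul_adj_comm. apply gauge_SU; assumption. }
  assert (EF : F x = mul (F 0) (pencil (gauged_pot y) l x)).
  { apply (ordexp_unique J HJ HJ0 (fun x => cscal l (gauged_pot y x))); [| | |exact Hx].
    - intros t Ht; apply continuous_cscal, gauged_pot_cont; assumption.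
    - intros t Ht; apply tracefree_cscal, tracefree_conj; [apply DD, Ht | apply pot_x_skew, Ht].
    - intros t Ht. unfold F, gauged_pot.
      rewrite <- (gauge_cancel (ext_frame l t y) (gauge t y) (pot_x t) l (gauge_form y t) (DD t Ht)).
      apply (is_derive_mul (fun x => ext_frame l x y) (fun x => adj (gauge x y))).
      + apply ext_frame_dx; assumption.
      + apply (adj_derive_skew (fun x => gauge x y)); [apply gauge_form_skew|].
        apply (ordexp_derive J HJ HJ0 _ (gauge_form_cont y Hy) t Ht). }
  unfold F in EF.
  rewrite mul_assoc.
  assert (E0 : gauge 0 y = mone) by apply (ordexp_0 J HJ HJ0 _ (gauge_form_cont y Hy)).
  rewrite E0, adj_1, mul_1_r in EF. rewrite <- EF, <- mul_assoc, DD, mul_1_r by exact Hx. reflexivity.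
Qed.

Lemma birkhoff_ext_frame (x y : R) : J x -> J y ->
  birkhoff (fun l => toM2 (ext_frame l 0 y)) (fun l => toM2 (ext_frame l x 0))
    (fun l => toM2 (plus_factor x y l)) (fun l => toM2 (minus_factor x y l)).
Proof.
  intros Hx Hy. split; [|split].
  - apply plus_factor_loop; assumption.
  - apply minus_factor_loop; assumption.
  - intros l Hl.
    assert (A1 : mul (ext_frame l 0 y) (adj (ext_frame l 0 y)) = mone) by (apply ext_frame_adj; assumption).
    assert (A2 : mul (minus_factor x y l) (adj (minus_factor x y l)) = mone).
    { apply (pencil_det J HJ HJ0 (pot_y x) (pot_y_cont x Hx) (fun t Ht => pot_y_offdiag x t Hx Ht) mone SU_1 y Hy). }
    rewrite !inv2_toM2 by (apply det_of_adj; assumption).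
    rewrite !mmul_toM2. f_equal.
    transitivity (mul (adj (ext_frame l 0 y)) (mul (ext_frame l x 0) (mul (minus_factor x y l) (adj (minus_factor x y l))))).
    { rewrite A2, mul_1_r. reflexivity. }
    rewrite (mul_assoc (ext_frame l x 0)), <- (ext_frame_minus l x y Hl Hx Hy), (ext_frame_plus l x y Hl Hx Hy).
    rewrite (mul_assoc (adj (ext_frame l 0 y)) (mul (ext_frame l 0 y) (plus_factor x y l))).
    rewrite (mul_assoc (adj (ext_frame l 0 y)) (ext_frame l 0 y) (plus_factor x y l)).
    rewrite <- (mul_adj_comm (ext_frame l 0 y)), A1, mul_1_l. reflexivity.
Qed.

(** At l = exp t the factors of Z are pencils with parameters exp t - 1 and 1 - exp
    (-t), both of which are t + O(t^2). *)
Lemma ext_frame_derive_at_1 (x y : R) : J x -> J y ->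
  is_derive (fun t : R => ext_frame (RtoC (exp t)) x y) 0
    (rot R0 (mul (plus (integral (fun u => P u 0) 0 x) (integral (Q x) 0 y)) (frame x y))).
Proof.
  intros Hx Hy. unfold ext_frame. apply rot_derive, is_derive_mul_r.
  destruct (pencil_derive_at_0 J (fun u => P u 0) x HJ HJ0 CP
    (fun t Ht => proj2 (SP t 0 Ht HJ0)) Hx) as [E1 D1].
  destruct (pencil_derive_at_0 J (Q x) y HJ HJ0 (CQ x Hx)
    (fun t Ht => proj2 (SQ x t Hx Ht)) Hy) as [E2 D2].
  apply (is_derive_ext (fun t => mul (pencil (fun u => P u 0) (RtoC (exp t - 1)) x)
                                     (pencil (Q x) (RtoC (1 - exp (- t))) y))).
  { intros t. unfold spectral, transport, pencil, spectral_dx, spectral_dy.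
    rewrite !RtoC_minus. rewrite exp_Ropp, RtoC_inv by (apply Rgt_not_eq, exp_pos). reflexivity. }
  replace (plus (integral (fun u => P u 0) 0 x) (integral (Q x) 0 y)) with
    (plus (mul (scal 1 (integral (fun u => P u 0) 0 x)) (pencil (Q x) (RtoC (1 - exp (- 0))) y))
          (mul (pencil (fun u => P u 0) (RtoC (exp 0 - 1)) x) (scal 1 (integral (Q x) 0 y)))).
  2:{ rewrite Ropp_0, exp_0, Rminus_diag, E1, E2.
      generalize (integral (fun u => P u 0) 0 x) (integral (Q x) 0 y). mring. }
  apply (is_derive_mul (fun t => pencil (fun u => P u 0) (RtoC (exp t - 1)) x)
                       (fun t => pencil (Q x) (RtoC (1 - exp (- t))) y)).
  - apply (is_derive_comp (V := Mat) (fun z : R => pencil (fun u => P u 0) (RtoC z) x) (fun t => exp t - 1)).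
    + replace (exp 0 - 1) with 0 by (rewrite exp_0; ring). exact D1.
    + auto_derive; [trivial | rewrite exp_0; ring].
  - apply (is_derive_comp (V := Mat) (fun z : R => pencil (Q x) (RtoC z) y) (fun t => 1 - exp (- t))).
    + replace (1 - exp (- 0)) with 0 by (rewrite Ropp_0, exp_0; ring). exact D2.
    + auto_derive; [trivial | rewrite Ropp_0, exp_0; ring].
Qed.
Context (PP : forall x y, J x -> J y -> mul (P x y) (P x y) = scal (-1/4) mone).
Context (QQ : forall x y, J x -> J y -> mul (Q x y) (Q x y) = scal (-1/4) mone).

Lemma pot_x_square (x : R) : J x -> mul (pot_x x) (pot_x x) = scal (-1/4) mone.
Proof.
  intros Hx. change (pot_x x) with (in_frame x 0 (P x 0)).
  rewrite <- in_frame_mul, PP, in_frame_scal, in_frame_1 by assumption. reflexivity.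
Qed.
Lemma pot_y_square (x y : R) : J x -> J y -> mul (pot_y x y) (pot_y x y) = scal (-1/4) mone.
Proof.
  intros Hx Hy. change (pot_y x y) with (opp (in_frame x y (Q x y))).
  transitivity (mul (in_frame x y (Q x y)) (in_frame x y (Q x y))); [generalize (in_frame x y (Q x y)); mring|].
  rewrite <- in_frame_mul, QQ, in_frame_scal, in_frame_1 by assumption. reflexivity.
Qed.

Lemma coord_cont (A : R -> Mat) (c : R) (pr : C -> R) :
  (forall z w : C, pr (z - w)%C = pr z - pr w) -> (forall z, Rabs (pr z) <= Cmod z) ->
  cont_on J A -> cont_on J (fun x => c * pr (m12 (A x))).
Proof.
  intros H1 H2 HA x Hx.
  apply (continuous_scal_r (V := R_NormedModule) c (fun x => pr (m12 (A x)))).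
  apply (continuous_contraction (V := Mat) (W := R_NormedModule) (fun M => pr (m12 M)) A x).
  - intros M M'. apply H1.
  - intros M. eapply Rle_trans; [apply H2 | apply Cmod_m12].
  - apply HA, Hx.
Qed.

(** On y = 0 the form omega vanishes, so there Uhat_x = Uhat l a(x). *)
Lemma potential_plus : exists al : R -> R, (forall x, J x -> continuous al x) /\
  integrates J (eta_plus al) (fun x l => toM2 (ext_frame l x 0)).
Proof.
  pose proof (fun x (Hx : J x) => offdiag_skew_shape (pot_x x) (pot_x_offdiag x Hx)
    (proj1 (pot_x_skew x Hx)) (pot_x_square x Hx)) as Ha.
  destruct (continuous_angle J (fun x => 2 * snd (m12 (pot_x x))) (fun x => 2 * fst (m12 (pot_x x))) HJ HJ0) as [al Hal].
  - apply (coord_cont pot_x 2 snd); [reflexivity | apply Rabs_snd_le | exact pot_x_cont].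
  - apply (coord_cont pot_x 2 fst); [reflexivity | apply Rabs_fst_le | exact pot_x_cont].
  - intros x Hx; apply Ha, Hx.
  - exists al. split; [intros x Hx; apply Hal, Hx|].
    intros l Hl. split; [rewrite ext_frame_0, id2_toM2; reflexivity|].
    intros x Hx. destruct (Hal x Hx) as [_ [Hc Hs]].
    rewrite (eta_plus_coord al x l (m12 (pot_x x)) Hc Hs), <- (proj1 (Ha x Hx)), mmul_toM2.
    apply (is_mderive_toM2 (fun x => ext_frame l x 0)).
    replace (mul (ext_frame l x 0) (cscal l (pot_x x))) with
      (mul (ext_frame l x 0) (plus (cscal l (pot_x x)) (scal (omega x 0) axis))).
    + apply ext_frame_dx; assumption.
    + rewrite omega_0. generalize (ext_frame l x 0) (pot_x x) axis. mring.
Qed.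

Lemma potential_minus : exists be : R -> R, (forall y, J y -> continuous be y) /\
  integrates J (eta_minus be) (fun y l => toM2 (ext_frame l 0 y)).
Proof.
  pose proof (fun y (Hy : J y) => offdiag_skew_shape (pot_y 0 y) (pot_y_offdiag 0 y HJ0 Hy)
    (proj1 (pot_y_skew 0 y HJ0 Hy)) (pot_y_square 0 y HJ0 Hy)) as Hb.
  destruct (continuous_angle J (fun y => - 2 * snd (m12 (pot_y 0 y))) (fun y => 2 * fst (m12 (pot_y 0 y))) HJ HJ0) as [be Hbe].
  - apply (coord_cont (pot_y 0) (- 2) snd); [reflexivity | apply Rabs_snd_le | exact (pot_y_cont 0 HJ0)].
  - apply (coord_cont (pot_y 0) 2 fst); [reflexivity | apply Rabs_fst_le | exact (pot_y_cont 0 HJ0)].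
  - intros y Hy. destruct (Hb y Hy) as [_ E]. rewrite <- E. ring.
  - exists be. split; [intros y Hy; apply Hbe, Hy|].
    intros l Hl. split; [rewrite ext_frame_0, id2_toM2; reflexivity|].
    intros y Hy. destruct (Hbe y Hy) as [_ [Hc Hs]].
    rewrite (eta_minus_coord be y l (m12 (pot_y 0 y)) Hl Hc Hs), <- (proj1 (Hb y Hy)), mmul_toM2.
    apply (is_mderive_toM2 (fun y => ext_frame l 0 y)).
    apply ext_frame_dy; assumption.
Qed.

Context (F : R -> R -> Mat).
Context (DFx : forall x y, J x -> J y -> is_derive (fun x => F x y) x (P x y)).
Context (DFy : forall x y, J x -> J y -> is_derive (F x) y (Q x y)).

(** The t-derivative of Z integrates df along an axis-parallel path. *)
Lemma path_integral (x y : R) : J x -> J y ->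
  plus (integral (fun u => P u 0) 0 x) (integral (Q x) 0 y) = minus (F x y) (F 0 0).
Proof.
  intros Hx Hy.
  assert (E1 : integral (fun u => P u 0) 0 x = minus (F x 0) (F 0 0)).
  { apply (is_RInt_unique (V := MatC)), (is_RInt_derive (V := MatC) (fun u => F u 0)).
    - intros t Ht. apply DFx; [exact (interval_conv J 0 x t HJ HJ0 Hx Ht) | exact HJ0].
    - intros t Ht. apply CP, (interval_conv J 0 x t HJ HJ0 Hx Ht). }
  assert (E2 : integral (Q x) 0 y = minus (F x y) (F x 0)).
  { apply (is_RInt_unique (V := MatC)), (is_RInt_derive (V := MatC) (F x)).
    - intros t Ht. apply DFy; [exact Hx | exact (interval_conv J 0 y t HJ HJ0 Hy Ht)].
    - intros t Ht. apply CQ; [exact Hx | exact (interval_conv J 0 y t HJ HJ0 Hy Ht)]. }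
  rewrite E1, E2. generalize (F x y) (F x 0) (F 0 0). mring.
Qed.

(** The rotation R0 makes the normal at the origin vertical, so the front obtained from
    the potential is the rotated and translated F. *)
Theorem frame_f_eta (g : R -> R -> vec3) :
  (forall x y, J x -> J y -> su (g x y) = rot R0 (minus (F x y) (F 0 0))) ->
  exists al be : R -> R,
    (forall s, J s -> continuous al s /\ continuous be s) /\ is_f_eta J al be g.
Proof.
  intros Hg.
  destruct potential_plus as [al [Cal Ial]]. destruct potential_minus as [be [Cbe Ibe]].
  exists al, be. split; [intros s Hs; split; [apply Cal | apply Cbe]; exact Hs|].
  exists (fun x l => toM2 (ext_frame l x 0)), (fun y l => toM2 (ext_frame l 0 y)),
    (fun x y l => toM2 (plus_factor x y l)), (fun x y l => toM2 (minus_factor x y l)).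
  split; [exact Ial | split; [exact Ibe|]].
  intros x y Hx Hy. split; [exact (birkhoff_ext_frame x y Hx Hy)|]. cbv zeta.
  assert (EU : forall l, l <> RtoC 0 -> mmul (toM2 (ext_frame l 0 y)) (toM2 (plus_factor x y l)) = toM2 (ext_frame l x y)).
  { intros l Hl. rewrite mmul_toM2, <- ext_frame_plus by assumption. reflexivity. }
  exists (toM2 (rot R0 (mul (minus (F x y) (F 0 0)) (frame x y)))). split.
  - apply (is_mderive_ext (fun t => toM2 (ext_frame (RtoC (exp t)) x y))).
    + intros t. symmetry. apply EU. intros E. apply RtoC_inj in E. pose proof (exp_pos t). lra.
    + apply is_mderive_toM2. rewrite <- path_integral by assumption. apply ext_frame_derive_at_1; assumption.
  - rewrite EU by apply C1_nz. rewrite ext_frame_1 by assumption.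
    assert (EUU : mul (frame x y) (adj (frame x y)) = mone).
    { unfold frame at 2. rewrite adj_adj. apply frame_coframe; assumption. }
    rewrite inv2_toM2.
    + rewrite mmul_toM2, adj_rot, (rot_mul_cancel R0 _ _ _ SR EUU). rewrite <- Hg by assumption. reflexivity.
    + apply det_of_adj. rewrite adj_rot.
      rewrite <- (mul_1_l (frame x y)) at 1. rewrite (rot_mul_cancel R0 _ _ _ SR EUU).
      unfold rot. rewrite mul_1_r, <- mul_adj_comm. apply SR.
Qed.
End Frame.

(** * Existence of the potential *)

Theorem theorem3p4 :
  forall (J : R -> Prop) (f N : R -> R -> vec3),
    is_open_interval J -> J 0 ->
    ps_front_with J f N -> asymptotic J f N -> chebyshev J f ->
    exists (alpha beta : R -> R) (f_eta : R -> R -> vec3)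
           (A : vec3 -> vec3) (b : vec3),
      (forall s, J s -> continuous alpha s /\ continuous beta s) /\
      is_f_eta J alpha beta f_eta /\
      rotation A /\
      (forall x y, J x -> J y -> f x y = vadd (A (f_eta x y)) b) /\
      (normalized f N -> (forall v, A v = v) /\ b = vzero).
Proof.
  intros J f N HJ HJ0 HF _ HC.
  destruct (rotation_to_e3 (N 0 0) (normal_unit J f N HF 0 0 HJ0 HJ0)) as [R0 [sgn [HR [Hs [Hn HR1]]]]].
  set (g := fun x y => unsu (rot R0 (su (vadd (f x y) (vopp (f 0 0)))))).
  pose proof (proj1 (proj1 HF)) as f1. pose proof (proj1 (proj2 HF)) as f2.
  pose proof (proj1 (proj1 (proj1 (proj2 (proj2 HF))))) as N1.
  destruct (frame_f_eta J HJ HJ0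
    (fun x y => su (dx f x y)) (fun x y => su (dy f x y)) (fun x y => su (N x y))
    (fun x y => su (dy (dx f) x y)) (kappa f N))
    with (R0 := R0) (sgn := sgn) (F := fun x y => su (f x y)) (g := g)
    as [al [be [Cab Heta]]]; try assumption.
  - apply (joint_cont_1 J (fun x y => su (dx f x y)) 0); [|exact HJ0].
    intros x y Hx Hy. apply continuous_su, (proj1 (proj2 f1)); assumption.
  - intros x Hx. apply (joint_cont_2 J (fun x y => su (dy f x y)) x); [|exact Hx].
    intros u v Hu Hv. apply continuous_su, (proj2 (proj2 f1)); assumption.
  - intros x y Hx Hy. apply is_derive_su, (C1M_dxdy J); assumption.
  - intros x y Hx Hy. rewrite (proj2 (proj2 (proj2 (proj2 f2)))) by assumption.
    apply is_derive_su, (C1M_dydx J f); assumption.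
  - intros x y Hx Hy. apply continuous_su, (proj1 (proj2 (proj2 f2))); assumption.
  - intros x y Hx Hy. apply (kappa_cont J); assumption.
  - intros x y Hx Hy. rewrite <- su_cross, <- (normal_dx_cross J HJ f N HF x y Hx Hy).
    apply is_derive_su, (C1_dx J); assumption.
  - intros x y Hx Hy. rewrite <- su_cross, <- (normal_dy_cross J HJ f N HF x y Hx Hy).
    apply is_derive_su, (C1_dy J); assumption.
  - intros x y Hx Hy. rewrite <- su_cross. f_equal. apply (front_dxdy_cross J HJ f N HF x y Hx Hy).
  - intros x y Hx Hy. rewrite <- su_vscal. f_equal. apply (front_dxdy_normal J HJ f N HF x y Hx Hy).
  - intros; apply skew_su.
  - intros; apply skew_su.
  - intros; apply skew_su.
  - intros x y Hx Hy. apply anticommute_of_dot, (front_normal_dx J f N HF x y Hx Hy).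
  - intros x y Hx Hy. apply anticommute_of_dot, (front_normal_dy J f N HF x y Hx Hy).
  - intros x y Hx Hy. apply mul_sq_of_dot, HC; assumption.
  - intros x y Hx Hy. apply mul_sq_of_dot, HC; assumption.
  - intros x y Hx Hy. apply is_derive_su, (C1_dx J); assumption.
  - intros x y Hx Hy. apply is_derive_su, (C1_dy J); assumption.
  - intros x y Hx Hy. unfold g. rewrite rot_su by exact HR. f_equal. exact (su_minus (f x y) (f 0 0)).
  - exists al, be, g, (fun v => unsu (rot (adj R0) (su v))), (f 0 0).
    split; [exact Cab | split; [exact Heta | split; [|split]]].
    + apply rotation_of_SU, SU_adj, HR.
    + intros x y Hx Hy. unfold g. rewrite rot_su, rot_rot, unsu_su by exact HR.
      generalize (f x y) (f 0 0). vring.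
    + intros [H0 HN]. split; [|exact H0].
      intros v. rewrite (HR1 HN). unfold rot. rewrite !adj_1, mul_1_l, mul_1_r. apply unsu_su.
Qed.
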